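(* Let $g\in L^2(\mathbb R^* )$ satisfy $\int_{\mathbb R^*}\big||\nu|^{1/2}g(\nu)\big|^2d\mu_{\mathbb R^*}(\nu)=1$ and let $\eta\in L^2(\widehat{\mathbb R^2})$ satisfy $\|\eta\|_{L^2(\widehat{\mathbb R^2})}=1$. Let $E\in L^2\big(K,L^2(\mathbb R^* )\big)$ be defined as $$E[0,L](\nu)=\frac{\overline{\eta}\big((1,0)L^{-1}\big)}{|\det(L)|}\,g(\nu),\quad\text{for each }[0,L]\in K\text{ and }\nu\in\mathbb R^*.$$ Define $V_EF[x,A]=\langle F,\sigma[x,A]E\rangle_{L^2(K,L^2(\mathbb R^* ))}$ for $[x,A]\in G_2$ and $F\in L^2\big(K,L^2(\mathbb R^* )\big)$. Then $V_E$ is a linear isometry of $L^2\big(K,L^2(\mathbb R^* )\big)$ into $L^2(G_2)$ that intertwines $\sigma$ with the left regular representation $\lambda_{G_2}$. In particular, $\sigma$ is a square-integrable representation of $G_2$.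
   Context: $\mathbb R^2$ denotes column vectors, $\widehat{\mathbb R^2}$ row vectors with Lebesgue measure; $\|\omega\|$ is the Euclidean norm. $G_2=\{[x,A]:x\in\mathbb R^2,A\in\mathrm{GL}_2(\mathbb R)\}$ has product $[x,A][y,B]=[x+Ay,AB]$ and left Haar measure $\frac{dx\,d\mu_{\mathrm{GL}_2(\mathbb R)}(A)}{|\det A|}$, where $\mu_{\mathrm{GL}_2(\mathbb R)}$ is Lebesgue measure on the four entries divided by $|\det A|^2$. The left regular representation of $G_2$ on $L^2(G_2)$ is $\lambda_{G_2}(x)f(y)=f(x^{-1}y)$. $\mathbb R^*=\mathbb R\setminus\{0\}$ is the multiplicative group with Haar measure $d\mu_{\mathbb R^*}(t)=dt/|t|$. $K_0=\left\{\begin{pmatrix}s&-t\\ t&s\end{pmatrix}:s,t\in\mathbb R,\ s^2+t^2>0\right\}$, $K=\{[0,M]:M\in K_0\}\subset G_2$. $\mathcal O=\widehat{\mathbb R^2}\setminus\{(0,0)\}$, and $\gamma:\mathcal O\to K_0$ is the homeomorphism $\gamma(\omega)=\frac1{\|\omega\|^2}\begin{pmatrix}\omega_1&-\omega_2\\ \omega_2&\omega_1\end{pmatrix}$ (so $(1,0)\gamma(\omega)^{-1}=\omega$). Haar measure on $K$ is given by $\int_Kf\,d\mu_K=\int_{\widehat{\mathbb R^2}}f[0,\gamma(\omega)]\frac{d\omega}{\|\omega\|^2}$. For $\omega\in\mathcal O$, $A\in\mathrm{GL}_2(\mathbb R)$, the reals $u_{\omega,A}$, $v_{\omega,A}$ are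 defined by $\gamma(\omega)^{-1}A\gamma(\omega A)=\begin{pmatrix}1&0\\ u_{\omega,A}&v_{\omega,A}\end{pmatrix}$. $\sigma$ is the unitary representation of $G_2$ on $L^2(K,L^2(\mathbb R^* ))$ given by $$\big(\sigma[x,A]F[0,\gamma(\omega)]\big)(t)=\frac{|\det A|^{1/2}\|\omega\|}{\|\omega A\|}e^{2\pi i(\omega x+t^{-1}u_{\omega,A})}\big(F[0,\gamma(\omega A)]\big)(v_{\omega,A}^{-1}t)$$ for a.e. $\omega\in\mathcal O$, a.e. $t\in\mathbb R^*$. A unitary representation $\pi$ of a locally compact group $G$ on $\mathcal H_\pi$ is square-integrable if it is irreducible and there is a nonzero $\xi\in\mathcal H_\pi$ such that $x\mapsto\langle\xi,\pi(x)\xi\rangle$ is in $L^2(G)$. A bounded operator $T$ intertwines $\pi$ with $\pi'$ if $T\pi(x)=\pi'(x)T$ for all $x\in G$.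
   Formalization: That E lies in L²(K, L²(R* )) is assumed rather than derived: it fails for some admissible η, e.g. η(ω)=c/(1+‖ω‖²), because ‖E‖² = ‖g‖²∫|η(ω)|²‖ω‖²dω may be infinite. *)

(* Defs.v *)
From HB Require Import structures.
From mathcomp Require Import all_boot all_order all_algebra.
From mathcomp Require Import generic_quotient ring_quotient.
From mathcomp Require Import complex.
From mathcomp Require Import ring lra.
From mathcomp Require Import all_classical all_reals all_analysis.
From mathcomp Require Import measurable_realfun.

Set Implicit Arguments.
Unset Strict Implicit.
Unset Printing Implicit Defensive.

Import Order.TTheory GRing.Theory Num.Theory.
Import numFieldNormedType.Exports.

Local Open Scope classical_set_scope.
Local Open Scope ring_scope.
Local Open Scope quotient_scope.

(* An inner product space is a complex vector space V with dot : {dot V for conjc},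
   linear in its first argument and conjugate-linear in its second. *)
Section inner_product.
Context (R : realType) (V : lmodType R[i]) (dot : {dot V for @conjc R}).
Implicit Types u v w : V.

Definition dnorm v : R := complex.Re (dot v v).

Definition hnorm v : R := Num.sqrt (dnorm v).

Let re u v : R := complex.Re (dot u v).

Lemma dotC u v : dot u v = (dot v u)^*%C.
Proof. by rewrite (hermitian_subproof (s:=dot) u v) expr0 mul1r. Qed.

Lemma dotDl u v w : dot (u + v) w = dot u w + dot v w.
Proof. exact: linearDl. Qed.

Lemma dotZl a u w : dot (a *: u) w = a * dot u w.
Proof. exact: linearZl_LR. Qed.

Lemma dotDr u v w : dot w (u + v) = dot w u + dot w v.
Proof. by rewrite dotC dotDl rmorphD/= -!dotC. Qed.

Lemma dotZr a u w : dot w (a *: u) = a^*%C * dot w u.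
Proof. by rewrite dotC dotZl rmorphM/= -dotC. Qed.

Lemma Im_dotvv v : complex.Im (dot v v) = 0.
Proof.
have := dotC v v; case: (dot v v) => a b [] /= /esym/eqP.
by rewrite -subr_eq0 -opprD oppr_eq0 -mulr2n mulrn_eq0 => /eqP.
Qed.

Lemma dnorm_gt0 v : v != 0 -> 0 < dnorm v.
Proof.
move=> /(neq0_dnorm_gt0 (s:=dot)); rewrite /dnorm.
by case: (dot v v) => a b /=; rewrite ltcE /= => /andP[_].
Qed.

Lemma dnorm0 : dnorm 0 = 0.
Proof. by rewrite /dnorm -(scale0r 0) dotZl mul0r. Qed.

Lemma dnorm_ge0 v : 0 <= dnorm v.
Proof. by have [->|/dnorm_gt0/ltW//] := eqVneq v 0; rewrite dnorm0. Qed.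

Lemma dnorm_eq0 v : dnorm v = 0 -> v = 0.
Proof. by apply: contra_eq => /dnorm_gt0; rewrite lt0r => /andP[]. Qed.

Lemma dnormZ a v : dnorm (a *: v) = (complex.Re a ^+ 2 + complex.Im a ^+ 2) * dnorm v.
Proof.
rewrite /dnorm dotZl dotZr mulrA; have := Im_dotvv v.
case: a (dot v v) => a b [c d] /= ->.
by rewrite !mulr0 subr0 mulrN opprK !expr2.
Qed.

Lemma ReZ (x : R) z : complex.Re (x%:C%C * z) = x * complex.Re z.
Proof. by case: z => a b /=; rewrite mul0r subr0. Qed.

Lemma dnormZr (x : R) v : dnorm (x%:C%C *: v) = x ^+ 2 * dnorm v.
Proof. by rewrite dnormZ /= expr0n addr0. Qed.

Lemma reC u v : re u v = re v u.
Proof. by rewrite /re dotC; case: (dot v u). Qed.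

Lemma dnormD u v : dnorm (u + v) = dnorm u + 2 * re u v + dnorm v.
Proof.
rewrite /dnorm dotDl !dotDr !raddfD /= mulr_natl mulr2n.
by rewrite -/(re u v) -/(re v u) (reC v u) !addrA.
Qed.

Lemma dnormN v : dnorm (- v) = dnorm v.
Proof. by rewrite -scaleN1r dnormZ /= oppr0 expr0n addr0 sqrrN expr1n mul1r. Qed.

Lemma reNr u v : re u (- v) = - re u v.
Proof. by rewrite /re linearNr raddfN. Qed.

Lemma dnormB u v : dnorm (u - v) = dnorm u - 2 * re u v + dnorm v.
Proof. by rewrite dnormD dnormN reNr mulrN. Qed.

Lemma dnormD_le u v : dnorm (u + v) <= 2 * dnorm u + 2 * dnorm v.
Proof.
have := dnorm_ge0 (u - v); rewrite dnormB dnormD; lra.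
Qed.

Lemma re_polar u v : re u v = (dnorm (u + v) - dnorm (u - v)) / 4.
Proof. rewrite dnormB dnormD; lra. Qed.

Lemma re_CS u v : re u v ^+ 2 <= dnorm u * dnorm v.
Proof.
have [->|v0] := eqVneq v 0.
  by rewrite dnorm0 mulr0 /re -(scale0r 0) dotZr conjc0 mul0r expr0n.
have pv := dnorm_gt0 v0.
have := dnorm_ge0 (u - (re u v / dnorm v)%:C%C *: v).
rewrite dnormB dnormZr {1}/re dotZr conjc_real ReZ -/(re u v).
have -> : dnorm u - 2 * (re u v / dnorm v * re u v) +
   (re u v / dnorm v) ^+ 2 * dnorm v = dnorm u - re u v ^+ 2 / dnorm v.
  by field; rewrite gt_eqF.
by rewrite subr_ge0 ler_pdivrMr.
Qed.

Lemma cvg_dnorm (s : nat -> V) v : dnorm (v - s n) @[n --> \oo] --> 0 ->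
  dnorm (s n) @[n --> \oo] --> dnorm v.
Proof.
move=> sv.
have sE n : dnorm (s n) = dnorm v - 2 * re v (v - s n) + dnorm (v - s n).
  by rewrite -dnormB opprB addrC subrK.
rewrite (_ : dnorm v = dnorm v - 2 * 0 + 0); last by rewrite mulr0 subr0 addr0.
under eq_fun do rewrite sE.
apply: cvgD => //; apply: cvgB; first exact: cvg_cst.
apply: cvgMl_tmp.
have cs n : `|re v (v - s n)| <= Num.sqrt (dnorm v * dnorm (v - s n)).
  by rewrite -sqrtr_sqr ler_sqrt ?mulr_ge0 ?dnorm_ge0// re_CS.
apply: norm_cvg0.
apply: (@squeeze_cvgr _ _ _ _ (cst 0) (fun n => Num.sqrt (dnorm v * dnorm (v - s n)))).
- by apply: nearW => n; rewrite cs normr_ge0.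
- exact: cvg_cst.
- have -> : 0 = Num.sqrt (dnorm v * 0) by rewrite mulr0 sqrtr0.
  apply: (@continuous_cvg _ _ _ _ _ _ Num.sqrt); first exact: sqrt_continuous.
  exact: cvgMl_tmp.
Qed.

End inner_product.

Section L2_functions.
Context d (X : measurableType d) (R : realType).
Variable mu : {measure set X -> \bar R}.
Context (V : lmodType R[i]) (dot : {dot V for @conjc R}).
Implicit Types f g : X -> V.

(* Bochner measurability: f is a pointwise limit of measurable simple functions. *)
Definition strongly_measurable f := exists s : nat -> {fimfun X >-> V},
  (forall n v, measurable (s n @^-1` [set v])) /\
  (forall x, dnorm dot (f x - s n x) @[n --> \oo] --> 0).

Definition square_integrable_fun f :=
  strongly_measurable f /\ (\int[mu]_x (dnorm dot (f x))%:E < +oo)%E.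

Lemma simple_measurable (s : {fimfun X >-> V}) (A : set V) :
  (forall v, measurable (s @^-1` [set v])) -> measurable (s @^-1` A).
Proof.
move=> ms; have -> : s @^-1` A = \bigcup_(v in range s `&` A) (s @^-1` [set v]).
  apply/seteqP; split=> [x Ax|x [v [_ Av] /= ->]//].
  by exists (s x) => //; split => //; exists x.
by apply: fin_bigcup_measurable => //; exact: finite_setIl.
Qed.

Lemma measurable_dnorm f : strongly_measurable f ->
  measurable_fun setT (fun x => dnorm dot (f x)).
Proof.
move=> [s [ms sf]].
apply: (@measurable_fun_cvg _ _ _ _ (fun n x => dnorm dot (s n x))).
- by move=> n _ B mB; rewrite setTI; exact: (@simple_measurable (s n) (dnorm dot @^-1` B)).
- by move=> x _; exact: cvg_dnorm.
Qed.

Lemma strongly_measurable0 : strongly_measurable 0.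
Proof.
exists (fun=> 0); split=> [_ v|x].
  rewrite fimfun0 preimage_cst; case: ifPn => _; [exact: measurableT|exact: measurable0].
by under eq_fun do rewrite subr0 dnorm0; exact: cvg_cst.
Qed.

Lemma strongly_measurableD f g :
  strongly_measurable f -> strongly_measurable g -> strongly_measurable (f + g).
Proof.
move=> [s [ms sf]] [t [mt tg]]; exists (fun n => s n + t n); split=> [n v|x].
  have -> : (s n + t n) @^-1` [set v] =
      \bigcup_(u in range (s n)) (s n @^-1` [set u] `&` t n @^-1` [set v - u]).
    apply/seteqP; split=> [x /= <-|x [u _ /= [su tu]]].
      by exists (s n x); [exists x|split=> //=; rewrite addrAC subrr add0r].
    by change (s n x + t n x = v); rewrite su tu addrC subrK.
  by apply: fin_bigcup_measurable => // u _; exact: measurableI.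
apply: (@squeeze_cvgr _ _ _ _ (cst 0)
  (fun n => 2 * dnorm dot (f x - s n x) + 2 * dnorm dot (g x - t n x))).
- apply: nearW => n; rewrite dnorm_ge0/=.
  have -> : (f + g) x - (s n + t n) x = (f x - s n x) + (g x - t n x).
    by rewrite /= opprD addrACA.
  exact: dnormD_le.
- exact: cvg_cst.
- have -> : 0 = 2 * 0 + 2 * 0 :> R by rewrite mulr0 addr0.
  by apply: cvgD; apply: cvgMl_tmp.
Qed.

Lemma strongly_measurableZ (a : R[i]) f :
  strongly_measurable f -> strongly_measurable (a *: f).
Proof.
move=> [s [ms sf]]; exists (fun n => [the {fimfun X >-> V} of *:%R a \o s n]).
split=> [n v|x].
  by rewrite /= comp_preimage; exact: simple_measurable.
under eq_fun do rewrite /= -scalerBr dnormZ.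
set c := complex.Re a ^+ 2 + complex.Im a ^+ 2.
rewrite (_ : 0 = c * 0); last by rewrite mulr0.
by apply: cvgMl_tmp.
Qed.

Definition L2_pred : {pred X -> V} := mem [set f | square_integrable_fun f].

Lemma L2_pred_submod : submod_closed L2_pred.
Proof.
split=> [|a f g]; rewrite !inE/=.
  split; first exact: strongly_measurable0.
  by under eq_integral do rewrite dnorm0; rewrite integral0.
move=> [mf f2] [mg g2].
have maf := strongly_measurableZ a mf.
split; first exact: strongly_measurableD.
set c := complex.Re a ^+ 2 + complex.Im a ^+ 2.
have c0 : 0 <= c by rewrite addr_ge0// sqr_ge0.
apply: (@le_lt_trans _ _ (\int[mu]_x ((2 * c)%:E * (dnorm dot (f x))%:E +
    2%:E * (dnorm dot (g x))%:E))%E).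
  apply: ge0_le_integral => //.
  - by move=> x _; rewrite lee_fin dnorm_ge0.
  - apply/measurable_EFinP; exact: (measurable_dnorm (strongly_measurableD maf mg)).
  - apply: emeasurable_funD; apply/measurable_EFinP/measurable_funM => //;
     exact: measurable_dnorm.
  - move=> x _; rewrite -!EFinM -EFinD lee_fin -mulrA -dnormZ.
    exact: dnormD_le.
rewrite ge0_integralD//; last 4 first.
- by move=> x _; rewrite -EFinM lee_fin mulr_ge0 ?dnorm_ge0// mulr_ge0.
- by apply/measurable_EFinP/measurable_funM => //; exact: measurable_dnorm.
- by move=> x _; rewrite -EFinM lee_fin mulr_ge0 ?dnorm_ge0.
- by apply/measurable_EFinP/measurable_funM => //; exact: measurable_dnorm.
rewrite !ge0_integralZl_EFin//; first by rewrite lte_add_pinfty// lte_mul_pinfty// lee_fin mulr_ge0.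
all: try by [move=> x _; rewrite lee_fin dnorm_ge0|rewrite mulr_ge0|
  apply/measurable_EFinP; exact: measurable_dnorm].
Qed.

HB.instance Definition _ :=
  GRing.isSubmodClosed.Build R[i] (X -> V) L2_pred L2_pred_submod.

Record L2_function := MkL2Function {
  L2_function_val :> X -> V;
  L2_functionP : L2_function_val \in L2_pred }.

HB.instance Definition _ := [isSub for L2_function_val].
HB.instance Definition _ := [Choice of L2_function by <:].
HB.instance Definition _ := [SubChoice_isSubLmodule of L2_function by <:].

Definition null_L2 : {pred L2_function} :=
  mem [set f : L2_function | \forall x \ae mu, f x = 0].

Lemma null_L2_submod : submod_closed null_L2.
Proof.
split=> [|a f g]; rewrite !inE/=; first by apply: nearW.
move=> f0 g0; apply: filterS2 f0 g0 => x fx gx.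
by change (a *: f x + g x = 0); rewrite fx gx scaler0 addr0.
Qed.

HB.instance Definition _ :=
  GRing.isSubmodClosed.Build R[i] L2_function null_L2 null_L2_submod.

(* L^2(X, mu; V): square-integrable functions modulo equality mu-a.e. *)
Definition L2 : Type := Quotient.quot null_L2.

HB.instance Definition _ := EqQuotient.on L2.
HB.instance Definition _ := Choice.on L2.
HB.instance Definition _ := GRing.Zmodule.on L2.

(* A representative, determined only mu-a.e. *)
Definition L2_fun (q : L2) : X -> V := L2_function_val (repr q).

Lemma L2_piP (f g : L2_function) :
  \pi_L2 f = \pi_L2 g <-> \forall x \ae mu, f x = g x.
Proof.
split=> [/eqP|fg].
  rewrite -Quotient.idealrBE inE/=; apply: filterS => x /eqP.
  by rewrite [_ - _ == 0]subr_eq0 => /eqP.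
apply/eqP; rewrite -Quotient.idealrBE inE/=; apply: filterS fg => x fgx.
by change (f x - g x = 0); rewrite fgx subrr.
Qed.

Lemma L2_fun_pi (f : L2_function) : \forall x \ae mu, L2_fun (\pi_L2 f) x = f x.
Proof. by apply/L2_piP; rewrite reprK. Qed.

Lemma L2_eqP (p q : L2) : p = q <-> \forall x \ae mu, L2_fun p x = L2_fun q x.
Proof. by rewrite -{1}[p]reprK -{1}[q]reprK; exact: L2_piP. Qed.

Lemma L2_funP (q : L2) : square_integrable_fun (L2_fun q).
Proof. by have := L2_functionP (repr q); rewrite inE. Qed.

Definition L2_scale (a : R[i]) (q : L2) : L2 := \pi_L2 (a *: repr q).

Lemma L2_scale_pi a (f : L2_function) : L2_scale a (\pi_L2 f) = \pi_L2 (a *: f).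
Proof.
apply/L2_piP; apply: filterS (L2_fun_pi f) => x fx.
by change (a *: L2_fun (\pi_L2 f) x = a *: f x); rewrite fx.
Qed.

Lemma L2_piD (f g : L2_function) : \pi_L2 (f + g) = \pi_L2 f + \pi_L2 g :> L2.
Proof. exact: Quotient.pi_add. Qed.

Let L2_scaleA a b q : L2_scale a (L2_scale b q) = L2_scale (a * b) q.
Proof. by rewrite /L2_scale -/(L2_scale a _) L2_scale_pi scalerA. Qed.

Let L2_scale1 : left_id 1 L2_scale.
Proof. by move=> q; rewrite /L2_scale scale1r reprK. Qed.

Let L2_scaleDr : right_distributive L2_scale +%R.
Proof.
move=> a p q; rewrite -[p]reprK -[q]reprK -L2_piD.
by rewrite !L2_scale_pi scalerDr L2_piD.
Qed.

Let L2_scaleDl q : {morph L2_scale^~ q : a b / a + b}.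
Proof. by move=> a b; rewrite /L2_scale scalerDl L2_piD. Qed.

HB.instance Definition _ := GRing.Zmodule_isLmodule.Build R[i] L2
  L2_scaleA L2_scale1 L2_scaleDr L2_scaleDl.

Lemma L2_funD (p q : L2) : \forall x \ae mu, L2_fun (p + q) x = L2_fun p x + L2_fun q x.
Proof.
have -> : p + q = \pi_L2 (repr p + repr q) by rewrite L2_piD !reprK.
exact: L2_fun_pi.
Qed.

Lemma L2_funZ a (q : L2) : \forall x \ae mu, L2_fun (a *: q) x = a *: L2_fun q x.
Proof. exact: L2_fun_pi. Qed.

(* The class of f; junk value 0 when f is not square-integrable. *)
Definition L2_of (f : X -> V) : L2 := \pi_L2 (insubd 0 f).

Lemma L2_ofE f : square_integrable_fun f -> \forall x \ae mu, L2_fun (L2_of f) x = f x.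
Proof.
move=> f2; apply: filterS (L2_fun_pi (insubd 0 f)) => x ->.
by have -> : L2_function_val (insubd (0 : L2_function) f) = f by apply: insubdK; rewrite inE.
Qed.

Lemma integrable_dnorm (f : X -> V) : square_integrable_fun f ->
  mu.-integrable setT (EFin \o (fun x => dnorm dot (f x))).
Proof.
move=> [mf f2]; apply/integrableP; split.
  by apply/measurable_EFinP; exact: measurable_dnorm.
by under eq_integral do rewrite /= ger0_norm ?dnorm_ge0//.
Qed.

Lemma square_integrable_funP (a : R[i]) (f g : X -> V) : square_integrable_fun f ->
  square_integrable_fun g -> square_integrable_fun (fun x => a *: f x + g x).
Proof.
move=> f2 g2; have [_ /(_ a f g)] := L2_pred_submod; rewrite !inE/=; exact.
Qed.

Lemma integrable_Re_dot (f g : X -> V) :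
  square_integrable_fun f -> square_integrable_fun g ->
  mu.-integrable setT (EFin \o (fun x => complex.Re (dot (f x) (g x)))).
Proof.
move=> f2 g2.
have i1 := integrable_dnorm (square_integrable_funP 1 f2 g2).
have i2 := integrable_dnorm (square_integrable_funP (-1) g2 f2).
have := integrableB measurableT i1 i2 => /(integrableZl measurableT 4^-1).
apply: eq_integrable => // x _ /=; rewrite -EFinB -EFinM; congr (_%:E).
rewrite re_polar scale1r scaleN1r mulrC; congr ((_ - dnorm _ _) / _).
by rewrite addrC.
Qed.

Lemma Im_dot u v : complex.Im (dot u v) = complex.Re (dot ((0 -i* 1)%C *: u) v).
Proof. by rewrite dotZl; case: (dot u v) => a b /=; rewrite mul0r mulN1r sub0r opprK. Qed.

Lemma integrable_Im_dot (f g : X -> V) :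
  square_integrable_fun f -> square_integrable_fun g ->
  mu.-integrable setT (EFin \o (fun x => complex.Im (dot (f x) (g x)))).
Proof.
move=> f2 g2; have s0 : square_integrable_fun (fun=> 0).
  by have [] := L2_pred_submod; rewrite inE.
have := integrable_Re_dot (square_integrable_funP (0 -i* 1)%C f2 s0) g2.
by apply: eq_integrable => // x _ /=; rewrite Im_dot addr0.
Qed.

Definition cintegral (h : X -> R[i]) : R[i] :=
  ((\int[mu]_x complex.Re (h x)) +i* (\int[mu]_x complex.Im (h x)))%C.

Definition L2_dot (p q : L2) : R[i] := cintegral (fun x => dot (L2_fun p x) (L2_fun q x)).

Lemma ae_eq_Rintegral (h k : X -> R) : mu.-integrable setT (EFin \o h) ->
  mu.-integrable setT (EFin \o k) -> (\forall x \ae mu, h x = k x) ->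
  \int[mu]_x h x = \int[mu]_x k x.
Proof.
move=> hi ki hk; rewrite /Rintegral; congr fine; apply: ae_eq_integral => //.
- exact: measurable_int hi.
- exact: measurable_int ki.
- by apply: filterS hk => x hkx _; rewrite hkx.
Qed.

Lemma cintegral_dotC (f g : X -> V) :
  square_integrable_fun f -> square_integrable_fun g ->
  cintegral (fun x => dot (f x) (g x)) = (cintegral (fun x => dot (g x) (f x)))^*%C.
Proof.
move=> f2 g2; rewrite /cintegral /=; congr Complex.
  by apply: eq_Rintegral => x _; rewrite dotC; case: (dot (g x) _).
rewrite -mulN1r -RintegralZl//; last exact: integrable_Im_dot.
by apply: eq_Rintegral => x _; rewrite dotC; case: (dot (g x) _) => a b /=; rewrite mulN1r.
Qed.

Lemma L2_dot_linearl (q : L2) : GRing.linear_for *%R (L2_dot^~ q).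
Proof.
move=> a p p'; rewrite /L2_dot /cintegral.
have [fp fp' fq] := And3 (L2_funP p) (L2_funP p') (L2_funP q).
have fpa := L2_funP (a *: p + p').
have E : \forall x \ae mu, dot (L2_fun (a *: p + p') x) (L2_fun q x) =
    a * dot (L2_fun p x) (L2_fun q x) + dot (L2_fun p' x) (L2_fun q x).
  apply: filterS2 (L2_funD (a *: p) p') (L2_funZ a p) => x -> ->.
  by rewrite dotDl dotZl.
have i1 := integrable_Re_dot fp fq; have i2 := integrable_Im_dot fp fq.
have i3 := integrable_Re_dot fp' fq; have i4 := integrable_Im_dot fp' fq.
have Z (b : R) (h : X -> R) : mu.-integrable setT (EFin \o h) ->
    mu.-integrable setT (EFin \o (fun x => b * h x)).
  by move=> hi; apply: eq_integrable (integrableZl measurableT b hi).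
have D (h k : X -> R) : mu.-integrable setT (EFin \o h) ->
    mu.-integrable setT (EFin \o k) -> mu.-integrable setT (EFin \o (fun x => h x + k x)).
  by move=> hi ki; apply: eq_integrable (integrableD measurableT hi ki).
case: a E fpa => a b E fpa.
pose re x := complex.Re (dot (L2_fun p x) (L2_fun q x)).
pose im x := complex.Im (dot (L2_fun p x) (L2_fun q x)).
pose re' x := complex.Re (dot (L2_fun p' x) (L2_fun q x)).
pose im' x := complex.Im (dot (L2_fun p' x) (L2_fun q x)).
rewrite -/re -/im -/re' -/im'.
apply/eqP; rewrite eq_complex /=; apply/andP; split; apply/eqP.
- transitivity (\int[mu]_x ((a * re x + (- b) * im x) + re' x)).
    apply: ae_eq_Rintegral; first exact: integrable_Re_dot.
      by apply: (D) => //; apply: (D); apply: (Z).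
    apply: filterS E => x ->; rewrite raddfD /= /re /im.
    by case: (dot (L2_fun p x) _) => c e /=; rewrite mulNr.
  rewrite RintegralD//; last by apply: (D); apply: (Z).
  rewrite RintegralD//; [|exact: (Z)..].
  by rewrite !RintegralZl// mulNr.
- transitivity (\int[mu]_x ((a * im x + b * re x) + im' x)).
    apply: ae_eq_Rintegral; first exact: integrable_Im_dot.
      by apply: (D) => //; apply: (D); apply: (Z).
    apply: filterS E => x ->; rewrite raddfD /= /re /im.
    by case: (dot (L2_fun p x) _) => c e /=.
  rewrite RintegralD//; last by apply: (D); apply: (Z).
  rewrite RintegralD//; [|exact: (Z)..].
  by rewrite !RintegralZl.
Qed.

Let L2_dotC (p q : L2) : L2_dot p q = (-1) ^+ false * (L2_dot q p)^*%C.
Proof. by rewrite expr0 mul1r; apply: cintegral_dotC; exact: L2_funP. Qed.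

Let L2_dot_linearr (q : L2) : GRing.linear_for (@conjc R \; *%R) (L2_dot q).
Proof.
by move=> a p p'; rewrite !(L2_dotC q) !expr0 !mul1r L2_dot_linearl rmorphD rmorphM.
Qed.

Lemma L2_fun0 : \forall x \ae mu, L2_fun 0 x = 0.
Proof. by rewrite -(scale0r 0); apply: filterS (L2_funZ 0 0) => x ->; rewrite scale0r. Qed.

Let L2_dot_gt0 (q : L2) : q != 0 -> 0 < L2_dot q q.
Proof.
move=> q0; have iq := integrable_dnorm (L2_funP q).
rewrite ltcE /=; apply/andP; split.
  rewrite /Rintegral (eq_integral (cst 0%E)) ?integral0//= => x _.
  by rewrite Im_dotvv.
rewrite lt0r Rintegral_ge0 ?andbT; last by move=> x _; exact: dnorm_ge0.
apply: contra q0 => /eqP i0; apply/eqP/L2_eqP.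
have : (\int[mu]_x `|(dnorm dot (L2_fun q x))%:E| = 0)%E.
  under eq_integral do rewrite /= ger0_norm ?dnorm_ge0//.
  by rewrite -[LHS]fineK; [congr (_%:E)|exact: integrable_fin_num iq].
move/(ae_eq_integral_abs _ measurableT (measurable_int _ iq)) => q0.
apply: filterS2 q0 L2_fun0 => x q0x ->.
by apply: (@dnorm_eq0 _ _ dot); have [] := q0x I.
Qed.

HB.instance Definition _ := bilinear_isBilinear.Build R[i] L2 L2 R[i] *%R (@conjc R \; *%R)
  L2_dot (L2_dot_linearl, L2_dot_linearr).
HB.instance Definition _ := isHermitianSesquilinear.Build R[i] L2 false (@conjc R) L2_dot L2_dotC.
HB.instance Definition _ := isDotProduct.Build R[i] L2 L2_dot L2_dot_gt0.
End L2_functions.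

Section weighted_image.
Context d1 d2 (X : measurableType d1) (Y : measurableType d2) (R : realType).
Variables (m : {measure set X -> \bar R}) (w : X -> R) (phi : X -> Y).

(* The image under phi of the measure w dm, w being its density. *)
Definition weighted_image (B : set Y) : \bar R :=
  (\int[m]_(x in phi @^-1` B) (w x)%:E)%E.

Hypotheses (mphi : measurable_fun setT phi) (mw : measurable_fun setT w).
Hypothesis w0 : forall x, 0 <= w x.

Lemma weighted_image0 : weighted_image set0 = 0%E.
Proof. by rewrite /weighted_image preimage_set0 integral_set0. Qed.

Lemma weighted_image_ge0 B : (0 <= weighted_image B)%E.
Proof. by apply: integral_ge0 => x _; rewrite lee_fin. Qed.

Lemma weighted_image_sigma_additive : semi_sigma_additive weighted_image.
Proof.
move=> F mF tF mUF; rewrite /weighted_image preimage_bigcup.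
apply: (@semi_sigma_additive_nng_induced _ _ _ m (EFin \o w)).
- exact/measurable_EFinP.
- by move=> x; rewrite /= lee_fin.
- by move=> n; rewrite -[X in measurable X]setTI; exact: mphi.
- apply/trivIsetP => /= i j _ _ ij; rewrite -preimage_setI.
  by move/trivIsetP : tF => /(_ _ _ _ _ ij) ->//; rewrite preimage_set0.
- by rewrite -preimage_bigcup -[X in measurable X]setTI; exact: mphi.
Qed.
End weighted_image.

Section initial_sigma_algebra.
Context d (T : Type) (Y : measurableType d) (f : T -> Y).

Definition initial_measurable : set (set T) := preimage_set_system setT f measurable.

Lemma initial_measurableP A :
  initial_measurable A <-> exists2 B, measurable B & f @^-1` B = A.
Proof. by split=> -[B mB <-]; exists B => //; rewrite setTI. Qed.

Lemma initial_measurable0 : initial_measurable set0.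
Proof. by apply/initial_measurableP; exists set0. Qed.

Lemma initial_measurableC A : initial_measurable A -> initial_measurable (~` A).
Proof.
move=> /initial_measurableP[B mB <-]; apply/initial_measurableP.
by exists (~` B); [exact: measurableC|].
Qed.

Lemma initial_measurable_bigcup (F : (set T)^nat) :
  (forall i, initial_measurable (F i)) -> initial_measurable (\bigcup_i F i).
Proof.
move=> mF; have /choice[G GF] i : exists B, measurable B /\ f @^-1` B = F i.
  by have /initial_measurableP[B mB BF] := mF i; exists B.
apply/initial_measurableP; exists (\bigcup_i G i).
  by apply: bigcupT_measurable => i; have [] := GF i.
by rewrite preimage_bigcup; apply: eq_bigcupr => i _; have [] := GF i.
Qed.
End initial_sigma_algebra.

Definition initial_display : measure_display -> measure_display.
Proof. exact. Qed.

Lemma measurable_insubd d d1 d2 (X : measurableType d) (T : measurableType d1)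
    (P : pred T) (S : subType P) (S' : measurableType d2) (h : S -> S') (u : S)
    (f : X -> T) :
  (forall B : set S', measurable B -> initial_measurable (val : S -> T) (h @^-1` B)) ->
  measurable_fun setT f -> measurable [set x | P (f x)] ->
  measurable_fun setT (fun x => h (insubd u (f x))).
Proof.
move=> mh mf mP _ B /mh/initial_measurableP[A mA AB]; rewrite setTI.
have -> : (fun x => h (insubd u (f x))) @^-1` B =
    ([set x | P (f x)] `&` f @^-1` A) `|`
    (~` [set x | P (f x)] `&` [set x | B (h u)]).
  apply/seteqP; split=> x.
    have [Px|Px] := boolP (P (f x)) => Bx.
      left; split=> //; change (A (f x)); rewrite -(insubdK u Px).
      by change ((val @^-1` A) (insubd u (f x))); rewrite AB.
    by right; split=> [|/=]; [exact/negP|move: Bx; rewrite /= /insubd insubN].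
  case=> -[Px Ax].
    change ((h @^-1` B) (insubd u (f x))); rewrite -AB.
    by change (A (val (insubd u (f x)))); rewrite insubdK.
  have {}Px : ~~ P (f x) by apply/negP => Px'; exact: Px.
  by change (B (h (insubd u (f x)))); rewrite /insubd insubN.
apply: measurableU.
  by apply: measurableI => //; rewrite -[X in measurable X]setTI; exact: mf.
apply: measurableI; first exact: measurableC.
have [Bu|Bu] := pselect (B (h u)).
  by rewrite (_ : [set _ | _] = setT)//; apply/seteqP; split.
by rewrite (_ : [set _ | _] = set0)//; apply/seteqP; split.
Qed.

Lemma measurable_invr_ge0 d (T : measurableType d) (R : realType) (f : T -> R) :
  (forall x, 0 <= f x) -> measurable_fun setT f ->
  measurable_fun setT (fun x => (f x)^-1).
Proof.
move=> f0 mf; rewrite (_ : (fun x => _) = (fun y => powR y (-1)) \o f).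
  by apply: measurableT_comp => //; exact: measurable_powR.
by apply/funext => x /=; rewrite powR_inv1.
Qed.

Definition matrix_display : measure_display.
Proof. exact: default_measure_display. Qed.

Section matrix_measurable.
Context (R : realType) (m n : nat).

(* Generated by the entries; this is the Borel sigma-algebra. *)
Definition matrix_measurable : set (set 'M[R]_(m, n)) :=
  <<s \bigcup_(ij in [set: 'I_m * 'I_n])
        preimage_set_system setT (fun M : 'M[R]_(m, n) => M ij.1 ij.2) measurable >>.

Let measurable0 : matrix_measurable set0. Proof. exact: sigma_algebra0. Qed.

Let measurableC A : matrix_measurable A -> matrix_measurable (~` A).
Proof. exact: sigma_algebraC. Qed.

Let measurable_bigcup (F : (set 'M[R]_(m, n))^nat) :
  (forall i, matrix_measurable (F i)) -> matrix_measurable (\bigcup_i F i).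
Proof. exact: sigma_algebra_bigcup. Qed.

HB.instance Definition _ := @isMeasurable.Build matrix_display
  'M[R]_(m, n) matrix_measurable measurable0 measurableC measurable_bigcup.

Lemma measurable_matrix d (X : measurableType d) (f : X -> 'M[R]_(m, n)) :
  (forall i j, measurable_fun setT (fun x => f x i j : measurableTypeR R)) ->
  measurable_fun setT f.
Proof.
move=> mf; apply: measurability => // _ [_ [ij _ [B mB <-]] <-].
by rewrite setTI -comp_preimage; exact: mf.
Qed.

Lemma measurable_entry i j :
  measurable_fun setT (fun M : 'M[R]_(m, n) => M i j : measurableTypeR R).
Proof.
move=> _ B mB; apply: sub_sigma_algebra; exists (i, j) => //.
by exists B.
Qed.
End matrix_measurable.

Section spaces.
Variable R : realType.

Definition complex_dot (z w : R[i]^o) : R[i] := z * w^*%C.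

Let complex_dot_linearl w : GRing.linear_for *%R (complex_dot^~ w).
Proof. by move=> a z z'; rewrite /complex_dot mulrDl -mulrA. Qed.

Let complex_dot_linearr z : GRing.linear_for (@conjc R \; *%R) (complex_dot z).
Proof. by move=> a w w'; rewrite /complex_dot rmorphD rmorphM /= mulrDr mulrCA. Qed.

Let complex_dotC z w : complex_dot z w = (-1) ^+ false * (complex_dot w z)^*%C.
Proof. by rewrite expr0 mul1r /complex_dot rmorphM /= conjcK mulrC. Qed.

Let complex_dot_gt0 z : z != 0 -> 0 < complex_dot z z.
Proof. by move=> z0; rewrite /complex_dot -normCK exprn_gt0// normr_gt0. Qed.

HB.instance Definition _ := bilinear_isBilinear.Build R[i] R[i]^o R[i]^o R[i] *%R
  (@conjc R \; *%R) complex_dot (complex_dot_linearl, complex_dot_linearr).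
HB.instance Definition _ := isHermitianSesquilinear.Build R[i] R[i]^o false
  (@conjc R) complex_dot complex_dotC.
HB.instance Definition _ := isDotProduct.Build R[i] R[i]^o complex_dot complex_dot_gt0.

Definition Rstar : Type := {t : R | t != 0}.

HB.instance Definition _ := SubType.on Rstar.
HB.instance Definition _ := Choice.on Rstar.

Definition Rstar1 : Rstar := exist _ 1 (oner_neq0 R).

HB.instance Definition _ := isPointed.Build Rstar Rstar1.
HB.instance Definition _ := @isMeasurable.Build (initial_display default_measure_display) Rstar
  (initial_measurable (fun t : Rstar => val t : measurableTypeR R))
  (initial_measurable0 _) (@initial_measurableC _ _ _ _)
  (@initial_measurable_bigcup _ _ _ _).

(* The point t of R^*; junk value 1 for t = 0. *)
Definition rstar (t : measurableTypeR R) : Rstar := insubd Rstar1 t.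

(* dt / |t| *)
Definition mu_Rstar : set Rstar -> \bar R :=
  weighted_image lebesgue_measure (fun t => `|t|^-1) rstar.

Let measurable_rstar : measurable_fun setT rstar.
Proof.
apply: (@measurable_insubd _ _ _ _ (measurableTypeR R) _ Rstar Rstar id) => //.
rewrite (_ : [set _ | _] = ~` [set 0]); last by apply/seteqP; split=> x /eqP.
by apply: measurableC; exact: measurable_set1.
Qed.

Let measurable_norminv : measurable_fun setT (fun t : measurableTypeR R => `|t|^-1).
Proof. by apply: measurable_invr_ge0 => //; exact: measurableT_comp. Qed.

Let norminv_ge0 (t : measurableTypeR R) : 0 <= `|t|^-1.
Proof. by rewrite invr_ge0. Qed.

HB.instance Definition _ := isMeasure.Build _ _ _ mu_Rstar
  (weighted_image0 _ _ _) (weighted_image_ge0 _ _ norminv_ge0)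
  (@weighted_image_sigma_additive _ _ _ _ _ _ _ _ measurable_rstar measurable_norminv norminv_ge0).
End spaces.

Section plane.
Variable R : realType.
Local Notation leb := (@lebesgue_measure R).
Local Notation RR := (measurableTypeR R * measurableTypeR R)%type.

Definition lebesgue2 : set RR -> \bar R := (leb \x leb)%E.

HB.instance Definition _ := Measure.on lebesgue2.

Let lebesgue2_sigma_finite : sigma_finite setT lebesgue2.
Proof.
have /sigma_finiteP[F [TF ndF Foo]] := sigma_finiteT leb.
exists (fun n => F n `*` F n).
  rewrite -setXTT TF predeqE => -[x y]; split.
    move=> [/= [n _ Fnx] [k _ Fky]]; exists (maxn n k) => //; split.
    - by move: x Fnx; exact/subsetPset/ndF/leq_maxl.
    - by move: y Fky; exact/subsetPset/ndF/leq_maxr.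
  by move=> [n _ []/= ? ?]; split; exists n.
move=> k; have [? ?] := Foo k; split; first exact: measurableX.
by rewrite /lebesgue2 product_measure1E// lte_mul_pinfty// ge0_fin_numE.
Qed.

HB.instance Definition _ := Measure_isSigmaFinite.Build _ _ _ lebesgue2 lebesgue2_sigma_finite.

Definition rvec2 (p : RR) : 'rV[R]_2 := \row_j (if j == 0 then p.1 else p.2).

Definition cvec2 (p : RR) : 'cV[R]_2 := \col_i (if i == 0 then p.1 else p.2).

Definition mat2 (a b c d : R) : 'M[R]_2 :=
  \matrix_(i, j) (if i == 0 then if j == 0 then a else b
                  else if j == 0 then c else d).

Lemma det_mat2 a b c d : \det (mat2 a b c d) = a * d - b * c.
Proof.
rewrite (expand_det_row (mat2 a b c d) ord0) !big_ord_recl big_ord0 addr0.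
rewrite /cofactor !det_mx11 !mxE /=.
by rewrite /bump /= !addn0 expr0 expr1 mul1r mulN1r mulrN.
Qed.

Definition mx22 (q : RR * RR) : 'M[R]_2 := mat2 q.1.1 q.1.2 q.2.1 q.2.2.

Lemma measurable_rvec2 : measurable_fun setT rvec2.
Proof.
apply: measurable_matrix => i j; under eq_fun do rewrite mxE.
by case: (j == 0); [exact: measurable_fst|exact: measurable_snd].
Qed.

Definition lebesgue_rV2 : set 'rV[R]_2 -> \bar R := pushforward lebesgue2 rvec2.

Let nu : {measure set 'rV[R]_2 -> \bar R} :=
  measure_function_pushforward__canonical__measure_function_Measure
    lebesgue2 measurable_rvec2.

HB.instance Definition _ := Measure.copy lebesgue_rV2 nu.
End plane.

Section affine_group.
Variable R : realType.
Local Notation RR := (measurableTypeR R * measurableTypeR R)%type.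

(* [x, A] is the pair (x, A). *)
Definition G2 : Type := {p : 'cV[R]_2 * 'M[R]_2 | p.2 \in unitmx}.

HB.instance Definition _ := SubType.on G2.
HB.instance Definition _ := Choice.on G2.

Implicit Types g h : G2.

Definition G2_vec g : 'cV[R]_2 := (val g).1.

Definition G2_mx g : 'M[R]_2 := (val g).2.

Lemma G2_mx_unit g : G2_mx g \in unitmx.
Proof. exact: valP g. Qed.

Lemma G2_eq g h : G2_vec g = G2_vec h -> G2_mx g = G2_mx h -> g = h.
Proof.
by move=> gh1 gh2; apply: val_inj; rewrite (surjective_pairing (val g)) [LHS](f_equal2 pair gh1 gh2) -surjective_pairing.
Qed.

Definition G2_one : G2 := exist _ (0, 1%:M) (unitmx1 R 2).

Lemma G2_mul_subproof g h : G2_mx g *m G2_mx h \in unitmx.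
Proof. by rewrite unitmx_mul !G2_mx_unit. Qed.

Definition G2_mul g h : G2 := 
  exist _ (G2_vec g + G2_mx g *m G2_vec h, G2_mx g *m G2_mx h) (G2_mul_subproof g h).

Lemma G2_inv_subproof g : invmx (G2_mx g) \in unitmx.
Proof. by rewrite unitmx_inv G2_mx_unit. Qed.

Definition G2_inv g : G2 := 
  exist _ (- (invmx (G2_mx g) *m G2_vec g), invmx (G2_mx g)) (G2_inv_subproof g).

Let G2_mulA : associative G2_mul.
Proof.
move=> a b c; apply: G2_eq; rewrite /G2_vec/G2_mx /= -/(G2_vec _) -/(G2_mx _).
  by rewrite /G2_vec/G2_mx /= mulmxDr mulmxA addrA.
by rewrite /G2_mx /= mulmxA.
Qed.

Let G2_mul1g : left_id G2_one G2_mul.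
Proof. by move=> a; apply: G2_eq; rewrite /G2_vec/G2_mx /= ?mul1mx ?add0r. Qed.

Let G2_mulg1 : right_id G2_one G2_mul.
Proof. by move=> a; apply: G2_eq; rewrite /G2_vec/G2_mx /= ?mulmx1 ?mulmx0 ?addr0. Qed.

Let G2_mulVg : left_inverse G2_one G2_inv G2_mul.
Proof.
by move=> a; apply: G2_eq; rewrite /G2_vec/G2_mx /= ?mulVmx ?G2_mx_unit ?addNr.
Qed.

Let G2_mulgV : right_inverse G2_one G2_inv G2_mul.
Proof.
move=> a; have uA := G2_mx_unit a; apply: G2_eq; rewrite /G2_vec/G2_mx /= ?mulmxV//.
by rewrite mulmxN mulKVmx// subrr.
Qed.

HB.instance Definition _ := isGroup.Build G2
  G2_mulA G2_mul1g G2_mulg1 G2_mulVg G2_mulgV.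

HB.instance Definition _ := Topological.copy G2
  (initial_topology (val : G2 -> 'cV[R]_2 * 'M[R]_2)).

HB.instance Definition _ := isPointed.Build G2 G2_one.
HB.instance Definition _ := @isMeasurable.Build (initial_display matrix_display) G2
  (initial_measurable (val : G2 -> 'cV[R]_2 * 'M[R]_2))
  (initial_measurable0 _) (@initial_measurableC _ _ _ _)
  (@initial_measurable_bigcup _ _ _ _).

(* The element [x, A]; junk value 1 when A is not invertible. *)
Definition G2_of (x : 'cV[R]_2) (A : 'M[R]_2) : G2 := insubd G2_one (x, A).

(* dx dmu(A) / |det A| where dmu(A) = dA / |det A|^2; the coordinates z of [x, A]
   are the four entries z.1 of A and the two entries z.2 of x. The density is 0
   where det A = 0, so that the junk value of G2_of carries no mass. *)
Definition haar_G2 : set G2 -> \bar R :=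
  weighted_image ((@lebesgue2 R \x @lebesgue2 R) \x @lebesgue2 R)%E
    (fun z : (RR * RR) * RR => (`|\det (mx22 z.1)| * `|\det (mx22 z.1)| ^+ 2)^-1)
    (fun z : (RR * RR) * RR => G2_of (cvec2 z.2) (mx22 z.1)).

Let measurable_mx22_entry i j :
  measurable_fun setT (fun z : (RR * RR) * RR => mx22 z.1 i j : measurableTypeR R).
Proof.
have m1 : measurable_fun setT (fun z : (RR * RR) * RR => z.1.1).
  exact: (measurableT_comp measurable_fst measurable_fst).
have m2 : measurable_fun setT (fun z : (RR * RR) * RR => z.1.2).
  exact: (measurableT_comp measurable_snd measurable_fst).
under eq_fun do rewrite mxE.
case: (i == 0); case: (j == 0).
- exact: (measurableT_comp measurable_fst m1).
- exact: (measurableT_comp measurable_snd m1).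
- exact: (measurableT_comp measurable_fst m2).
- exact: (measurableT_comp measurable_snd m2).
Qed.

Let measurable_det : measurable_fun setT (fun z : (RR * RR) * RR => \det (mx22 z.1)).
Proof.
rewrite (_ : (fun z => _) = (fun z : (RR * RR) * RR =>
    mx22 z.1 0 0 * mx22 z.1 1 1 - mx22 z.1 0 1 * mx22 z.1 1 0)).
  by apply: measurable_funB; apply: measurable_funM; exact: measurable_mx22_entry.
by apply/funext => z; rewrite det_mat2 !mxE.
Qed.

Let haar_G2_weight_ge0 (z : (RR * RR) * RR) :
  0 <= (`|\det (mx22 z.1)| * `|\det (mx22 z.1)| ^+ 2)^-1.
Proof. by rewrite invr_ge0 mulr_ge0. Qed.

Let measurable_haar_G2_weight : measurable_fun setT
  (fun z : (RR * RR) * RR => (`|\det (mx22 z.1)| * `|\det (mx22 z.1)| ^+ 2)^-1).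
Proof.
apply: measurable_invr_ge0 => [z|]; first by rewrite mulr_ge0.
have mdet : measurable_fun setT (fun z : (RR * RR) * RR => `|\det (mx22 z.1)|).
  exact: measurableT_comp.
by apply: measurable_funM => //; exact: measurable_funX.
Qed.

Let measurable_G2_chart : measurable_fun setT
  (fun z : (RR * RR) * RR => G2_of (cvec2 z.2) (mx22 z.1)).
Proof.
apply: (@measurable_insubd _ _ _ _ _ _ G2 G2 id G2_one
  (fun z : (RR * RR) * RR => (cvec2 z.2, mx22 z.1))).
- by [].
- apply: measurable_fun_pair.
    apply: measurable_matrix => i j; under eq_fun do rewrite mxE.
    case: (i == 0); first exact: (measurableT_comp measurable_fst measurable_snd).
    exact: (measurableT_comp measurable_snd measurable_snd).
  by apply: measurable_matrix => i j; exact: measurable_mx22_entry.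
- rewrite (_ : [set _ | _] = (fun z => \det (mx22 z.1)) @^-1` (~` [set 0])).
    rewrite -[X in measurable X]setTI; apply: measurable_det => //.
    by apply: measurableC; exact: measurable_set1.
  by apply/seteqP; split=> z /=; rewrite unitmxE unitfE => /eqP.
Qed.

HB.instance Definition _ := isMeasure.Build _ _ _ haar_G2
  (weighted_image0 _ _ _) (weighted_image_ge0 _ _ haar_G2_weight_ge0)
  (@weighted_image_sigma_additive _ _ _ _ _ _ _ _
    measurable_G2_chart measurable_haar_G2_weight haar_G2_weight_ge0).
End affine_group.

Section similitudes.
Variable R : realType.
Local Notation RR := (measurableTypeR R * measurableTypeR R)%type.
Implicit Types (w : 'rV[R]_2) (A : 'M[R]_2).

Definition K0 : {pred 'M[R]_2} :=
  mem [set M | exists s t : R, 0 < s ^+ 2 + t ^+ 2 /\ M = mat2 s (- t) t s].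

Definition in_K : {pred G2 R} := fun g => (G2_vec g == 0) && (G2_mx g \in K0).

Definition K : Type := {g : G2 R | in_K g}.

HB.instance Definition _ := SubType.on K.
HB.instance Definition _ := Choice.on K.

Lemma K_one_subproof : in_K 1%g.
Proof.
apply/andP; split; first exact: eqxx.
rewrite inE; exists 1, 0; split; first by rewrite expr1n expr0n addr0.
apply/matrixP => i j; rewrite !mxE oppr0.
by case: i j => [[|[|//]] ?] [[|[|//]] ?].
Qed.

Definition K_one : K := exist _ 1%g K_one_subproof.

HB.instance Definition _ := isPointed.Build K K_one.
HB.instance Definition _ :=
  @isMeasurable.Build (initial_display (initial_display matrix_display)) K
  (initial_measurable (val : K -> G2 R))
  (initial_measurable0 _) (@initial_measurableC _ _ _ _)
  (@initial_measurable_bigcup _ _ _ _).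

(* The matrix L of the element [0, L] of K. *)
Definition K_mx (k : K) : 'M[R]_2 := G2_mx (val k).

Definition enorm w : R := Num.sqrt (w 0 0 ^+ 2 + w 0 1 ^+ 2).

Definition gamma w : 'M[R]_2 :=
  (enorm w ^+ 2)^-1 *: mat2 (w 0 0) (- w 0 1) (w 0 1) (w 0 0).

(* The element [0, gamma w] of K; junk value 1 for w = 0. *)
Definition kappa w : K := insubd K_one (G2_of 0 (gamma w)).

(* \int_K f dmu_K = \int f [0, gamma w] dw / |w|^2 *)
Definition mu_K : set K -> \bar R :=
  weighted_image (@lebesgue_rV2 R) (fun w => (enorm w ^+ 2)^-1) kappa.

Let sqr_enorm w : enorm w ^+ 2 = w 0 0 ^+ 2 + w 0 1 ^+ 2.
Proof. by rewrite sqr_sqrtr// addr_ge0// sqr_ge0. Qed.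

Let enorm_gt0 w : w != 0 -> 0 < enorm w ^+ 2.
Proof.
move=> w0; rewrite lt0r sqr_ge0 andbT; apply: contra w0.
rewrite sqr_enorm paddr_eq0 ?sqr_ge0// !sqrf_eq0 => /andP[/eqP w0 /eqP w1].
apply/eqP/rowP => j; rewrite mxE.
by case: j => [[|[|//]] ?]; [rewrite -[RHS]w0|rewrite -[RHS]w1]; congr (w _ _); apply: val_inj.
Qed.

Let measurable_sqr_enorm : measurable_fun setT (fun w => enorm w ^+ 2).
Proof.
rewrite (_ : (fun w => _) = (fun w => w 0 0 ^+ 2 + w 0 1 ^+ 2)); last exact/funext.
by apply: measurable_funD; apply: measurable_funX; exact: measurable_entry.
Qed.

Let kappa_weight_ge0 w : 0 <= (enorm w ^+ 2)^-1.
Proof. by rewrite invr_ge0 sqr_ge0. Qed.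

Let measurable_kappa_weight : measurable_fun setT (fun w => (enorm w ^+ 2)^-1).
Proof. by apply: measurable_invr_ge0 => // w; exact: sqr_ge0. Qed.

Let gamma0 : gamma 0 = 0.
Proof.
rewrite /gamma !mxE oppr0; apply/matrixP => i j; rewrite !mxE.
by case: ifP => _; case: ifP => _; rewrite mulr0.
Qed.

Lemma gamma_K0 w : w != 0 -> gamma w \in K0.
Proof.
move=> /enorm_gt0 w0; rewrite inE; set c := (enorm w ^+ 2)^-1.
exists (c * w 0 0), (c * w 0 1); split.
  by rewrite !exprMn -mulrDr -sqr_enorm mulr_gt0// exprn_gt0// invr_gt0.
apply/matrixP => i j; rewrite /gamma !mxE -/c.
by case: ifP => _; case: ifP => _; rewrite ?mulrN.
Qed.

Lemma gamma_unit w : w != 0 -> gamma w \in unitmx.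
Proof.
move=> /gamma_K0; rewrite inE => -[s [t [st ->]]].
by rewrite unitmxE det_mat2 unitfE mulNr opprK -!expr2 gt_eqF.
Qed.

Lemma kappa_in_K w : in_K (G2_of 0 (gamma w)).
Proof.
have [->|w0] := eqVneq w 0.
  by rewrite gamma0 /G2_of /insubd insubN ?K_one_subproof//= unitmxE det0 unitr0.
rewrite /in_K /G2_vec /G2_mx /G2_of insubdK ?eqxx ?gamma_K0//.
exact: gamma_unit.
Qed.

Let measurable_gamma : measurable_fun setT gamma.
Proof.
apply: measurable_matrix => i j; under eq_fun do rewrite mxE.
apply: measurable_funM => //; under eq_fun do rewrite mxE.
by case: (i == 0); case: (j == 0); do ?apply: measurable_funN; exact: measurable_entry.
Qed.

Let measurable_neq0 : measurable [set w : 'rV[R]_2 | w != 0].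
Proof.
rewrite (_ : [set w | _] = (fun w => enorm w ^+ 2) @^-1` (~` [set 0])).
  rewrite -[X in measurable X]setTI; apply: measurable_sqr_enorm => //.
  by apply: measurableC; exact: measurable_set1.
apply/seteqP; split=> w /=; first by move=> /enorm_gt0/gt_eqF/eqP.
by apply: contra_notP => /negP/negPn/eqP ->; rewrite sqr_enorm !mxE expr0n addr0.
Qed.

Let measurable_kappa : measurable_fun setT kappa.
Proof.
have mg : measurable_fun setT (fun w => G2_of 0 (gamma w)).
  apply: (@measurable_insubd _ _ _ _ _ _ (G2 R) (G2 R) id (G2_one R)
    (fun w => (0, gamma w))); first by [].
    by apply: measurable_fun_pair => //; exact: measurable_cst.
  rewrite (_ : [set _ | _] = [set w | w != 0])//.
  apply/seteqP; split=> w /=; last exact: gamma_unit.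
  apply: contraTneq => ->; rewrite gamma0.
  by rewrite unitmxE det0 unitr0.
apply: (@measurable_insubd _ _ _ _ _ _ K K id K_one _ _ mg); first by [].
rewrite (_ : [set _ | _] = setT)//; apply/seteqP; split=> // w _ /=.
exact: kappa_in_K.
Qed.

HB.instance Definition _ := isMeasure.Build _ _ _ mu_K
  (weighted_image0 _ _ _) (weighted_image_ge0 _ _ kappa_weight_ge0)
  (@weighted_image_sigma_additive _ _ _ _ _ _ _ _
    measurable_kappa measurable_kappa_weight kappa_weight_ge0).
End similitudes.

Section representations.
Context (R : realType) (V : lmodType R[i]) (dot : {dot V for @conjc R}).
Implicit Types (pi : G2 R -> V -> V) (W : set V).

(* Each pi g is invertible by the group law, so isometry makes it unitary. *)
Definition unitary_representation pi :=
  [/\ forall g, linear (pi g),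
      forall g, isometry dot dot (pi g),
      pi 1%g =1 id /\ forall g h, pi (g * h)%g =1 pi g \o pi h &
      forall v g0, hnorm dot (pi g v - pi g0 v) @[g --> g0] --> 0].

Definition closed_subspace W :=
  [/\ W 0,
      forall (a : R[i]) u v, W u -> W v -> W (a *: u + v) &
      forall (u : nat -> V) v, (forall n, W (u n)) ->
        hnorm dot (u n - v) @[n --> \oo] --> 0 -> W v].

Definition irreducible pi := forall W, closed_subspace W ->
  (forall g v, W v -> W (pi g v)) -> W = [set 0] \/ W = setT.

Definition square_integrable_representation pi :=
  [/\ unitary_representation pi, irreducible pi &
      exists2 xi, xi != 0 &
        square_integrable_fun (@haar_G2 R) (@complex_dot R)
          (fun g => dot xi (pi g xi) : R[i]^o)].
End representations.

Definition linear_isometry (R : realType) (V V' : lmodType R[i])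
    (dot : {dot V for @conjc R}) (dot' : {dot V' for @conjc R}) (T : V -> V') :=
  linear T /\ forall v, hnorm dot' (T v) = hnorm dot v.

Definition intertwines (R : realType) (V V' : lmodType R[i])
    (dot : {dot V for @conjc R}) (dot' : {dot V' for @conjc R})
    (T : V -> V') (pi : G2 R -> V -> V) (pi' : G2 R -> V' -> V') :=
  [/\ linear T,
      exists C : R, forall v, hnorm dot' (T v) <= C * hnorm dot v &
      forall g v, T (pi g v) = pi' g (T v)].

Notation L2_Rstar R := (L2 (@mu_Rstar R) (@complex_dot R)).
Notation L2_rV2 R := (L2 (@lebesgue_rV2 R) (@complex_dot R)).
Notation L2_G2 R := (L2 (@haar_G2 R) (@complex_dot R)).
Notation dot_Rstar R := (@L2_dot _ _ _ (@mu_Rstar R) _ (@complex_dot R)).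
Notation dot_rV2 R := (@L2_dot _ _ _ (@lebesgue_rV2 R) _ (@complex_dot R)).
Notation dot_G2 R := (@L2_dot _ _ _ (@haar_G2 R) _ (@complex_dot R)).
Notation L2_K R := (L2 (@mu_K R) (dot_Rstar R)).
Notation dot_K R := (@L2_dot _ _ _ (@mu_K R) _ (dot_Rstar R)).

Section wavelet.
Variable R : realType.

Definition left_regular (g : G2 R) (f : L2_G2 R) : L2_G2 R :=
  L2_of (@haar_G2 R) (@complex_dot R) (fun h => L2_fun f (g^-1 * h)%g).

(* e^(i theta) *)
Definition expi (theta : R) : R[i] := (cos theta +i* sin theta)%C.

(* The second row (u, v) of gamma(w)^-1 A gamma(wA). *)
Definition u_coef (w : 'rV[R]_2) (A : 'M[R]_2) : R :=
  (invmx (gamma w) *m A *m gamma (w *m A)) 1 0.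

Definition v_coef (w : 'rV[R]_2) (A : 'M[R]_2) : R :=
  (invmx (gamma w) *m A *m gamma (w *m A)) 1 1.

Definition sigma_formula (sigma : G2 R -> L2_K R -> L2_K R) :=
  forall (g : G2 R) (F : L2_K R),
    let x := G2_vec g in let A := G2_mx g in
    \forall w \ae @lebesgue_rV2 R, w != 0 ->
    \forall t \ae @mu_Rstar R,
      L2_fun (L2_fun (sigma g F) (kappa w)) t =
      (Num.sqrt `|\det A| * enorm w / enorm (w *m A))%:C%C *
      expi (2 * pi * ((w *m x) 0 0 + (val t)^-1 * u_coef w A)) *
      L2_fun (L2_fun F (kappa (w *m A))) (rstar ((v_coef w A)^-1 * val t)).

Definition wavelet_transform (sigma : G2 R -> L2_K R -> L2_K R) (E F : L2_K R)
  (g : G2 R) : R[i]^o := dot_K R F (sigma g E).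

End wavelet.

(* Main.v *)
Require Import Defs.
From HB Require Import structures.
From mathcomp Require Import all_boot all_order all_algebra.
From mathcomp Require Import complex.
From mathcomp Require Import ring lra.
From mathcomp Require Import all_classical all_reals all_analysis.
From mathcomp Require Import measurable_realfun.
Import Defs.

Set Implicit Arguments.
Unset Strict Implicit.
Unset Printing Implicit Defensive.

Import Order.TTheory GRing.Theory Num.Theory.
Import numFieldNormedType.Exports.

Local Open Scope classical_set_scope.
Local Open Scope ring_scope.

(* In the coordinates w of K, the coefficient <F, sigma[x,A] E> is the Fourier transform at x
   of |w|^-2 (|det A|^(1/2) |w| / |wA|) J, where J is the integral over R^* of
   F(w, t) conj(E(wA, t/v)) e^(-2 pi i u/t) dt/|t|.  Plancherel in x turns the integral over x
   into an integral over w.  For fixed w, the matrix gamma(w)^-1 A is determined by z = wA and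
   by the pair (u, v); Plancherel in u, after t = 1/s, and the dilation nu = t/v then give, for
   all E and F and with infinite values allowed,
     int_G |<F, sigma(g) E>|^2 dg = |F|^2 int |z|^-4 int |E(z, nu)|^2 dnu dz.
   The last factor is 1 for the E of the theorem, and it is positive as soon as E <> 0, which
   gives irreducibility.  The intertwining property is the unitarity of sigma.
   Plancherel is needed for integrable functions only, with infinite values allowed. *)

(** * Changes of variables on the line *)

(** Each element is therefore replaced by a measurable function of (w, t) whose section at every w
    represents the corresponding class. Integrable functions suffice for Plancherel because the
    functions of w and of t that it meets are integrands of inner products; their square
    integrability is not known in advance, hence identities in [0, +oo]. For the E of the theorem,
    E(z, nu) = conj(eta(z)) |z|^2 g(nu): the factor |z|^4 of its square cancels the weight |z|^-4,
    and dnu is |nu| times the Haar measure of R^*, which explains the two normalisations. Square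
    integrability of sigma asks for a vector without reference to g and eta, so an explicit one is
    built. *)

Section substitution.
Variable R : realType.
Local Notation T := (measurableTypeR R).
Local Notation leb := (@lebesgue_measure R).
Implicit Types h : T -> \bar R.

Lemma measurable_affine (a b : R) : measurable_fun setT (fun x : T => a * x + b : T).
Proof.
by apply: measurable_funD => //; apply: measurable_funM => //.
Qed.

Lemma ge0_integral_oppr h : measurable_fun setT h -> (forall x, (0 <= h x)%E) ->
  (\int[leb]_x h (- x)%R = \int[leb]_x h x)%E.
Proof.
move=> mh h0.
have mN : measurable_fun setT (-%R : T -> T) by exact: oppr_measurable.
rewrite -[LHS](@ge0_integral_pushforward _ _ T T R (-%R) mN leb setT h)//.
by apply: eq_measure_integral => A mA _; exact: lebesgue_measureN.
Qed.

(** The image of Lebesgue measure under x -> a x + b, multiplied by a, gives each half-open interval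
    its length, hence is Lebesgue measure by uniqueness. *)
Lemma ge0_integral_affine_pos (a b : R) h : 0 < a -> measurable_fun setT h ->
  (forall x, (0 <= h x)%E) ->
  (\int[leb]_x h (a * x + b)%R = (a^-1)%:E * \int[leb]_x h x)%E.
Proof.
move=> a0 mh h0.
pose phi : T -> T := fun x => a * x + b.
have mphi : measurable_fun setT phi by exact: measurable_affine.
pose nu : {measure set T -> \bar R} :=
  measure_function_pushforward__canonical__measure_function_Measure leb mphi.
pose m : {measure set T -> \bar R} := mscale (NngNum (ltW a0)) nu.
have lebm (A : set T) : measurable A -> leb A = m A.
  apply: lebesgue_measure_unique => _ [[c d]] _ <-.
  rewrite /m /= /mscale/= /nu /= /pushforward.
  rewrite (_ : phi @^-1` _ = `](c - b) / a, (d - b) / a]%classic); last first.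
    apply/seteqP; split => x /=; rewrite !in_itv/= /phi ltr_pdivrMr// ler_pdivlMr//;
      rewrite ltrBlDr lerBrDr (mulrC a x)//.
  rewrite !lebesgue_measure_itv/= !lte_fin ltr_pM2r ?invr_gt0// ltrD2r.
  case: ifPn => _; last by rewrite mule0.
  by rewrite -!EFinM -EFinD; congr (_%:E); field; rewrite gt_eqF.
rewrite -[LHS](@ge0_integral_pushforward _ _ T T R phi mphi leb setT h)//.
rewrite (@eq_measure_integral _ _ _ _ m leb)//.
rewrite ge0_integral_mscale// muleA -EFinM mulVf ?mul1e ?gt_eqF//.
by move=> A mA _; exact: lebm.
Qed.

Lemma ge0_integral_affine (a b : R) h : a != 0 -> measurable_fun setT h ->
  (forall x, (0 <= h x)%E) ->
  (\int[leb]_x h (a * x + b)%R = (`|a|^-1)%:E * \int[leb]_x h x)%E.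
Proof.
move=> a0 mh h0; have [a_gt0|a_le0] := ltP 0 a.
  by rewrite ger0_norm ?(ltW a_gt0)//; exact: ge0_integral_affine_pos.
have Na : 0 < - a by rewrite oppr_gt0 lt_neqAle a0.
rewrite ler0_norm// -(ge0_integral_affine_pos b Na)//.
rewrite -[LHS](@ge0_integral_oppr (fun x => h (a * x + b)%R))//.
  by apply: eq_integral => x _; rewrite mulrN mulNr.
by apply: (measurableT_comp mh); exact: measurable_affine.
Qed.

Lemma ge0_integral_shift (b : R) h : measurable_fun setT h ->
  (forall x, (0 <= h x)%E) ->
  (\int[leb]_x h (x + b)%R = \int[leb]_x h x)%E.
Proof.
move=> mh h0; have := @ge0_integral_affine_pos 1 b h ltr01 mh h0.
by rewrite invr1 mul1e; under eq_integral do rewrite mul1r.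
Qed.

End substitution.

(** * Integration against the image of a measure with density *)

Section weighted_image_integral.
Local Open Scope ereal_scope.
Context d1 d2 (X : measurableType d1) (Y : measurableType d2) (R : realType).
Variables (m : {measure set X -> \bar R}) (w : X -> R) (phi : X -> Y).
Variable nu : {measure set Y -> \bar R}.
Hypotheses (mphi : measurable_fun setT phi) (mw : measurable_fun setT w).
Hypothesis w0 : forall x, (0 <= w x)%R.
Hypothesis nuE : forall B, measurable B -> nu B = weighted_image m w phi B.

Import HBNNSimple.

Let nnsfun_case (h : {nnsfun Y >-> R}) :
  \int[nu]_y (h y)%:E = \int[m]_x ((h (phi x))%:E * (w x)%:E).
Proof.
have mh r : measurable (phi @^-1` (h @^-1` [set r])).
  by rewrite -[X in measurable X]setTI; apply: mphi.
transitivity (\int[nu]_y (\sum_(r \in range h) (r * \1_(h @^-1` [set r]) y)%:E)).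
  by apply: eq_integral => y _; rewrite fimfunE -fsumEFin.
rewrite ge0_integral_fsum//; last 2 first.
- by move=> r; apply/measurable_EFinP/measurable_funM => //.
- by move=> r y _; exact: nnfun_muleindic_ge0.
transitivity (\int[m]_x (\sum_(r \in range h)
    ((r * \1_(h @^-1` [set r]) (phi x))%:E * (w x)%:E))).
  rewrite ge0_integral_fsum//; last 2 first.
  - move=> r; apply: emeasurable_funM; last exact/measurable_EFinP.
    apply/measurable_EFinP/measurable_funM => //.
    exact: (measurableT_comp (measurable_indic (measurable_sfunP h (measurable_set1 r))) mphi).
  - by move=> r x _; rewrite mule_ge0 ?lee_fin// -lee_fin nnfun_muleindic_ge0.
  apply: eq_fsbigr => r /[!inE] -[y _ <-].
  rewrite integralZl_indic_nnsfun// integral_indic// setIT nuE//.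
  rewrite /weighted_image integral_mkcond -ge0_integralZl//.
  - apply: eq_integral => x _; rewrite patchE EFinM -muleA; congr (_ * _).
    rewrite indicE; case: ifPn => xh; last first.
      by rewrite (_ : (phi x \in _) = false) ?mul0e//; apply/negbTE; move: xh; rewrite !notin_setE.
    by rewrite (_ : (phi x \in _) = true) ?mul1e//; move: xh; rewrite !inE.
  - apply/(measurable_restrictT _ _).1 => //; apply: measurable_funTS; exact/measurable_EFinP.
  - by move=> x _; rewrite patchE; case: ifPn => // _; rewrite lee_fin.
  - by rewrite lee_fin.
apply: eq_integral => x _; rewrite -ge0_mule_fsuml.
  by rewrite fsumEFin// -(fimfunE h).
by move=> r; exact: nnfun_muleindic_ge0.
Qed.

(** True for simple functions by additivity, then by monotone convergence. Since [nu] is any measure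
    that agrees with the weighted image on measurable sets, the lemma serves for R^*, K and G_2 in
    their coordinates, and for Lebesgue measure under inversion. *)
Lemma ge0_integral_weighted_image f : measurable_fun setT f ->
  (forall y, 0 <= f y) ->
  \int[nu]_y f y = \int[m]_x (f (phi x) * (w x)%:E).
Proof.
move=> mf f0; pose h := nnsfun_approx measurableT mf.
have hf y : (h n y)%:E @[n --> \oo] --> f y by apply: cvg_nnsfun_approx.
have fE y : f y = limn (fun n => (h n y)%:E) by apply/esym/cvg_lim => //; exact: hf.
under eq_integral do rewrite fE.
rewrite monotone_convergence//; last 3 first.
- by move=> n; apply/measurable_EFinP.
- by move=> n y _; rewrite lee_fin.
- by move=> y _ a b ab; rewrite lee_fin; exact/lefP/nd_nnsfun_approx.
under eq_fun do rewrite nnsfun_case.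
rewrite -monotone_convergence//; last 3 first.
- move=> n; apply: emeasurable_funM; apply/measurable_EFinP => //.
  exact: measurableT_comp.
- by move=> n x _; rewrite mule_ge0 ?lee_fin.
- move=> x _ a b ab; rewrite lee_wpmul2r ?lee_fin//; exact/lefP/nd_nnsfun_approx.
apply: eq_integral => x _; apply/cvg_lim => //.
by apply: cvgeZr => //; exact: hf.
Qed.

End weighted_image_integral.

(** * The substitution x -> 1/x *)

Section inversion.
Variable R : realType.
Local Notation T := (measurableTypeR R).
Local Notation leb := (@lebesgue_measure R).

Lemma measurable_inv : measurable_fun setT (fun x : T => x^-1 : T).
Proof.
rewrite (_ : (fun x => _) = (fun x => x * (x ^+ 2)^-1)); last first.
  apply/funext => x; have [->|x0] := eqVneq x 0; first by rewrite invr0 mul0r.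
  by field.
apply: measurable_funM => //; apply: measurable_invr_ge0; first by move=> x; exact: sqr_ge0.
exact: measurable_funX.
Qed.

Lemma measurable_fun_inv d (X : measurableType d) (f : X -> R) :
  measurable_fun setT f -> measurable_fun setT (fun x => (f x)^-1 : R).
Proof. by move=> mf; exact: (measurableT_comp measurable_inv mf). Qed.

Let integral_itvVy (b : R) : 0 < b ->
  (\int[leb]_(x in `[(b^-1)%R, +oo[) ((x ^+ 2)^-1)%:E = b%:E)%E.
Proof.
move=> b0; have bV0 : 0 < b^-1 by rewrite invr_gt0.
rewrite (@ge0_continuous_FTC2y _ _ (fun x => - x^-1) _ 0).
- by rewrite EFinN oppeK invrK add0e.
- by move=> x _; rewrite invr_ge0 sqr_ge0.
- apply: continuous_in_subspaceT => x; rewrite inE/= in_itv/= andbT => xb.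
  have x0 : x != 0 by rewrite gt_eqF// (lt_le_trans bV0).
  apply: cvgV; first by rewrite expf_eq0.
  exact: exprn_continuous.
- rewrite -oppr0; apply: cvgN.
  by apply/(@gtr0_cvgV0 _ _ _ _ (fun x : R => x)); [near=> x; near: x; exact: nbhs_pinfty_gt|exact: cvg_id].
- by move=> x xb; apply: derivableN; apply: derivableV => //; rewrite gt_eqF// (lt_trans bV0).
- apply: cvgN; apply: cvg_at_right_filter; apply: cvgV => //; by rewrite gt_eqF.
- move=> x; rewrite in_itv/= andbT => xb.
  have x0 : x != 0 by rewrite gt_eqF// (lt_trans bV0).
  rewrite derive1E deriveN ?deriveV//; last exact: derivableV.
  by rewrite derive_id scaleNr opprK; exact: mulr1.
Unshelve. all: by end_near. Qed.

Let w (x : T) : R := (x ^+ 2)^-1.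
Let w0 x : 0 <= w x. Proof. by rewrite invr_ge0 sqr_ge0. Qed.
Let mw : measurable_fun setT w.
Proof. by apply: measurable_fun_inv; exact: measurable_funX. Qed.

Let m : set T -> \bar R := weighted_image leb w (fun x : T => x^-1 : T).

HB.instance Definition _ := isMeasure.Build _ _ _ m
  (weighted_image0 _ _ _) (weighted_image_ge0 _ _ w0)
  (@weighted_image_sigma_additive _ _ _ _ _ _ _ _ measurable_inv mw w0).

Let mU (A B : set T) : measurable A -> measurable B -> A `&` B = set0 ->
  m (A `|` B) = (m A + m B)%E.
Proof. exact: measureU. Qed.

Let mE (A : set T) : measurable A -> m A = (\int[leb]_x (\1_A (x^-1)%R * w x)%:E)%E.
Proof.
move=> mA; rewrite /m /weighted_image integral_mkcond; apply: eq_integral => x _.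
rewrite patchE indicE; case: ifPn => xA.
  by rewrite (_ : (_ \in A) = true) ?mul1r//; move: xA; rewrite !inE.
by rewrite (_ : (_ \in A) = false) ?mul0r//; apply/negbTE; move: xA; rewrite !notin_setE.
Qed.

Let m1 (a : R) : m [set a] = 0%E.
Proof.
rewrite /m /weighted_image (_ : _ @^-1` _ = [set a^-1]) ?integral_set1//.
by apply/seteqP; split => x /= => [<-|->]; rewrite invrK.
Qed.

Let mN (A : set T) : measurable A -> m (-%R @^-1` A) = m A.
Proof.
move=> mA; have mNA : measurable ((-%R : T -> T) @^-1` A).
  by rewrite -[X in measurable X]setTI; exact: (oppr_measurable measurableT).
rewrite !mE//; rewrite -[RHS]ge0_integral_oppr.
- by apply: eq_integral => x _; rewrite /w sqrrN invrN.
- apply/measurable_EFinP/measurable_funM => //.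
  exact: (measurableT_comp (measurable_indic mA) measurable_inv).
- by move=> x; rewrite lee_fin mulr_ge0.
Qed.

Let m0b (b : R) : 0 <= b -> m `]0, b]%classic = b%:E.
Proof.
rewrite le_eqVlt => /predU1P[<-|b0].
  by rewrite set_itv_ge ?bnd_simp// measure0.
rewrite -[RHS]integral_itvVy// /m /weighted_image; congr integral.
apply/seteqP; split => x /=; rewrite !in_itv/= ?andbT.
  by move=> /andP[]; rewrite invr_gt0 => x0; rewrite invf_ple ?posrE.
move=> bx; have x0 : 0 < x by rewrite (lt_le_trans _ bx)// invr_gt0.
by rewrite invr_gt0 x0 invf_ple ?posrE.
Qed.

Let mab (a b : R) : 0 <= a -> a <= b -> m `]a, b]%classic = (b - a)%:E.
Proof.
move=> a0 ab; have b0 := le_trans a0 ab.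
have := m0b b0; rewrite (@itv_bndbnd_setU _ _ _ (BRight a)) ?bnd_simp//.
rewrite mU//; last first.
  apply/seteqP; split => // x [] /=; rewrite !in_itv/= => /andP[_ xa] /andP[ax _].
  by move: (lt_le_trans ax xa); rewrite ltxx.
rewrite m0b//; case: (m _) => [r| |]//= -[] <-.
by rewrite addrAC subrr add0r.
Qed.

(** Reflection turns ]c, d] into [-d, -c[, so the values on negative intervals need this closed-open
    form. *)
Let mab' (a b : R) : 0 <= a -> a <= b -> m `[a, b[%classic = (b - a)%:E.
Proof.
move=> a0; rewrite le_eqVlt => /predU1P[<-|ab].
  by rewrite set_itvco0 measure0 subrr.
have := mab a0 (ltW ab).
rewrite -(@setUitv1 _ _ (BRight a) b true) ?bnd_simp// -(@setU1itv _ _ (BLeft b) a false) ?bnd_simp//.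
rewrite !mU//; do ?by apply/seteqP; split => // x /= []; rewrite in_itv/= => /[swap] ->; rewrite ltxx ?andbF.
  by rewrite !m1 adde0 add0e.
by apply/seteqP; split => // x /= []; rewrite in_itv/= => ->; rewrite ltxx ?andbF.
Qed.

(** Uniqueness of Lebesgue measure once more. The measure [m] of ]0, b] is the integral of x^-2 over
    [1/b, +oo[, that is b; negative intervals are reflected by [mN], and an interval around 0 is cut
    at 0. *)
Let lebm (A : set T) : measurable A -> leb A = m A.
Proof.
apply: lebesgue_measure_unique => _ [[c d]] _ <- /=.
have [dc|cd] := leP d c; first by rewrite set_itv_ge ?bnd_simp -?leNgt// !measure0.
rewrite lebesgue_measure_itv/= lte_fin cd -EFinB.
have [c0|c0] := leP 0 c; first by rewrite mab// ltW.
have Nc : m `]c, 0]%classic = (- c)%:E.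
  rewrite -mN// opp_preimage_itvbndbnd/= oppr0 mab' ?subr0// oppr_ge0 ltW//.
have [d0|d0] := leP d 0.
  by rewrite -mN// opp_preimage_itvbndbnd/= mab' ?oppr_ge0 ?lerN2 ?(ltW cd)// opprK addrC.
rewrite (@itv_bndbnd_setU _ _ _ (BRight (0 : R))) ?bnd_simp ?ltW//.
rewrite mU//; last first.
  apply/seteqP; split => // x [] /=; rewrite !in_itv/= => /andP[_ xa] /andP[ax _].
  by move: (lt_le_trans ax xa); rewrite ltxx.
by rewrite Nc m0b ?ltW// -EFinD addrC.
Qed.

Lemma lebesgue_weighted_inv (A : set T) : measurable A ->
  leb A = weighted_image leb (fun x : T => (x ^+ 2)^-1) (fun x : T => x^-1 : T) A.
Proof. exact: lebm. Qed.

Lemma ge0_integral_inv (h : T -> \bar R) : measurable_fun setT h ->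
  (forall x, (0 <= h x)%E) ->
  (\int[leb]_x (h (x^-1)%R * ((x ^+ 2)^-1)%:E) = \int[leb]_x h x)%E.
Proof.
move=> mh h0.
by rewrite -(@ge0_integral_weighted_image _ _ T T R leb w (fun x : T => x^-1 : T) leb measurable_inv mw w0 lebm).
Qed.

End inversion.

(** * The Plancherel theorem *)

Section poisson.
Variable R : realType.
Local Notation T := (measurableTypeR R).
Local Notation leb := (@lebesgue_measure R).

Definition poisson_kernel (a s : R) : R := a / (pi * (a ^+ 2 + s ^+ 2)).

(** An antiderivative of e^(-c x) (1 + cos(b x)). The summand 1 makes the integrand nonnegative, as
    the improper form of the fundamental theorem of calculus requires; it is subtracted again in
    [Rintegral_expR_cos]. *)
Let eprim (c b x : R) : R :=
  - (expR (- c * x) / c) +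
  expR (- c * x) * (b * sin (b * x) - c * cos (b * x)) / (c ^+ 2 + b ^+ 2).

Let is_derive_scale (c x : R) : is_derive x 1 (fun x => c * x) c.
Proof.
rewrite (_ : (fun x => c * x) = c \*: (@id R))//.
by apply: is_derive_eq; exact: mulr1.
Qed.

Let eprim_derive (c b x : R) : 0 < c ->
  is_derive x 1 (eprim c b) (expR (- c * x) * (1 + cos (b * x))).
Proof.
move=> c0.
have de := is_derive1_comp (is_derive_expR (- c * x)) (is_derive_scale (- c) x).
have ds := is_derive1_comp (is_derive_sin (b * x)) (is_derive_scale b x).
have dc := is_derive1_comp (is_derive_cos (b * x)) (is_derive_scale b x).
rewrite (_ : eprim c b = (- c^-1) \*: (expR \o *%R (- c)) +
  ((c ^+ 2 + b ^+ 2)^-1 \*: ((expR \o *%R (- c)) * (b \*: (sin \o *%R b) - c \*: (cos \o *%R b))))); last first.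
  apply/funext => y; rewrite /eprim /= !fctE/=.
  rewrite /GRing.scale/=. field.
  by rewrite !gt_eqF// ltr_wpDr ?sqr_ge0// exprn_gt0.
apply: is_derive_eq; rewrite !fctE.
set E := expR _; set S := sin _; set C := cos _.
rewrite [LHS](_ : _ = - c^-1 * (E * - c) + (c ^+ 2 + b ^+ 2)^-1 *
  (E * (b * (C * b) - c * (- S * b)) + (b * S - c * C) * (E * - c)))//; field.
by rewrite !gt_eqF// ltr_wpDr ?sqr_ge0// exprn_gt0.
Qed.

Let continuous_expcos (c b : R) : continuous (fun x => expR (- c * `|x|) * (1 + cos (b * x))).
Proof.
move=> x; apply: cvgM.
  apply: continuous_comp; last exact: continuous_expR.
  by apply: cvgMl_tmp; exact: norm_continuous.
apply: cvgD; first exact: cvg_cst.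
apply: continuous_comp; last exact: continuous_cos.
by apply: cvgMl_tmp; exact: cvg_id.
Qed.

Let eprim_cvg (c b : R) : 0 < c -> eprim c b x @[x --> +oo] --> 0.
Proof.
move=> c0.
have e0 : expR (- c * x) @[x --> +oo] --> 0.
  under eq_fun do rewrite mulNr.
  apply: (@cvg_comp _ _ _ (fun x => c * x) (fun x => expR (- x)) _ (+oo%R)); last exact: cvgr_expR.
  by apply: gt0_cvgMry => //; exact: cvg_id.
have k0 : 0 <= (c ^+ 2 + b ^+ 2)^-1 by rewrite invr_ge0 addr_ge0 ?sqr_ge0.
pose M := c^-1 + (`|b| + c) / (c ^+ 2 + b ^+ 2).
apply: norm_cvg0.
apply: (@squeeze_cvgr _ _ _ _ (cst 0) (fun x => M * expR (- c * x))).
- apply: nearW => x; rewrite normr_ge0/= /eprim /M mulrDl (le_trans (ler_normD _ _))// lerD//.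
    by rewrite normrN normrM (ger0_norm (expR_ge0 _)) ger0_norm ?invr_ge0 ?(ltW c0)// mulrC.
  rewrite !normrM (ger0_norm (expR_ge0 _)) (ger0_norm k0) [leRHS]mulrC -mulrA.
  rewrite ler_wpM2l ?expR_ge0//.
  rewrite ler_wpM2r// (le_trans (ler_normB _ _))// lerD//.
    by rewrite normrM ler_piMr// ler_norml sin_geN1 sin_le1.
  by rewrite normrM gtr0_norm// ler_piMr ?(ltW c0)// ler_norml cos_geN1 cos_le1.
- exact: cvg_cst.
- by rewrite -(mulr0 M); apply: cvgMl_tmp.
Qed.

Lemma integral_expR_cos (c b : R) : 0 < c ->
  (\int[leb]_x (expR (- c * `|x|) * (1 + cos (b * x)))%:E =
   (2 / c + 2 * c / (c ^+ 2 + b ^+ 2))%:E)%E.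
Proof.
move=> c0.
rewrite ge0_symfun_integralT; last 3 first.
- by move=> x; rewrite mulr_ge0 ?expR_ge0// -lerBlDl sub0r cos_geN1.
- exact: continuous_expcos.
- by move=> x /=; rewrite normrN mulrN cosN.
rewrite -set_itvcy (@eq_integral _ T _ leb _ (fun x : T => (expR (- c * x) * (1 + cos (b * x)))%:E)); last first.
  by move=> x; rewrite inE/= in_itv/= andbT => x0; rewrite ger0_norm.
have der x : derivable (eprim c b) x 1 by have [] := eprim_derive b x c0.
rewrite (@ge0_continuous_FTC2y _ _ (eprim c b) _ 0).
- rewrite add0e -EFinN -EFinM; congr (_%:E).
  rewrite /eprim !mulr0 expR0 sin0 cos0; field.
  by rewrite !gt_eqF// ltr_wpDr ?sqr_ge0// exprn_gt0.
- by move=> x _; rewrite mulr_ge0 ?expR_ge0// -lerBlDl sub0r cos_geN1.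
- apply: continuous_subspaceT => x; apply: cvgM.
    apply: continuous_comp; last exact: continuous_expR.
    by apply: cvgMl_tmp; exact: cvg_id.
  apply: cvgD; first exact: cvg_cst.
  apply: continuous_comp; last exact: continuous_cos.
  by apply: cvgMl_tmp; exact: cvg_id.
- exact: eprim_cvg.
- by move=> x _; exact: der.
- apply: cvg_at_right_filter; apply: differentiable_continuous.
  exact/derivable1_diffP.
- by move=> x _; rewrite derive1E; have [_ ->] := eprim_derive b x c0.
Qed.
End poisson.

Lemma measurable_fun_cos d (X : measurableType d) (R : realType) (f : X -> R) :
  measurable_fun setT f -> measurable_fun setT (fun x => cos (f x)).
Proof.
move=> mf; apply: (@measurableT_comp _ _ _ _ _ _ (@cos R)) => //.
by apply: continuous_measurable_fun; exact: continuous_cos.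
Qed.

Lemma measurable_fun_sin d (X : measurableType d) (R : realType) (f : X -> R) :
  measurable_fun setT f -> measurable_fun setT (fun x => sin (f x)).
Proof.
move=> mf; apply: (@measurableT_comp _ _ _ _ _ _ (@sin R)) => //.
by apply: continuous_measurable_fun; exact: continuous_sin.
Qed.

Lemma cos_norm_le1 (R : realType) (x : R) : `|cos x| <= 1.
Proof. by rewrite ler_norml cos_geN1 cos_le1. Qed.

Lemma sin_norm_le1 (R : realType) (x : R) : `|sin x| <= 1.
Proof. by rewrite ler_norml sin_geN1 sin_le1. Qed.

Section integrability.
Context d (X : measurableType d) (R : realType).
Variable mu : {measure set X -> \bar R}.

Lemma integrable_bounded_mul (g h : X -> R) (M : R) :
  measurable_fun setT h -> (forall x, `|h x| <= M) ->
  mu.-integrable setT (EFin \o g) ->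
  mu.-integrable setT (EFin \o (fun x => g x * h x)).
Proof.
move=> mh hM ig; have mg : measurable_fun setT g.
  by apply/measurable_EFinP; exact: measurable_int ig.
apply: (@le_integrable _ _ _ _ _ measurableT _ (fun x => M%:E * (EFin \o g) x)%E).
- by apply/measurable_EFinP; exact: measurable_funM.
- move=> x _; rewrite /= lee_fin !normrM mulrC ler_wpM2r//.
  by rewrite (le_trans (hM x))// ler_norm.
- exact: integrableZl.
Qed.

Lemma integrable_ge0_lty (h : X -> R) : measurable_fun setT h -> (forall x, 0 <= h x) ->
  (\int[mu]_x (h x)%:E < +oo)%E -> mu.-integrable setT (EFin \o h).
Proof.
move=> mh h0 hoo; apply/integrableP; split; first exact/measurable_EFinP.
by under eq_integral do rewrite /= ger0_norm//.
Qed.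

End integrability.

Section poisson_bis.
Variable R : realType.
Local Notation T := (measurableTypeR R).
Local Notation leb := (@lebesgue_measure R).

Let measurable_expRn (c : R) : measurable_fun setT (fun x : T => expR (- c * `|x|)).
Proof.
apply: measurableT_comp => //; apply: measurable_funM => //.
Qed.

Lemma integral_expR_norm (c : R) : 0 < c ->
  (\int[leb]_x (expR (- c * `|x|))%:E = (2 / c)%:E)%E.
Proof.
(* At b = 0 the factor 1 + cos(b x) is the constant 2. *)
move=> c0; have := integral_expR_cos 0 c0.
under eq_integral do rewrite mul0r cos0 -[1 + 1]/(2 : R) mulrC EFinM.
rewrite ge0_integralZl//.
- rewrite expr0n/= addr0.
  have -> : 2 / c + 2 * c / c ^+ 2 = 2 * (2 / c) by field; rewrite gt_eqF.
  rewrite EFinM => /(congr1 (fun x => (2^-1)%:E * x)%E).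
  rewrite muleA -!EFinM mulVf// mul1e => ->; congr (_%:E); field.
  by rewrite gt_eqF.
- by apply/measurable_EFinP; exact: measurable_expRn.
Qed.

Lemma integrable_expR_norm (c : R) : 0 < c ->
  leb.-integrable setT (EFin \o (fun x : T => expR (- c * `|x|))).
Proof.
move=> c0; apply: integrable_ge0_lty => //.
by rewrite integral_expR_norm// ltry.
Qed.

Lemma integrable_expR_cos (c b : R) : 0 < c ->
  leb.-integrable setT (EFin \o (fun x : T => expR (- c * `|x|) * cos (b * x))).
Proof.
move=> c0; apply: (@integrable_bounded_mul _ T R leb _ _ 1); last exact: integrable_expR_norm.
- by apply: measurable_fun_cos; exact: measurable_funM.
- by move=> x; exact: cos_norm_le1.
Qed.

Lemma Rintegral_expR_cos (c b : R) : 0 < c ->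
  \int[leb]_x (expR (- c * `|x|) * cos (b * x)) = 2 * c / (c ^+ 2 + b ^+ 2).
Proof.
move=> c0; have := integral_expR_cos b c0.
under eq_integral do rewrite mulrDr mulr1 EFinD.
rewrite integralD//; last 2 first.
- exact: integrable_expR_norm.
- exact: integrable_expR_cos.
rewrite integral_expR_norm// /Rintegral.
have := integrable_fin_num measurableT (integrable_expR_cos b c0).
rewrite /comp; case: (\int[_]_(_ in _) _)%E => // r _ [] /=.
by move/addrI.
Qed.

(** The dilation s = a x reduces the kernel to 1 / (pi (1 + x^2)). *)
Lemma integral_poisson_kernel (a : R) : 0 < a ->
  (\int[leb]_s (poisson_kernel a s)%:E = 1)%E.
Proof.
move=> a0.
have mP : measurable_fun setT (fun s : T => (poisson_kernel a s)%:E).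
  apply/measurable_EFinP; apply: measurable_funM => //; apply: measurable_fun_inv.
  by apply: measurable_funM => //; apply: measurable_funD => //; exact: measurable_funX.
have P0 s : (0 <= (poisson_kernel a s)%:E)%E.
  by rewrite lee_fin divr_ge0 ?(ltW a0)// mulr_ge0 ?pi_ge0// addr_ge0 ?sqr_ge0.
have pi0 : (pi : R) != 0 by rewrite gt_eqF ?pi_gt0.
have PE x : poisson_kernel a (a * x + 0) = (pi * a)^-1 * (oneDsqr x)^-1.
  rewrite /poisson_kernel addr0 exprMn /oneDsqr; move: pi pi0 => p p0; field.
  have x1 : 0 < 1 + x ^+ 2 by rewrite ltr_pwDl ?sqr_ge0.
  have -> : a ^+ 2 + (a * x) ^+ 2 = a ^+ 2 * (1 + x ^+ 2) by ring.
  by rewrite mulf_neq0 ?p0 ?expf_neq0 ?gt_eqF.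
have int1 : (\int[leb]_x ((oneDsqr x)^-1)%:E = (pi : R)%:E)%E.
  rewrite ge0_symfun_integralT; last 3 first.
  - by move=> x; rewrite invr_ge0 (le_trans ler01)// oneDsqr_ge1.
  - exact: continuous_oneDsqrV.
  - by move=> x /=; rewrite /oneDsqr sqrrN.
  by rewrite -set_itvcy integral0y_oneDsqr -EFinM mulrC divfK.
have := @ge0_integral_affine_pos _ a 0 _ a0 mP P0.
under eq_integral do rewrite PE EFinM.
have mo : measurable_fun setT (fun s : T => ((oneDsqr s)^-1)%:E).
  apply/measurable_EFinP; apply: measurable_fun_inv.
  by apply: measurable_funD => //; exact: measurable_funX.
rewrite ge0_integralZl//; last first.
  by rewrite lee_fin invr_ge0 mulr_ge0 ?pi_ge0 ?(ltW a0).
rewrite int1 => /(congr1 (fun x => a%:E * x)%E).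
rewrite [RHS]muleA -!EFinM divff ?gt_eqF// mul1e => <-; congr (_%:E).
by move: pi pi0 => p p0; field; rewrite p0 gt_eqF.
Qed.

End poisson_bis.

Section product.
Context d1 d2 (X : measurableType d1) (Y : measurableType d2) (R : realType).
Variable m1 : {sigma_finite_measure set X -> \bar R}.
Variable m2 : {sigma_finite_measure set Y -> \bar R}.

Lemma integrable_prodM (f : X -> R) (g : Y -> R) :
  m1.-integrable setT (EFin \o f) -> m2.-integrable setT (EFin \o g) ->
  (m1 \x m2)%E.-integrable setT (EFin \o (fun z => f z.1 * g z.2)).
Proof.
move=> /[dup] fi /integrableP[mf foo] /[dup] gi /integrableP[mg goo].
have mf' : measurable_fun setT f by exact/measurable_EFinP.
have mg' : measurable_fun setT g by exact/measurable_EFinP.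
apply/integrable12ltyP.
  apply/measurable_EFinP; apply: measurable_funM.
    exact: (measurableT_comp mf' measurable_fst).
  exact: (measurableT_comp mg' measurable_snd).
have mng : measurable_fun setT (fun y => `|g y|%:E).
  by apply/measurable_EFinP; exact: measurableT_comp.
have mnf : measurable_fun setT (fun y => `|f y|%:E).
  by apply/measurable_EFinP; exact: measurableT_comp.
rewrite (eq_integral (fun x => (`|f x|%:E * \int[m2]_y `|g y|%:E)%E)); last first.
  by move=> x _; under eq_integral do rewrite /= normrM EFinM; rewrite ge0_integralZl.
rewrite ge0_integralZr//; last exact: integral_ge0.
by rewrite lte_mul_pinfty// ?ge0_fin_numE// integral_ge0.
Qed.

Lemma Rintegral_prodM (f : X -> R) (g : Y -> R) :
  m1.-integrable setT (EFin \o f) -> m2.-integrable setT (EFin \o g) ->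
  \int[(m1 \x m2)%E]_z (f z.1 * g z.2) = (\int[m1]_x f x) * (\int[m2]_y g y).
Proof.
move=> fi gi; rewrite /Rintegral -(integral12_prod_meas1 (integrable_prodM fi gi)).
rewrite /fubini_F/=.
under eq_integral => x _.
  under eq_integral => y _ do rewrite EFinM.
  rewrite integralZl//.
  over.
rewrite -(@fineK _ (\int[m2]_y (g y)%:E)%E); last exact: integrable_fin_num gi.
rewrite integralZr//= -(@fineK _ (\int[m1]_y (f y)%:E)%E)//.
exact: integrable_fin_num fi.
Qed.

End product.

Section lebesgue2.
Variable R : realType.
Local Notation T := (measurableTypeR R).
Local Notation leb := (@lebesgue_measure R).

Lemma lebesgue2_integrable_prodM (f g : T -> R) :
  leb.-integrable setT (EFin \o f) -> leb.-integrable setT (EFin \o g) ->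
  (@lebesgue2 R).-integrable setT (EFin \o (fun z : T * T => f z.1 * g z.2)).
Proof. exact: integrable_prodM. Qed.

Lemma lebesgue2_Rintegral_prodM (f g : T -> R) :
  leb.-integrable setT (EFin \o f) -> leb.-integrable setT (EFin \o g) ->
  \int[@lebesgue2 R]_z (f z.1 * g z.2) = (\int[leb]_x f x) * (\int[leb]_y g y).
Proof. exact: Rintegral_prodM. Qed.

Lemma lebesgue2_tonelli (f : T * T -> \bar R) : measurable_fun setT f ->
  (forall x, (0 <= f x)%E) ->
  (\int[@lebesgue2 R]_z f z = \int[leb]_x \int[leb]_y f (x, y))%E.
Proof. by move=> mf f0; exact: fubini_tonelli1. Qed.

Lemma lebesgue2_tonelli2 (f : T * T -> \bar R) : measurable_fun setT f ->
  (forall x, (0 <= f x)%E) ->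
  (\int[@lebesgue2 R]_z f z = \int[leb]_y \int[leb]_x f (x, y))%E.
Proof. by move=> mf f0; exact: fubini_tonelli2. Qed.

Lemma lebesgue2_fubini (f : T * T -> \bar R) : 
  (@lebesgue2 R).-integrable setT f ->
  (\int[@lebesgue2 R]_z f z = \int[leb]_x \int[leb]_y f (x, y))%E.
Proof. by move=> fi; rewrite -integral12_prod_meas1. Qed.

End lebesgue2.

(** * The power spectrum of a real integrable function *)

Section fourier.
Variable R : realType.
Local Notation T := (measurableTypeR R).
Local Notation leb := (@lebesgue_measure R).
Local Notation leb2 := (@lebesgue2 R).

Definition cosT (f : T -> R) (x : R) : R := \int[leb]_w (f w * cos (2 * pi * (x * w))).
Definition sinT (f : T -> R) (x : R) : R := \int[leb]_w (f w * sin (2 * pi * (x * w))).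
(** The squared modulus at x of the Fourier transform of the real function f. *)
Definition specT (f : T -> R) (x : R) : R := cosT f x ^+ 2 + sinT f x ^+ 2.

Lemma specT_ge0 f x : 0 <= specT f x.
Proof. by rewrite addr_ge0 ?sqr_ge0. Qed.

Let mphase (x : R) : measurable_fun setT (fun w : T => 2 * pi * (x * w)).
Proof. by apply: measurable_funM => //; exact: measurable_funM. Qed.

Lemma integrable_cosT (f : T -> R) (x : R) : leb.-integrable setT (EFin \o f) ->
  leb.-integrable setT (EFin \o (fun w => f w * cos (2 * pi * (x * w)))).
Proof.
move=> fi; apply: (@integrable_bounded_mul _ T R leb _ _ 1) => // [|w].
  exact: measurable_fun_cos.
exact: cos_norm_le1.
Qed.

Lemma integrable_sinT (f : T -> R) (x : R) : leb.-integrable setT (EFin \o f) ->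
  leb.-integrable setT (EFin \o (fun w => f w * sin (2 * pi * (x * w)))).
Proof.
move=> fi; apply: (@integrable_bounded_mul _ T R leb _ _ 1) => // [|w].
  exact: measurable_fun_sin.
exact: sin_norm_le1.
Qed.

(** A square of an integral is a double integral, and cos(a) cos(b) + sin(a) sin(b) = cos(a - b). *)
Lemma specT_double (f : T -> R) (x : R) : leb.-integrable setT (EFin \o f) ->
  specT f x = \int[leb2]_z (f z.1 * f z.2 * cos (2 * pi * (x * (z.1 - z.2)))).
Proof.
move=> fi; have ci := integrable_cosT x fi; have si := integrable_sinT x fi.
transitivity (\int[leb2]_z
  ((f z.1 * cos (2 * pi * (x * z.1))) * (f z.2 * cos (2 * pi * (x * z.2))) +
   (f z.1 * sin (2 * pi * (x * z.1))) * (f z.2 * sin (2 * pi * (x * z.2))))).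
  rewrite RintegralD//; last 2 first.
  - exact: (lebesgue2_integrable_prodM ci ci).
  - exact: (lebesgue2_integrable_prodM si si).
  by rewrite (lebesgue2_Rintegral_prodM ci ci) (lebesgue2_Rintegral_prodM si si).
apply: eq_Rintegral => z _.
by rewrite !mulrBr cosB; ring.
Qed.

Lemma EFin_Rintegral d (X : measurableType d) (mu : {measure set X -> \bar R}) (h : X -> R) :
  mu.-integrable setT (EFin \o h) -> (\int[mu]_x (h x)%:E)%E = (\int[mu]_x h x)%:E.
Proof. by move=> hi; rewrite /Rintegral fineK//; exact: integrable_fin_num hi. Qed.

Lemma measurable_poisson_kernel (a : R) : measurable_fun setT (poisson_kernel a : T -> R).
Proof.
apply: measurable_funM => //; apply: measurable_fun_inv.
by apply: measurable_funM => //; apply: measurable_funD => //; exact: measurable_funX.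
Qed.

Lemma poisson_kernel_ge0 (a s : R) : 0 <= a -> 0 <= poisson_kernel a s.
Proof.
by move=> a0; rewrite divr_ge0// mulr_ge0 ?pi_ge0// addr_ge0 ?sqr_ge0.
Qed.

Lemma poisson_kernel_le (a s : R) : 0 < a -> `|poisson_kernel a s| <= (pi * a)^-1.
Proof.
move=> a0; have pi0 : 0 < (pi : R) := pi_gt0 R.
rewrite ger0_norm ?poisson_kernel_ge0 ?(ltW a0)// /poisson_kernel.
have q0 : 0 < a ^+ 2 + s ^+ 2 by rewrite ltr_wpDr ?sqr_ge0 ?exprn_gt0.
rewrite ler_pdivrMr ?mulr_gt0// mulrCA invfM -mulrA mulrA divff ?gt_eqF// mul1r.
by rewrite ler_pdivlMl// -expr2 lerDl sqr_ge0.
Qed.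

Lemma poisson_cos (a s : R) : 0 < a ->
  \int[leb]_x (expR (- (2 * pi * a) * `|x|) * cos (2 * pi * (x * s))) = poisson_kernel a s.
Proof.
move=> a0; have pi0 : 0 < (pi : R) := pi_gt0 R.
have c0 : 0 < 2 * pi * a by rewrite !mulr_gt0.
under eq_Rintegral do rewrite (mulrC _ s) mulrA.
rewrite Rintegral_expR_cos// /poisson_kernel; move: (pi) pi0 c0 => p p0 c0.
have q0 : 0 < a ^+ 2 + s ^+ 2 by rewrite ltr_wpDr ?sqr_ge0 ?exprn_gt0.
field; rewrite !gt_eqF//= ?mulr_gt0//.
by rewrite ltr_wpDr ?sqr_ge0 ?exprn_gt0.
Qed.

Section poisson_double.
Variables (f : T -> R) (a : R).
Hypotheses (fi : leb.-integrable setT (EFin \o f)) (a0 : 0 < a).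
Let rho (x : T) : R := expR (- (2 * pi * a) * `|x|).
Let H (xz : T * (T * T)) : R :=
  rho xz.1 * (f xz.2.1 * f xz.2.2) * cos (2 * pi * (xz.1 * (xz.2.1 - xz.2.2))).

Let c0 : 0 < 2 * pi * a. Proof. by rewrite !mulr_gt0// pi_gt0. Qed.

Let Hi : (leb \x leb2)%E.-integrable setT (EFin \o H).
Proof.
apply: (@integrable_bounded_mul _ _ R (leb \x leb2)%E
  (fun xz : T * (T * T) => rho xz.1 * (f xz.2.1 * f xz.2.2))
  (fun xz => cos (2 * pi * (xz.1 * (xz.2.1 - xz.2.2)))) 1).
- apply: measurable_fun_cos; apply: measurable_funM => //; apply: measurable_funM => //.
  apply: measurable_funB.
    exact: (measurableT_comp measurable_fst measurable_snd).
  exact: (measurableT_comp measurable_snd measurable_snd).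
- by move=> x; exact: cos_norm_le1.
- apply: (@integrable_prodM _ _ T (T * T)%type R leb leb2 rho (fun z => f z.1 * f z.2)).
    exact: integrable_expR_norm.
  exact: lebesgue2_integrable_prodM.
Qed.

Let inner1 (x : T) : (\int[leb2]_z (H (x, z))%:E = (rho x * specT f x)%:E)%E.
Proof.
have i1 : leb2.-integrable setT (EFin \o (fun z : T * T =>
    f z.1 * f z.2 * cos (2 * pi * (x * (z.1 - z.2))))).
  apply: (@integrable_bounded_mul _ _ R leb2 (fun z : T * T => f z.1 * f z.2)
    (fun z => cos (2 * pi * (x * (z.1 - z.2)))) 1).
  - apply: measurable_fun_cos; apply: measurable_funM => //; apply: measurable_funM => //.
    by apply: measurable_funB.
  - by move=> z; exact: cos_norm_le1.
  - exact: lebesgue2_integrable_prodM.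
under eq_integral do rewrite /H/= -mulrA EFinM.
by rewrite integralZl// EFin_Rintegral// -EFinM specT_double.
Qed.

Let inner2 (z : T * T) :
  (\int[leb]_x (H (x, z))%:E = (f z.1 * f z.2 * poisson_kernel a (z.1 - z.2))%:E)%E.
Proof.
have i2 : leb.-integrable setT (EFin \o (fun x : T =>
    rho x * cos (2 * pi * (x * (z.1 - z.2))))).
  apply: (@integrable_bounded_mul _ _ R leb rho _ 1).
  - by apply: measurable_fun_cos; apply: measurable_funM => //; exact: measurable_funM.
  - by move=> x; exact: cos_norm_le1.
  - exact: integrable_expR_norm.
rewrite -poisson_cos//.
under eq_integral do rewrite /H/= (mulrC (rho _)) -[X in X%:E]mulrA EFinM.
by rewrite integralZl// EFin_Rintegral// -EFinM.
Qed.

Lemma integrable_specT_expR : leb.-integrable setT (EFin \o (fun x => rho x * specT f x)).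
Proof.
have := integrable_fubini_F Hi; apply: eq_integrable => // x _.
exact: inner1.
Qed.

Lemma integrable_poisson_double : leb2.-integrable setT
  (EFin \o (fun z : T * T => f z.1 * f z.2 * poisson_kernel a (z.1 - z.2))).
Proof.
apply: (@integrable_bounded_mul _ _ R leb2 (fun z : T * T => f z.1 * f z.2)
    (fun z => poisson_kernel a (z.1 - z.2)) (pi * a)^-1).
- apply: (measurableT_comp (measurable_poisson_kernel a)).
  exact: measurable_funB.
- by move=> z; exact: poisson_kernel_le.
- exact: lebesgue2_integrable_prodM.
Qed.

(** The damping [rho] makes [H] integrable on the product, so Fubini applies: integrating the plane
    first gives the spectrum, integrating x first gives the kernel. *)
Lemma specT_poisson : (\int[leb]_x (rho x * specT f x)%:E =
  \int[leb2]_z (f z.1 * f z.2 * poisson_kernel a (z.1 - z.2))%:E)%E.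
Proof.
transitivity (\int[leb]_x (\int[leb2]_z (H (x, z))%:E))%E.
  by apply: eq_integral => x _; rewrite inner1.
rewrite (Fubini Hi).
by apply: eq_integral => z _; exact: inner2.
Qed.

End poisson_double.

End fourier.

Lemma integrable_measurable_fun d (X : measurableType d) (R : realType)
    (mu : {measure set X -> \bar R}) (f : X -> R) :
  mu.-integrable setT (EFin \o f) -> measurable_fun setT f.
Proof. by move=> fi; apply/measurable_EFinP; exact: measurable_int fi. Qed.

Lemma fatou_ae d (X : measurableType d) (R : realType) (mu : {measure set X -> \bar R})
    (u : nat -> X -> \bar R) (f : X -> \bar R) (M : \bar R) :
  (forall n, measurable_fun setT (u n)) -> (forall n x, (0 <= u n x)%E) ->
  measurable_fun setT f -> (forall x, (0 <= f x)%E) ->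
  {ae mu, forall x, u n x @[n --> \oo] --> f x} ->
  (forall n, (\int[mu]_x u n x <= M)%E) -> (\int[mu]_x f x <= M)%E.
Proof.
move=> mu_ u0 mf f0 uf uM.
have mli : measurable_fun setT (fun x => limn_einf (u^~ x)).
  rewrite (_ : (fun x => _) = (fun x => - limn_esup (fun n => - u n x))%E).
    apply: measurableT_comp => //; apply: measurable_fun_limn_esup => n.
    exact: measurableT_comp.
  by apply/funext => x; rewrite -[in RHS]/(_ \o _) limn_esupN oppeK.
have := @fatou _ X R mu setT measurableT u mu_ (fun n x _ => u0 n x).
rewrite (@ae_eq_integral _ _ _ mu setT f)//; last first.
  by apply: filterS uf => x ux _; rewrite (cvg_limn_einf_sup ux).
move=> /le_trans; apply; rewrite limn_einf_lim; apply: lime_le.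
  exact: is_cvg_einfs.
by apply: nearW => n; apply: le_trans (uM n); apply: ereal_inf_lbound; exists n => /=.
Qed.

Section plancherel.
Variable R : realType.
Local Notation T := (measurableTypeR R).
Local Notation leb := (@lebesgue_measure R).
Local Notation leb2 := (@lebesgue2 R).

Let eps (n : nat) : R := n.+1%:R^-1.
Let eps0 n : 0 < eps n. Proof. by rewrite invr_gt0. Qed.
Let eps_cvg : eps n @[n --> \oo] --> 0.
Proof. exact: cvg_harmonic. Qed.

Let expR_eps_cvg (x : R) : expR (- (2 * pi * eps n) * `|x|) @[n --> \oo] --> (1 : R).
Proof.
have h : - (2 * pi * eps n) * `|x| @[n --> \oo] --> 0.
  rewrite [X in _ --> X](_ : 0 = - (2 * pi * 0) * `|x|); last by rewrite mulr0 oppr0 mul0r.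
  by apply: cvgMr_tmp; apply: cvgN; apply: cvgMl_tmp; exact: eps_cvg.
have : expR (- (2 * pi * eps n) * `|x|) @[n --> \oo] --> expR (0 : R).
  by apply: continuous_cvg => //; exact: continuous_expR.
by rewrite expR0.
Qed.

Lemma integral_poisson_shift (a w : R) : 0 < a ->
  (\int[leb]_y (poisson_kernel a (w - y))%:E = 1)%E.
Proof.
move=> a0; rewrite -(integral_poisson_kernel a0).
have mP : measurable_fun setT (fun s : T => (poisson_kernel a s)%:E).
  by apply/measurable_EFinP; exact: measurable_poisson_kernel.
have P0 s : (0 <= (poisson_kernel a s)%:E)%E by rewrite lee_fin poisson_kernel_ge0 ?ltW.
have N1 : -1 != 0 :> R by rewrite oppr_eq0.
have := ge0_integral_affine w N1 mP P0.
rewrite normrN1 invr1 mul1e => <-; apply: eq_integral => y _.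
by rewrite mulN1r addrC.
Qed.

(** Fubini gives the measurability of the damped spectrum; multiplication by the inverse exponential
    removes the damping. *)
Lemma measurable_specT f : leb.-integrable setT (EFin \o f) -> measurable_fun setT (specT f : T -> R).
Proof.
move=> fi; have := integrable_specT_expR fi (ltr01 : 0 < 1) => /measurable_int/measurable_EFinP m1.
rewrite (_ : specT f = fun x => expR (2 * pi * 1 * `|x|) * (expR (- (2 * pi * 1) * `|x|) * specT f x)).
  apply: measurable_funM => //; apply: measurableT_comp => //.
  by apply: measurable_funM.
by apply/funext => x; rewrite mulrA -expRD mulNr subrr expR0 mul1r.
Qed.

Lemma specT_poisson_le (f : T -> R) (a : R) : leb.-integrable setT (EFin \o f) -> 0 < a ->
  (\int[leb]_x (expR (- (2 * pi * a) * `|x|) * specT f x)%:E <= \int[leb]_x (f x ^+ 2)%:E)%E.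
Proof.
move=> fi a0; rewrite specT_poisson//.
have mf : measurable_fun setT f by exact: integrable_measurable_fun fi.
have mP : measurable_fun setT (fun z : T * T => poisson_kernel a (z.1 - z.2)).
  apply: (measurableT_comp (measurable_poisson_kernel a)).
  exact: measurable_funB.
have P0 s : 0 <= poisson_kernel a s by rewrite poisson_kernel_ge0 ?ltW.
have m1 : measurable_fun setT (fun z : T * T => (f z.1 ^+ 2 * poisson_kernel a (z.1 - z.2))%:E).
  apply/measurable_EFinP/measurable_funM => //; apply: measurable_funX.
  exact: (measurableT_comp mf measurable_fst).
have m2 : measurable_fun setT (fun z : T * T => (f z.2 ^+ 2 * poisson_kernel a (z.1 - z.2))%:E).
  apply/measurable_EFinP/measurable_funM => //; apply: measurable_funX.
  exact: (measurableT_comp mf measurable_snd).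
(* The kernel has mass 1 in the variable that the square does not contain. *)
have I1 : (\int[leb2]_z (f z.1 ^+ 2 * poisson_kernel a (z.1 - z.2))%:E = \int[leb]_x (f x ^+ 2)%:E)%E.
  rewrite lebesgue2_tonelli//; last by move=> z; rewrite lee_fin mulr_ge0 ?sqr_ge0.
  apply: eq_integral => x _ /=; under eq_integral do rewrite EFinM.
  rewrite ge0_integralZl//=.
  - by rewrite integral_poisson_shift// mule1.
  - apply/measurable_EFinP; apply: (measurableT_comp (measurable_poisson_kernel a)).
    exact: measurable_funB.
  - by move=> *; rewrite lee_fin P0.
  - by rewrite lee_fin sqr_ge0.
have I2 : (\int[leb2]_z (f z.2 ^+ 2 * poisson_kernel a (z.1 - z.2))%:E = \int[leb]_x (f x ^+ 2)%:E)%E.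
  rewrite lebesgue2_tonelli2//; last by move=> z; rewrite lee_fin mulr_ge0 ?sqr_ge0.
  apply: eq_integral => x _ /=; under eq_integral do rewrite EFinM.
  rewrite ge0_integralZl//=.
  - under eq_integral => y _.
      rewrite (_ : poisson_kernel a (y - x) = poisson_kernel a (x - y)); first over.
      by rewrite /poisson_kernel -[(x - y) ^+ 2]sqrrN opprB.
    by rewrite integral_poisson_shift// mule1.
  - apply/measurable_EFinP; apply: (measurableT_comp (measurable_poisson_kernel a)).
    exact: measurable_funB.
  - by move=> *; rewrite lee_fin P0.
  - by rewrite lee_fin sqr_ge0.
apply: (@le_trans _ _ (\int[leb2]_z ((2^-1)%:E * (f z.1 ^+ 2 * poisson_kernel a (z.1 - z.2))%:E +
   (2^-1)%:E * (f z.2 ^+ 2 * poisson_kernel a (z.1 - z.2))%:E))%E).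
  apply: (@le_trans _ _ (\int[leb2]_z `|(f z.1 * f z.2 * poisson_kernel a (z.1 - z.2))%:E|)%E).
    apply: le_trans (lee_abs _) _; apply: le_abse_integral => //.
    exact: measurable_int (integrable_poisson_double fi a0).
  apply: ge0_le_integral => //.
  - apply: measurableT_comp => //.
    exact: measurable_int (integrable_poisson_double fi a0).
  - by apply: emeasurable_funD; apply: emeasurable_funM.
  - move=> z _; rewrite /= -!EFinM -EFinD lee_fin normrM (ger0_norm (P0 _)).
    rewrite [leRHS](_ : _ = 2^-1 * (f z.1 ^+ 2 + f z.2 ^+ 2) * poisson_kernel a (z.1 - z.2)); last by ring.
    rewrite ler_wpM2r// normrM -(real_normK (num_real (f z.1))) -(real_normK (num_real (f z.2))).
    have := sqr_ge0 (`|f z.1| - `|f z.2|); nra.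
rewrite ge0_integralD//.
- rewrite !ge0_integralZl// ?I1 ?I2//; last 2 first.
  + by move=> z _; rewrite lee_fin mulr_ge0 ?sqr_ge0.
  + by move=> z _; rewrite lee_fin mulr_ge0 ?sqr_ge0.
  rewrite -ge0_muleDl ?lee_fin//.
  by rewrite -EFinD (_ : _ + _ = 1) ?mul1e//; field.
- by move=> z _; rewrite -EFinM lee_fin mulr_ge0// mulr_ge0 ?sqr_ge0.
- exact: emeasurable_funM.
- by move=> z _; rewrite -EFinM lee_fin mulr_ge0// mulr_ge0 ?sqr_ge0.
- exact: emeasurable_funM.
Qed.

(* Abel summation: e^(-2 pi a |x|) has the Poisson kernel as transform, and
   f(z) f(z') <= (f(z)^2 + f(z')^2) / 2; then a tends to 0. *)
Lemma plancherel_le (f : T -> R) : leb.-integrable setT (EFin \o f) ->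
  (\int[leb]_x (specT f x)%:E <= \int[leb]_x (f x ^+ 2)%:E)%E.
Proof.
move=> fi; have ms := measurable_specT fi.
apply: (@fatou_ae _ T R leb (fun n x => (expR (- (2 * pi * eps n) * `|x|) * specT f x)%:E)).
- move=> n; apply/measurable_EFinP/measurable_funM => //.
  by apply: measurableT_comp => //; apply: measurable_funM.
- by move=> n x; rewrite lee_fin mulr_ge0 ?expR_ge0 ?specT_ge0.
- exact/measurable_EFinP.
- by move=> x; rewrite lee_fin specT_ge0.
- apply: aeW => x; apply: cvg_EFin; first exact: nearW.
  rewrite -[X in _ --> X]mul1r; apply: cvgMr_tmp.
  exact: expR_eps_cvg.
- by move=> n; exact: specT_poisson_le.
Qed.

End plancherel.

Section affine_signed.
Variable R : realType.
Local Notation T := (measurableTypeR R).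
Local Notation leb := (@lebesgue_measure R).

Lemma integrable_affine (a b : R) (h : T -> \bar R) : a != 0 ->
  leb.-integrable setT h -> leb.-integrable setT (fun x => h (a * x + b)%R).
Proof.
move=> a0 /integrableP[mh hoo]; apply/integrableP; split.
  by apply: (measurableT_comp mh); exact: measurable_affine.
rewrite (@ge0_integral_affine R a b (fun x => `|h x|)%E)//; last exact: measurableT_comp.
by rewrite lte_mul_pinfty// lee_fin.
Qed.

Lemma integral_affine (a b : R) (h : T -> \bar R) : a != 0 ->
  leb.-integrable setT h ->
  (\int[leb]_x h (a * x + b)%R = (`|a|^-1)%:E * \int[leb]_x h x)%E.
Proof.
move=> a0 hi; have mh := measurable_int _ hi.
rewrite integralE [in RHS]integralE muleBr//; last first.
  apply: fin_num_adde_defl; rewrite fin_numN; exact: integrable_neg_fin_num.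
rewrite -(ge0_integral_affine b a0)//; last exact: measurable_funepos.
rewrite -(ge0_integral_affine b a0)//; last exact: measurable_funeneg.
congr (_ - _)%E.
  by apply: eq_integral => x _; rewrite funeposE funeposE.
by apply: eq_integral => x _; rewrite funenegE funenegE.
Qed.

Lemma integral_reflect (w : R) (h : T -> \bar R) : leb.-integrable setT h ->
  (\int[leb]_x h (w - x)%R = \int[leb]_x h x)%E.
Proof.
move=> hi; have N1 : -1 != 0 :> R by rewrite oppr_eq0.
have := integral_affine w N1 hi; rewrite normrN1 invr1 mul1e => <-.
by apply: eq_integral => x _; rewrite mulN1r addrC.
Qed.

Lemma integral_shift (w : R) (h : T -> \bar R) : leb.-integrable setT h ->
  (\int[leb]_x h (x + w)%R = \int[leb]_x h x)%E.
Proof.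
move=> hi; have := integral_affine w (oner_neq0 R) hi; rewrite normr1 invr1 mul1e => <-.
by apply: eq_integral => x _; rewrite mul1r.
Qed.

End affine_signed.

(** * The lower bound for bounded functions *)

Section plancherel_lower.
Variable R : realType.
Local Notation T := (measurableTypeR R).
Local Notation leb := (@lebesgue_measure R).
Local Notation leb2 := (@lebesgue2 R).
Local Notation eps := (@harmonic R).

Let eps0 n : 0 < eps n. Proof. exact: harmonic_gt0. Qed.
Let eps_cvg : eps n @[n --> \oo] --> (0 : R).
Proof. exact: cvg_harmonic. Qed.

Lemma poisson_kernel_scale (a y : R) : 0 < a ->
  poisson_kernel a (a * y) = a^-1 * poisson_kernel 1 y.
Proof.
move=> a0; rewrite /poisson_kernel; have pi0 : (pi : R) != 0 by rewrite gt_eqF ?pi_gt0.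
move: pi pi0 => p p0.
have x1 : 0 < 1 ^+ 2 + y ^+ 2 by rewrite expr1n ltr_pwDl ?sqr_ge0.
have -> : a ^+ 2 + (a * y) ^+ 2 = a ^+ 2 * (1 ^+ 2 + y ^+ 2) by ring.
move: (1 ^+ 2 + y ^+ 2) x1 => q q0.
by field; rewrite p0 !gt_eqF.
Qed.

Lemma integrable_poisson_kernel (a : R) : 0 < a ->
  leb.-integrable setT (EFin \o (poisson_kernel a : T -> R)).
Proof.
move=> a0; apply: integrable_ge0_lty.
- exact: measurable_poisson_kernel.
- by move=> x; rewrite poisson_kernel_ge0 ?ltW.
- by rewrite integral_poisson_kernel// ltry.
Qed.

Section bounded.
Variables (f : T -> R) (M : R).
Hypotheses (fi : leb.-integrable setT (EFin \o f)) (fM : forall x, `|f x| <= M).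
Hypothesis fc : forall w y : R, f (w - eps n * y) @[n --> \oo] --> f w.

Let mf : measurable_fun setT f := integrable_measurable_fun fi.

Let g n (z : T * T) : R := f z.1 * poisson_kernel 1 z.2 * f (z.1 - eps n * z.2).

Let gi n : leb2.-integrable setT (EFin \o g n).
Proof.
apply: (@integrable_bounded_mul _ _ R leb2 (fun z : T * T => f z.1 * poisson_kernel 1 z.2)
   (fun z => f (z.1 - eps n * z.2)) M) => //.
  apply: (measurableT_comp mf); apply: measurable_funB => //.
  exact: measurable_funM.
by apply: lebesgue2_integrable_prodM => //; exact: integrable_poisson_kernel.
Qed.

(** The inner substitution y = w - eps s moves the dependence on eps from the kernel to the
    translate f(w - eps s), in preparation for dominated convergence. *)
Let gE n : (\int[leb2]_z (f z.1 * f z.2 * poisson_kernel (eps n) (z.1 - z.2))%:E =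
  \int[leb2]_z (g n z)%:E)%E.
Proof.
rewrite (lebesgue2_fubini (integrable_poisson_double fi (eps0 n))).
rewrite (lebesgue2_fubini (gi n)); apply: eq_integral => w _.
pose h (y : T) : R := f y * (f w * poisson_kernel (eps n) (w - y)).
have hi : leb.-integrable setT (EFin \o h).
  apply: (@integrable_bounded_mul _ T R leb f _ (`|f w| * (pi * eps n)^-1)) => //.
    apply: measurable_funM => //; apply: (measurableT_comp (measurable_poisson_kernel _)).
    exact: measurable_funB.
  by move=> y; rewrite normrM ler_wpM2l// poisson_kernel_le.
have en0 : - eps n != 0 by rewrite oppr_eq0 gt_eqF.
have := integral_affine w en0 hi; rewrite normrN gtr0_norm//.
move=> /(congr1 (fun x => (eps n)%:E * x)%E); rewrite muleA -EFinM divff ?gt_eqF// mul1e.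
move=> hE; transitivity (\int[leb]_y (EFin \o h) y)%E.
  by apply: eq_integral => y _; rewrite /h/=; congr (_%:E); ring.
rewrite -hE -integralZl//; last exact: (integrable_affine w en0 hi).
apply: eq_integral => y _; rewrite /comp -EFinM /h /g /fst /snd; congr (_%:E).
have -> : w - (- eps n * y + w) = eps n * y by rewrite opprD mulNr opprK addrCA subrr addr0.
rewrite poisson_kernel_scale// mulNr addrC.
move: (eps n) (eps0 n) => e e0; move: (f _) (f _) (poisson_kernel _ _) => u v p.
by field; rewrite gt_eqF.
Qed.

(** The bound M provides the dominating function M |f(w)| P(s), with P the kernel of parameter 1,
    and [fc] the pointwise limit, so the double integrals tend to the integral of f^2. Each of them
    is a damped integral of the spectrum, hence at most the undamped one. *)
Lemma plancherel_ge_bounded :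
  (\int[leb]_x (f x ^+ 2)%:E <= \int[leb]_x (specT f x)%:E)%E.
Proof.
have M0 : 0 <= M by exact: le_trans (fM 0).
have cv : (\int[leb2]_z (g n z)%:E)%E @[n --> \oo] -->
    (\int[leb2]_z (f z.1 * poisson_kernel 1 z.2 * f z.1)%:E)%E.
  have [|||||_ _] := @dominated_convergence _ _ R leb2 setT measurableT
    (fun n z => (g n z)%:E) (fun z => (f z.1 * poisson_kernel 1 z.2 * f z.1)%:E)
    (fun z => (M * `|f z.1 * poisson_kernel 1 z.2|)%:E); last exact.
  - by move=> n; exact: measurable_int (gi n).
  - apply/measurable_EFinP; apply: measurable_funM.
      by apply: measurable_funM; [exact: (measurableT_comp mf)|
        exact: (measurableT_comp (measurable_poisson_kernel _))].
    exact: (measurableT_comp mf).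
  - apply: aeW => z _; apply: cvg_EFin; first exact: nearW.
    by apply: cvgMl_tmp; exact: fc.
  - have := @integrable_norm _ _ _ leb2 setT (fun z => f z.1 * poisson_kernel 1 z.2)
      (lebesgue2_integrable_prodM fi (integrable_poisson_kernel ltr01)).
    by move=> /(integrableZl measurableT M).
  - apply: aeW => z n _; rewrite /= lee_fin /g normrM mulrC ler_wpM2r//.
rewrite (_ : (\int[leb2]_z _)%E = (\int[leb]_x (f x ^+ 2)%:E)%E) in cv; last first.
  rewrite lebesgue2_tonelli.
  - apply: eq_integral => w _ /=.
    under eq_integral do rewrite mulrAC EFinM.
    rewrite ge0_integralZl//=.
    + by rewrite integral_poisson_kernel// mule1.
    + by apply/measurable_EFinP; exact: measurable_poisson_kernel.
    + by move=> y _; rewrite lee_fin poisson_kernel_ge0.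
    + by rewrite lee_fin -expr2 sqr_ge0.
  - apply/measurable_EFinP; apply: measurable_funM.
      by apply: measurable_funM; [exact: (measurableT_comp mf)|
        exact: (measurableT_comp (measurable_poisson_kernel _))].
    exact: (measurableT_comp mf).
  - by move=> z; rewrite lee_fin mulrAC mulr_ge0 ?poisson_kernel_ge0// -expr2 sqr_ge0.
rewrite -(cvg_lim _ cv)//; apply: lime_le; first by apply/cvg_ex; eexists; exact: cv.
apply: nearW => n; rewrite -gE -specT_poisson//; apply: ge0_le_integral => //.
- by move=> x _; rewrite lee_fin mulr_ge0 ?expR_ge0 ?specT_ge0.
- exact: measurable_int (integrable_specT_expR fi (eps0 n)).
- by apply/measurable_EFinP; exact: measurable_specT.
- move=> x _; rewrite lee_fin ler_piMl ?specT_ge0// -[leRHS]expR0 ler_expR.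
  by rewrite mulNr oppr_le0 !mulr_ge0// ?pi_ge0 ?(ltW (eps0 _)).
Qed.

End bounded.
End plancherel_lower.

(** * Averages over intervals *)

Section box_average.
Variable R : realType.
Local Notation T := (measurableTypeR R).
Local Notation leb := (@lebesgue_measure R).
Local Notation leb2 := (@lebesgue2 R).

Definition box (d : R) (s : T) : R := (2 * d)^-1 * \1_(`]- d, d[%classic : set T) s.

Definition box_average (f : T -> R) (d : R) (w : T) : R :=
  \int[leb]_s (box d s * f (w - s)).

Variables (f : T -> R) (d : R).
Hypotheses (fi : leb.-integrable setT (EFin \o f)) (d0 : 0 < d).

Let mf : measurable_fun setT f := integrable_measurable_fun fi.

Let d2 : 0 < (2 * d)^-1. Proof. by rewrite invr_gt0 mulr_gt0. Qed.

Let box_ge0 s : 0 <= box d s.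
Proof. by rewrite mulr_ge0 ?(ltW d2). Qed.

Let box_le s : `|box d s| <= (2 * d)^-1.
Proof.
rewrite ger0_norm// ler_piMr ?(ltW d2)// indicE; by case: (_ \in _).
Qed.

Let measurable_box : measurable_fun setT (box d).
Proof.
by apply: measurable_funM => //; apply: measurable_indic.
Qed.

Let integral_box : (\int[leb]_s (box d s)%:E = 1)%E.
Proof.
have lE : leb `]- d, d[%classic = (2 * d)%:E.
  rewrite lebesgue_measure_itv/= lte_fin -subr_gt0 opprK addr_gt0//.
  by rewrite mulr_natl mulr2n.
under eq_integral do rewrite EFinM.
rewrite ge0_integralZl; first last.
- by rewrite lee_fin (ltW d2).
- by move=> s _; rewrite lee_fin.
- by apply/measurable_EFinP; apply: measurable_indic.
- exact: measurableT.
rewrite integral_indic; [|exact: measurableT|by []].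
rewrite setIT [X in (_ * X)%E]lE -EFinM mulVf//.
by rewrite gt_eqF ?mulr_gt0.
Qed.

Let integrable_box : leb.-integrable setT (EFin \o box d).
Proof. by apply: integrable_ge0_lty => //; rewrite integral_box ltry. Qed.

Let G (z : T * T) : R := box d z.2 * f (z.1 - z.2).

Let Gi : leb2.-integrable setT (EFin \o G).
Proof.
apply/integrable21ltyP.
  apply/measurable_EFinP/measurable_funM.
    exact: (measurableT_comp measurable_box).
  by apply: (measurableT_comp mf); exact: measurable_funB.
have mnf : measurable_fun setT (fun x : T => `|f x|%:E).
  by apply/measurable_EFinP; exact: measurableT_comp.
rewrite (eq_integral (fun s : T => (box d s)%:E * \int[leb]_x `|f x|%:E)%E); last first.
  move=> s _; under eq_integral do rewrite /= /G /= normrM (ger0_norm (box_ge0 _)) EFinM.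
  rewrite ge0_integralZl//=.
  - by rewrite -(@ge0_integral_shift R (- s) (fun x => `|f x|%:E))//.
  - by apply: (measurableT_comp mnf); exact: measurable_funB.
  - by rewrite lee_fin.
rewrite ge0_integralZr//=.
- rewrite integral_box mul1e; by case/integrableP : fi.
- exact/measurable_EFinP.
- by move=> s _; rewrite lee_fin.
- exact: integral_ge0.
Qed.

Let inner_i (w : T) : leb.-integrable setT (EFin \o (fun s : T => box d s * f (w - s))).
Proof.
have N1 : -1 != 0 :> R by rewrite oppr_eq0.
have := integrable_affine w N1 fi => fwi.
have fwi' : leb.-integrable setT (EFin \o (fun s : T => f (w - s))).
  by apply: eq_integrable fwi => // s _ /=; rewrite mulN1r addrC.
have := @integrable_bounded_mul _ T R leb _ _ _ measurable_box box_le fwi'.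
by apply: eq_integrable => // s _ /=; rewrite mulrC.
Qed.

Let avgE (w : T) : (box_average f d w)%:E = (\int[leb]_s (box d s * f (w - s))%:E)%E.
Proof. by rewrite EFin_Rintegral. Qed.

Lemma integrable_box_average : leb.-integrable setT (EFin \o box_average f d).
Proof.
have := integrable_fubini_F Gi; apply: eq_integrable => // w _.
by rewrite /= avgE.
Qed.

Lemma integrable_box_reflect (w : T) :
  leb.-integrable setT (EFin \o (fun v : T => box d (w - v) * f v)).
Proof.
have := @integrable_bounded_mul _ T R leb f (fun v => box d (w - v)) ((2 * d)^-1) _ _ fi.
move=> h; apply: eq_integrable (h _ _) => // [v _ /=|]; first by rewrite mulrC.
by apply: (measurableT_comp measurable_box); exact: measurable_funB.
Qed.

(** In this form w occurs in the window only and no longer in f, which gives the uniform bound and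
    the continuity in w. *)
Lemma box_average_reflect (w : T) :
  box_average f d w = \int[leb]_v (box d (w - v) * f v).
Proof.
apply: EFin_inj; rewrite avgE -(integral_reflect w (inner_i w)) /= -EFin_Rintegral.
  by apply: eq_integral => v _; rewrite subKr.
exact: integrable_box_reflect.
Qed.

Lemma box_average_bounded (w : T) :
  `|box_average f d w| <= (2 * d)^-1 * \int[leb]_v `|f v|.
Proof.
have nfi : leb.-integrable setT (EFin \o (fun v => `|f v|)) := integrable_norm fi.
rewrite -RintegralZl// box_average_reflect.
have hi := integrable_box_reflect w.
apply: le_trans (le_normr_Rintegral _ _) _ => //.
apply: le_Rintegral => //; [exact: integrable_norm hi|exact: (integrableZl _ _ nfi)|].
by move=> v _; rewrite normrM ler_wpM2r.
Qed.

(** Dominated convergence, the windows being bounded by 1 / (2 d); f itself need not be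
    continuous. *)
Lemma box_average_cvg (w : T) (u : nat -> R) : u n @[n --> \oo] --> w ->
  box_average f d (u n) @[n --> \oo] --> box_average f d w.
Proof.
move=> uw; under eq_fun do rewrite box_average_reflect.
rewrite box_average_reflect.
have mb (w' : R) : measurable_fun setT (fun v : T => (box d (w' - v) * f v)%:E).
  apply/measurable_EFinP/measurable_funM => //.
  by apply: (measurableT_comp measurable_box); exact: measurable_funB.
have cv : (\int[leb]_v (box d (u n - v) * f v)%:E)%E @[n --> \oo] -->
    (\int[leb]_v (box d (w - v) * f v)%:E)%E.
  have [|||||_ _] := @dominated_convergence _ _ R leb setT measurableT
    (fun n v => (box d (u n - v) * f v)%:E) (fun v => (box d (w - v) * f v)%:E)
    (fun v => ((2 * d)^-1 * `|f v|)%:E); last exact.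
  - by move=> n; exact: mb.
  - exact: mb.
  (* The indicator of the moving window is eventually constant at every v other than the end points
     of the limit window. *)
  - exists ([set w - d] `|` [set w + d]); split.
    + by apply: measurableU; exact: measurable_set1.
    + apply/eqP; rewrite -measure_le0.
      have := @measureU2 _ _ _ leb [set w - d] [set w + d] (measurable_set1 _) (measurable_set1 _).
      move=> /le_trans; apply.
      rewrite [X in (X + _ <= _)%E](lebesgue_measure_set1 (w - d)).
      by rewrite [X in (_ + X <= _)%E](lebesgue_measure_set1 (w + d)) adde0.
    + move=> v /=; apply: contra_notP => /not_orP[vd1 vd2] _.
      apply: cvg_EFin; first exact: nearW.
      apply: cvgMr_tmp; apply: cvgMl_tmp; apply: cvg_near_cst.
      have uv : u n - v @[n --> \oo] --> w - v by apply: cvgB => //; exact: cvg_cst.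
      have [wd|wd] := ltP (w - v) (- d).
        near=> n; rewrite !indicE !memNset//= in_itv/=; apply/negP.
          by rewrite (lt_gtF wd).
        rewrite (@lt_gtF _ _ (u n - v))//; near: n; exact: (cvgr_lt _ uv).
      have {}wd : - d < w - v.
        rewrite lt_neqAle wd andbT; apply/eqP => dw; apply: vd2.
        by rewrite -[d]opprK dw opprB addrC subrK.
      have [dw|dw] := ltP d (w - v).
        near=> n; rewrite !indicE !memNset//= in_itv/=; apply/negP.
          by rewrite (lt_gtF dw) andbF.
        rewrite (@lt_gtF _ _ _ (u n - v)) ?andbF//; near: n; exact: (cvgr_gt _ uv).
      have {}dw : w - v < d.
        rewrite lt_neqAle dw andbT; apply/eqP => wd'; apply: vd1.
        by rewrite -wd' subKr.
      near=> n; rewrite !indicE !mem_set//= in_itv/= ?wd ?dw//.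
      by apply/andP; split; near: n; [exact: (cvgr_gt _ uv)|exact: (cvgr_lt _ uv)].
  - exact: (integrableZl _ _ (integrable_norm fi)).
  - by apply: aeW => v n _; rewrite lee_fin normrM ler_wpM2r.
rewrite /Rintegral; apply: fine_cvg; rewrite fineK//.
exact: (integrable_fin_num measurableT (integrable_box_reflect w)).
Unshelve. all: by end_near. Qed.

(** Fubini and a translation move the averaging from f to the bounded test function k. *)
Let avg_pairing (k : T -> R) : measurable_fun setT k -> (forall x, `|k x| <= 1) ->
  \int[leb]_w (box_average f d w * k w) =
  \int[leb]_s (box d s * \int[leb]_v (f v * k (v + s))).
Proof.
move=> mk k1.
have Gki : leb2.-integrable setT (EFin \o (fun z => G z * k z.1)).
  apply: (@integrable_bounded_mul _ _ R leb2 G (fun z => k z.1) 1) => //.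
  exact: (measurableT_comp mk).
have fki s : leb.-integrable setT (EFin \o (fun v => f v * k (v + s))).
  apply: (@integrable_bounded_mul _ T R leb f (fun v => k (v + s)) 1) => //.
  by apply: (measurableT_comp mk); exact: measurable_funD.
rewrite /Rintegral; congr fine.
transitivity (\int[leb]_w \int[leb]_s (G (w, s) * k w)%:E)%E.
  apply: eq_integral => w _; rewrite EFinM avgE muleC -integralZl//; last exact: inner_i.
  by apply: eq_integral => s _; rewrite -EFinM mulrC.
rewrite -[LHS](lebesgue2_fubini Gki) -integral21_prod_meas1//.
apply: eq_integral => s _; rewrite -/(Rintegral _ _ _) EFinM -EFin_Rintegral// -integralZl//.
rewrite -[RHS](integral_shift (- s)); last exact: (integrableZl _ _ (fki s)).
  by apply: eq_integral => w _; rewrite -EFinM /G /= subrK mulrA.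
exact: fki.
Qed.

Let mphase (x : R) : measurable_fun setT (fun w : T => 2 * pi * (x * w)).
Proof. by apply: measurable_funM => //; exact: measurable_funM. Qed.

(** The average is a convolution, so its transform is a product; this and [sinT_box_average] are the
    two real components of that identity. *)
Lemma cosT_box_average x : cosT (box_average f d) x =
  cosT f x * cosT (box d) x - sinT f x * sinT (box d) x.
Proof.
rewrite /cosT /sinT avg_pairing; [|exact: measurable_fun_cos|by move=> y; exact: cos_norm_le1].
have bc := integrable_cosT x integrable_box; have bs := integrable_sinT x integrable_box.
have fc := integrable_cosT x fi; have fs := integrable_sinT x fi.
rewrite -!RintegralZl// -RintegralB//; [|exact: (integrableZl _ _ bc)|exact: (integrableZl _ _ bs)].
apply: eq_Rintegral => s _.
under eq_Rintegral do rewrite (mulrDr x) (mulrDr (2 * pi)) cosD (mulrBr (f _)) !(mulrA (f _)).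
rewrite RintegralB//.
- rewrite !RintegralZr//; ring.
- by apply: eq_integrable (integrableZr measurableT (cos (2 * pi * (x * s))) fc).
- by apply: eq_integrable (integrableZr measurableT (sin (2 * pi * (x * s))) fs).
Qed.

Lemma sinT_box_average x : sinT (box_average f d) x =
  sinT f x * cosT (box d) x + cosT f x * sinT (box d) x.
Proof.
rewrite /cosT /sinT avg_pairing; [|exact: measurable_fun_sin|by move=> y; exact: sin_norm_le1].
have bc := integrable_cosT x integrable_box; have bs := integrable_sinT x integrable_box.
have fc := integrable_cosT x fi; have fs := integrable_sinT x fi.
rewrite -!RintegralZl// -RintegralD//; [|exact: (integrableZl _ _ bc)|exact: (integrableZl _ _ bs)].
apply: eq_Rintegral => s _.
under eq_Rintegral do rewrite (mulrDr x) (mulrDr (2 * pi)) sinD (mulrDr (f _)) !(mulrA (f _)).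
rewrite RintegralD//.
- rewrite !RintegralZr//; ring.
- by apply: eq_integrable (integrableZr measurableT (cos (2 * pi * (x * s))) fs).
- by apply: eq_integrable (integrableZr measurableT (sin (2 * pi * (x * s))) fc).
Qed.

(** A nonnegative function of mass 1 has a transform of modulus at most 1: bound the cosine by 1 in
    the double integral. *)
Lemma specT_box_le1 x : specT (box d) x <= 1.
Proof.
rewrite (specT_double _ integrable_box).
have b2 := lebesgue2_integrable_prodM integrable_box integrable_box.
have b2c : leb2.-integrable setT (EFin \o (fun z : T * T =>
    box d z.1 * box d z.2 * cos (2 * pi * (x * (z.1 - z.2))))).
  apply: (@integrable_bounded_mul _ _ R leb2 _ _ 1) => //.
    apply: measurable_fun_cos; apply: measurable_funM => //; apply: measurable_funM => //.
    exact: measurable_funB.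
  by move=> z; exact: cos_norm_le1.
apply: (@le_trans _ _ (\int[leb2]_z (box d z.1 * box d z.2))).
  apply: le_Rintegral => // z _.
  by rewrite ler_piMr ?cos_le1// mulr_ge0.
by rewrite (lebesgue2_Rintegral_prodM integrable_box integrable_box) /Rintegral integral_box mulr1.
Qed.

Lemma specT_box_average_le x : specT (box_average f d) x <= specT f x.
Proof.
have -> : specT (box_average f d) x = specT f x * specT (box d) x.
  by rewrite /specT cosT_box_average sinT_box_average; ring.
by rewrite ler_piMr ?specT_ge0 ?specT_box_le1.
Qed.

End box_average.

Section plancherel.
Variable R : realType.
Local Notation T := (measurableTypeR R).
Local Notation leb := (@lebesgue_measure R).

(** Lebesgue differentiation: these averages are means of f over balls that shrink to x. *)
Lemma box_average_cvg_ae (f : T -> R) : leb.-integrable setT (EFin \o f) ->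
  {ae leb, forall x, box_average f (harmonic n) x @[n --> \oo] --> f x}.
Proof.
move=> fi; have e0 n : 0 < @harmonic R n by exact: harmonic_gt0.
have lf : locally_integrable setT f by apply: open_integrable_locally => //; exact: openT.
pose E (x : R) (n : nat) : set R := ball x (harmonic n).
have hE x : nicely_shrinking x (E x).
  split=> [n|]; first exact: measurable_ball.
  exists (1, fun n => PosNum (e0 n)); split => //; [exact: cvg_harmonic|by move=> n y|].
  by move=> n; rewrite [leRHS]mul1e.
have := lebesgue_differentiation lf; apply: filterS; first exact: (ae_filter_ringOfSetsType leb).
move=> x /(nice_lebesgue_differentiation hE lf) h.
have hbE n : (box_average f (harmonic n) x)%:E =
   ((lebesgue_measure (E x n))^-1 * \int[lebesgue_measure]_(y in E x n) (f y)%:E)%E.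
  rewrite lebesgue_measure_ball ?(ltW (e0 n))// box_average_reflect//.
  rewrite inver mulrn_eq0 [_ == 0 :> R]gt_eqF// -EFin_Rintegral; last exact: integrable_box_reflect.
  have -> : (@harmonic R n *+ 2)^-1 = (2 * harmonic n)^-1 by rewrite mulr_natl.
  rewrite [in RHS]integral_mkcond -integralZl//; last first.
    apply/(integrable_mkcond _ _).1; first exact: measurable_ball.
    by apply: integrableS fi => //; exact: measurable_ball.
  apply: eq_integral => v _; rewrite /box -mulrA EFinM; congr (_ * _)%E.
  rewrite patchE indicE/=; have -> : (x - v \in (`]- harmonic n, harmonic n[%classic : set T)) = (v \in E x n).
    have key (h' y z : R) : (- h' < y - z < h') = (y - h' < z < y + h').
      by apply/idP/idP => /andP[? ?]; apply/andP; split; lra.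
    by apply/idP/idP; rewrite !inE /E/= in_itv/= ball_itv/= in_itv/= key.
  by case: ifPn; rewrite ?mul1r ?mul0r.
have {}h : (box_average f (harmonic n) x)%:E @[n --> \oo] --> (f x)%:E.
  by under eq_fun do rewrite hbE.
exact: (fine_cvg h).
Qed.

(* The averages of f over boxes are bounded, so that the lower bound holds for them; their
   transforms are no larger than that of f, and they converge to f almost everywhere. *)
Lemma plancherel_ge (f : T -> R) : leb.-integrable setT (EFin \o f) ->
  (\int[leb]_x (f x ^+ 2)%:E <= \int[leb]_x (specT f x)%:E)%E.
Proof.
move=> fi; have e0 n : 0 < @harmonic R n by exact: harmonic_gt0.
have ai n := integrable_box_average fi (e0 n).
apply: (@fatou_ae _ T R leb (fun n x => (box_average f (harmonic n) x ^+ 2)%:E)).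
- move=> n; apply/measurable_EFinP; apply: measurable_funX; exact: integrable_measurable_fun (ai n).
- by move=> n x; rewrite lee_fin sqr_ge0.
- by apply/measurable_EFinP; apply: measurable_funX; exact: integrable_measurable_fun fi.
- by move=> x; rewrite lee_fin sqr_ge0.
- apply: filterS (box_average_cvg_ae fi) => x ax.
  by apply: cvg_EFin; [exact: nearW|rewrite expr2; apply: cvgM].
- move=> n.
  apply: le_trans (plancherel_ge_bounded (ai n) (box_average_bounded fi (e0 n)) _) _.
    move=> w y; apply: box_average_cvg => //.
    rewrite [X in _ --> X](_ : w = w - 0 * y); last by rewrite mul0r subr0.
    by apply: cvgB; [exact: cvg_cst|apply: cvgMr_tmp; exact: cvg_harmonic].
  apply: ge0_le_integral => //.
  + by move=> x _; rewrite lee_fin specT_ge0.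
  + by apply/measurable_EFinP; exact: measurable_specT.
  + by apply/measurable_EFinP; exact: measurable_specT.
  + by move=> x _; rewrite lee_fin specT_box_average_le.
Qed.

Lemma plancherel_real (f : T -> R) : leb.-integrable setT (EFin \o f) ->
  (\int[leb]_x (specT f x)%:E = \int[leb]_x (f x ^+ 2)%:E)%E.
Proof. by move=> fi; apply/eqP; rewrite eq_le plancherel_le ?plancherel_ge. Qed.

End plancherel.

(** * Complex-valued functions *)

Section complex_functions.
Context d (X : measurableType d) (R : realType).
Local Notation Re := (@complex.Re R).
Local Notation Im := (@complex.Im R).
Implicit Types h k : X -> R[i].

Definition csq (z : R[i]) : R := Re z ^+ 2 + Im z ^+ 2.

Lemma csq_ge0 z : 0 <= csq z. Proof. by rewrite addr_ge0 ?sqr_ge0. Qed.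

Lemma csqM z w : csq (z * w) = csq z * csq w.
Proof. by case: z w => a b [c e]; rewrite /csq /=; ring. Qed.

Lemma csq_conj z : csq z^*%C = csq z.
Proof. by case: z => a b; rewrite /csq /= sqrrN. Qed.

Lemma csq_real (x : R) : csq x%:C%C = x ^+ 2.
Proof. by rewrite /csq /= expr0n addr0. Qed.

Lemma dnorm_complex (z : R[i]^o) : dnorm (@complex_dot R) z = csq z.
Proof. by case: z => a b; rewrite /dnorm /complex_dot /csq /=; ring. Qed.

Definition cmeasurable h := measurable_fun setT (Re \o h) /\ measurable_fun setT (Im \o h).

Lemma cmeasurableM h k : cmeasurable h -> cmeasurable k -> cmeasurable (fun x => h x * k x).
Proof.
move=> [h1 h2] [k1 k2]; split.
  rewrite (_ : _ \o _ = (Re \o h) \* (Re \o k) \- (Im \o h) \* (Im \o k)).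
    by apply: measurable_funB; apply: measurable_funM.
  by apply/funext => x /=; case: (h x) (k x) => ? ? [].
rewrite (_ : _ \o _ = (Re \o h) \* (Im \o k) \+ (Im \o h) \* (Re \o k)).
  by apply: measurable_funD; apply: measurable_funM.
by apply/funext => x /=; case: (h x) (k x) => ? ? [].
Qed.

Lemma cmeasurable_conj h : cmeasurable h -> cmeasurable (fun x => (h x)^*%C).
Proof.
move=> [h1 h2]; split.
  by rewrite (_ : _ \o _ = Re \o h)//; apply/funext => x /=; case: (h x).
rewrite (_ : _ \o _ = \- (Im \o h)); first exact: measurableT_comp.
by apply/funext => x /=; case: (h x).
Qed.

Lemma cmeasurable_real (f : X -> R) : measurable_fun setT f -> cmeasurable (fun x => (f x)%:C%C).
Proof. by move=> mf; split => //; exact: measurable_cst. Qed.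

Lemma cmeasurable_expi (f : X -> R) : measurable_fun setT f -> cmeasurable (fun x => expi (f x)).
Proof. by move=> mf; split; [exact: measurable_fun_cos|exact: measurable_fun_sin]. Qed.

Lemma measurable_csq h : cmeasurable h -> measurable_fun setT (fun x => csq (h x)).
Proof.
by move=> [h1 h2]; apply: measurable_funD; apply: measurable_funX.
Qed.

Variable mu : {measure set X -> \bar R}.

Definition cintegrable h :=
  mu.-integrable setT (EFin \o (Re \o h)) /\ mu.-integrable setT (EFin \o (Im \o h)).

Lemma cintegrable_cmeasurable h : cintegrable h -> cmeasurable h.
Proof. by move=> [h1 h2]; split; [exact: (integrable_measurable_fun h1)|exact: (integrable_measurable_fun h2)]. Qed.

Lemma cintegrable_expi h (f : X -> R) : measurable_fun setT f -> cintegrable h ->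
  cintegrable (fun x => expi (f x) * h x).
Proof.
move=> mf [h1 h2].
have mc := measurable_fun_cos mf; have ms := measurable_fun_sin mf.
have b (g : X -> R) : mu.-integrable setT (EFin \o g) ->
    mu.-integrable setT (EFin \o (fun x => g x * cos (f x))) /\
    mu.-integrable setT (EFin \o (fun x => g x * sin (f x))).
  move=> gi; split; apply: (@integrable_bounded_mul _ _ _ mu g _ 1) => // x.
    exact: cos_norm_le1.
  exact: sin_norm_le1.
have [[a1 a2] [b1 b2]] := (b _ h1, b _ h2); split.
  apply: eq_integrable (integrableB measurableT a1 b2) => // x _ /=.
  by case: (h x) => u v /=; rewrite -EFinB mulrC [v * _]mulrC.
apply: eq_integrable (integrableD measurableT b1 a2) => // x _ /=.
by case: (h x) => u v /=; rewrite -EFinD addrC mulrC [v * _]mulrC addrC.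
Qed.

Lemma eq_cintegral h k : (forall x, h x = k x) -> cintegral mu h = cintegral mu k.
Proof. by move=> hk; congr (cintegral _ _); apply/funext. Qed.

Lemma ae_eq_cintegral h k : cmeasurable h -> cmeasurable k ->
  (\forall x \ae mu, h x = k x) -> cintegral mu h = cintegral mu k.
Proof.
move=> [h1 h2] [k1 k2] hk; rewrite /cintegral /Rintegral; congr (fine _ +i* fine _)%C;
  apply: ae_eq_integral => //; try exact/measurable_EFinP;
  by apply: filterS hk => x -> .
Qed.

End complex_functions.

Section parametric.
Context d1 d2 (X : measurableType d1) (Y : measurableType d2) (R : realType).
Variable m : {sigma_finite_measure set Y -> \bar R}.

(** The integral is the difference of those of the positive and negative parts, and each of these is
    measurable by Tonelli, whether or not the sections are integrable. *)
Lemma measurable_parametric_integral (G : X * Y -> \bar R) : measurable_fun setT G ->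
  measurable_fun setT (fun x => \int[m]_y G (x, y))%E.
Proof.
move=> mG; under eq_fun do rewrite integralE.
apply: emeasurable_funB.
  have := measurable_fun_fubini_tonelli_F (m2 := m) _ (measurable_funepos mG) (funepos_ge0 _).
  by apply: eq_measurable_fun => x _; apply: eq_integral => y _; rewrite !funeposE.
have := measurable_fun_fubini_tonelli_F (m2 := m) _ (measurable_funeneg mG) (funeneg_ge0 _).
by apply: eq_measurable_fun => x _; apply: eq_integral => y _; rewrite !funenegE.
Qed.

Lemma measurable_parametric_Rintegral (G : X * Y -> R) : measurable_fun setT G ->
  measurable_fun setT (fun x => \int[m]_y G (x, y)).
Proof.
move=> mG; apply: (@measurableT_comp _ _ _ _ _ _ fine) => //.
by apply: (@measurable_parametric_integral (EFin \o G)); exact/measurable_EFinP.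
Qed.

Lemma cmeasurable_parametric_cintegral (G : X * Y -> R[i]) : cmeasurable G ->
  cmeasurable (fun x => cintegral m (fun y => G (x, y))).
Proof.
move=> [G1 G2]; split.
  exact: (measurable_parametric_Rintegral G1).
exact: (measurable_parametric_Rintegral G2).
Qed.

Lemma cmeasurable_comp d3 (Z : measurableType d3) (h : X -> R[i]) (f : Z -> X) :
  cmeasurable h -> measurable_fun setT f -> cmeasurable (fun z => h (f z)).
Proof.
by move=> [h1 h2] mf; split; [exact: (measurableT_comp h1 mf)|exact: (measurableT_comp h2 mf)].
Qed.

End parametric.

Section Rintegral_fubini.
Context d1 d2 (X : measurableType d1) (Y : measurableType d2) (R : realType).
Variable m1 : {sigma_finite_measure set X -> \bar R}.
Variable m2 : {sigma_finite_measure set Y -> \bar R}.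
Variable g : X * Y -> R.
Hypothesis gi : (m1 \x m2)%E.-integrable setT (EFin \o g).

Let Fi := integrable_fubini_F gi.

Let mR : measurable_fun setT (fun x => \int[m2]_y g (x, y)).
Proof. exact: (@measurable_parametric_Rintegral _ _ X Y R m2 g (integrable_measurable_fun gi)). Qed.

(** Where the inner integral is infinite, [Rintegral] is 0, which only lowers the absolute value of
    the function of Fubini's theorem. *)
Lemma integrable_Rintegral_section : m1.-integrable setT (EFin \o (fun x => \int[m2]_y g (x, y))).
Proof.
apply: (le_integrable _ _ _ Fi) => //; first exact/measurable_EFinP.
move=> x _ /=; rewrite /Rintegral /fubini_F /=.
by case: (\int[_]_(_ in _) _)%E => [r||] /=; rewrite ?normr0 ?leey.
Qed.

Lemma Rintegral_fubini : \int[(m1 \x m2)%E]_z g z = \int[m1]_x \int[m2]_y g (x, y).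
Proof.
rewrite {1}/Rintegral -(integral12_prod_meas1 gi); congr fine.
apply: ae_eq_integral => //; first exact: measurable_int Fi.
  exact/measurable_EFinP.
have := integrable_ae measurableT Fi; apply: filterS => x Fx _.
by rewrite /Rintegral fineK//; exact: Fx.
Qed.

End Rintegral_fubini.

(** Allows to halve the identity obtained by adding the values at x and -x, infinite integrals
    included. *)
Lemma double_inje (R : realType) (x y : \bar R) : (x + x = y *+ 2)%E -> x = y.
Proof.
have half (z : \bar R) : (z = (2^-1)%:E * (z *+ 2))%E.
  by rewrite -mule_natl muleA -EFinM mulVf// mul1e.
by rewrite -mule2n => xy; rewrite [LHS]half xy -half.
Qed.

Section complex_plancherel.
Variable R : realType.
Local Notation T := (measurableTypeR R).
Local Notation leb := (@lebesgue_measure R).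
Local Notation leb2 := (@lebesgue2 R).
Local Notation Re := (@complex.Re R).
Local Notation Im := (@complex.Im R).

Definition fourier (h : T -> R[i]) (x : R) : R[i] :=
  cintegral leb (fun w => expi (- (2 * pi * (x * w))) * h w).

Lemma fourierE h x : cintegrable leb h ->
  fourier h x = ((cosT (Re \o h) x + sinT (Im \o h) x) +i*
                 (cosT (Im \o h) x - sinT (Re \o h) x))%C.
Proof.
move=> [h1 h2].
have [c1 c2] := (integrable_cosT x h1, integrable_cosT x h2).
have [s1 s2] := (integrable_sinT x h1, integrable_sinT x h2).
rewrite /fourier /cintegral /cosT /sinT -RintegralD// -RintegralB//.
congr (_ +i* _)%C; apply: eq_Rintegral => w _ /=;
  case: (h w) => a b /=; rewrite cosN sinN; move: (cos _) (sin _) => c s; ring.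
Qed.

(** The cross terms between the real and the imaginary part of h are odd in x and cancel. Complex
    Plancherel thus reduces to the real one for the two parts separately. *)
Lemma csq_fourier h x : cintegrable leb h ->
  csq (fourier h x) + csq (fourier h (- x)) =
  2 * (specT (Re \o h) x + specT (Im \o h) x).
Proof.
move=> hi; rewrite !fourierE// /csq /=.
have cN (f : T -> R) : cosT f (- x) = cosT f x.
  by apply: eq_Rintegral => w _; rewrite mulNr mulrN cosN.
have sN (f : T -> R) : leb.-integrable setT (EFin \o f) -> sinT f (- x) = - sinT f x.
  move=> fi; rewrite /sinT -[RHS]mulN1r -RintegralZl//; last exact: integrable_sinT.
  by apply: eq_Rintegral => w _; rewrite mulNr mulrN sinN mulN1r mulrN.
case: hi => h1 h2; rewrite !cN !sN// /specT.
by move: (cosT _ _) (cosT _ _) (sinT _ _) (sinT _ _) => a b c e; ring.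
Qed.

Lemma measurable_fourier h : cintegrable leb h -> cmeasurable (fourier h : T -> R[i]).
Proof.
move=> hi; pose G (z : T * T) : R[i] := expi (- (2 * pi * (z.1 * z.2))) * h z.2.
apply: (@cmeasurable_parametric_cintegral _ _ _ _ _ leb G).
apply: cmeasurableM.
  apply: cmeasurable_expi; apply: measurableT_comp => //; apply: measurable_funM => //.
  exact: measurable_funM.
by apply: (cmeasurable_comp (cintegrable_cmeasurable hi)).
Qed.

Lemma plancherel h : cintegrable leb h ->
  (\int[leb]_x (csq (fourier h x))%:E = \int[leb]_w (csq (h w))%:E)%E.
Proof.
move=> hi; have mF := measurable_csq (measurable_fourier hi).
have mF' : measurable_fun setT (fun x : T => (csq (fourier h x))%:E) by exact/measurable_EFinP.
have mFN : measurable_fun setT (fun x : T => (csq (fourier h (- x)))%:E).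
  by apply: (measurableT_comp mF'); exact: oppr_measurable.
have F0 x : (0 <= (csq (fourier h x))%:E)%E by rewrite lee_fin csq_ge0.
have FN : (\int[leb]_x (csq (fourier h (- x)))%:E = \int[leb]_x (csq (fourier h x))%:E)%E.
  exact: (ge0_integral_oppr mF').
have [h1 h2] := hi.
pose S (x : T) : R := specT (Re \o h) x + specT (Im \o h) x.
have S0 x : (0 <= (S x)%:E)%E by rewrite lee_fin addr_ge0 ?specT_ge0.
have mS : measurable_fun setT (fun x : T => (S x)%:E).
  by apply/measurable_EFinP/measurable_funD; exact: measurable_specT.
have SE : (\int[leb]_x (S x)%:E = \int[leb]_w (csq (h w))%:E)%E.
  under eq_integral do rewrite EFinD.
  rewrite ge0_integralD; [|by []|by move=> x _; rewrite lee_fin specT_ge0|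
    by apply/measurable_EFinP; exact: measurable_specT|by move=> x _; rewrite lee_fin specT_ge0|
    by apply/measurable_EFinP; exact: measurable_specT].
  rewrite (plancherel_real h1) (plancherel_real h2) -ge0_integralD; [|by []|by move=> x _; rewrite lee_fin sqr_ge0|
    |by move=> x _; rewrite lee_fin sqr_ge0|].
  - by apply: eq_integral => w _; rewrite -EFinD.
  - by apply/measurable_EFinP; apply: measurable_funX; exact: (integrable_measurable_fun h1).
  - by apply/measurable_EFinP; apply: measurable_funX; exact: (integrable_measurable_fun h2).
have dbl : (\int[leb]_x (csq (fourier h x))%:E + \int[leb]_x (csq (fourier h x))%:E =
    2%:E * \int[leb]_x (S x)%:E)%E.
  rewrite -[X in (_ + X)%E]FN -ge0_integralD; [|by []|by move=> x _; exact: F0|exact: mF'|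
    by move=> x _; exact: F0|exact: mFN].
  rewrite -ge0_integralZl_EFin; [|by []|by move=> x _; exact: S0|exact: mS|by []].
  by apply: eq_integral => x _; rewrite -EFinD csq_fourier// EFinM.
rewrite -SE; apply: double_inje; rewrite dbl; exact: mule_natl.
Qed.

Definition fourier2 (h : T * T -> R[i]) (x : T * T) : R[i] :=
  cintegral leb2 (fun p => expi (- (2 * pi * (p.1 * x.1 + p.2 * x.2))) * h p).

Lemma expiD (s t : R) : expi (s + t) = expi s * expi t.
Proof. by rewrite /expi cosD sinD; apply/eqP; rewrite eq_complex /=; apply/andP; split; apply/eqP; ring. Qed.

Lemma ae_cintegrable_section (h : T * T -> R[i]) : cintegrable leb2 h ->
  {ae leb, forall x, cintegrable leb (fun y => h (x, y))}.
Proof.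
move=> [h1 h2]; apply: filterS2 (ae_integrable1 h1) (ae_integrable1 h2) => x i1 i2.
by split; [exact: i1|exact: i2].
Qed.

Lemma cintegral_fubini (h : T * T -> R[i]) : cintegrable leb2 h ->
  cintegral leb2 h = cintegral leb (fun x => cintegral leb (fun y => h (x, y))).
Proof.
by move=> [h1 h2]; congr (_ +i* _)%C; [exact: (Rintegral_fubini h1)|exact: (Rintegral_fubini h2)].
Qed.

Lemma cintegrable_section (h : T * T -> R[i]) : cintegrable leb2 h ->
  cintegrable leb (fun x => cintegral leb (fun y => h (x, y))).
Proof.
by move=> [h1 h2]; split;
  [exact: (integrable_Rintegral_section h1)|exact: (integrable_Rintegral_section h2)].
Qed.

Lemma cintegralZl d (X : measurableType d) (mu : {measure set X -> \bar R}) (c : R[i])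
  (h : X -> R[i]) : cintegrable mu h -> cintegral mu (fun x => c * h x) = c * cintegral mu h.
Proof.
case: c => a b [h1 h2]; rewrite /cintegral /=.
have Z (r : R) (k : X -> R) : mu.-integrable setT (EFin \o k) ->
    mu.-integrable setT (EFin \o (fun x => r * k x)).
  by move=> ki; exact: (integrableZl measurableT r ki).
have e1 : \int[mu]_x complex.Re ((a +i* b)%C * h x) =
    \int[mu]_x (a * Re (h x) - b * Im (h x)).
  by apply: eq_Rintegral => x _; case: (h x).
have e2 : \int[mu]_x complex.Im ((a +i* b)%C * h x) =
    \int[mu]_x (a * Im (h x) + b * Re (h x)).
  by apply: eq_Rintegral => x _; case: (h x).
rewrite e1 e2 RintegralB//; [|exact: (Z _ _ h1)|exact: (Z _ _ h2)].
rewrite RintegralD//; [|exact: (Z _ _ h2)|exact: (Z _ _ h1)].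
by rewrite !RintegralZl.
Qed.

(** Plancherel in one variable at a time, through the transform [P] in the second variable alone.
    For every x2, [P] is integrable in the first variable by Fubini and its transform is [fourier2];
    for almost every p1, the section of h at p1 is integrable and [P] is its transform. *)
Lemma plancherel2 h : cintegrable leb2 h ->
  (\int[leb2]_x (csq (fourier2 h x))%:E = \int[leb2]_w (csq (h w))%:E)%E.
Proof.
move=> hi; have mh := cintegrable_cmeasurable hi.
pose P (z : T * T) : R[i] := fourier (fun p2 => h (z.1, p2)) z.2.
have mP : cmeasurable P.
  pose G (z : (T * T) * T) : R[i] := expi (- (2 * pi * (z.1.2 * z.2))) * h (z.1.1, z.2).
  apply: (@cmeasurable_parametric_cintegral _ _ _ _ _ leb G).
  apply: cmeasurableM.
    apply: cmeasurable_expi; apply: measurableT_comp => //; apply: measurable_funM => //.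
    by apply: measurable_funM => //; exact: (measurableT_comp measurable_snd measurable_fst).
  apply: (cmeasurable_comp mh); apply: measurable_fun_pair => //.
  exact: (measurableT_comp measurable_fst measurable_fst).
pose H (x2 : R) (p : T * T) : R[i] := expi (- (2 * pi * (p.2 * x2))) * h p.
have Hi x2 : cintegrable leb2 (H x2).
  apply: cintegrable_expi => //; apply: measurableT_comp => //; apply: measurable_funM => //.
  exact: measurable_funM.
have PH p1 x2 : P (p1, x2) = cintegral leb (fun p2 => H x2 (p1, p2)).
  by apply: eq_cintegral => p2; rewrite /H/= (mulrC x2).
have Pi x2 : cintegrable leb (fun p1 => P (p1, x2)).
  rewrite (_ : (fun p1 => _) = (fun p1 => cintegral leb (fun p2 => H x2 (p1, p2)))).
    exact: cintegrable_section.
  by apply/funext => p1; exact: PH.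
have F2 x1 x2 : {ae leb, forall p1, cintegrable leb (fun y => h (p1, y))} ->
    fourier2 h (x1, x2) = fourier (fun p1 => P (p1, x2)) x1.
  move=> hs; pose K (p : T * T) : R[i] := expi (- (2 * pi * (p.1 * x1))) * H x2 p.
  have Ki : cintegrable leb2 K.
    apply: cintegrable_expi => //; apply: measurableT_comp => //; apply: measurable_funM => //.
    exact: measurable_funM.
  transitivity (cintegral leb2 K).
    apply: eq_cintegral => p; rewrite /K /H mulrA -expiD/=; congr (expi _ * _).
    by rewrite (mulrDr (2 * pi)) opprD.
  rewrite (cintegral_fubini Ki); apply: ae_eq_cintegral.
  - exact: cintegrable_cmeasurable (cintegrable_section Ki).
  - apply: cintegrable_cmeasurable; apply: cintegrable_expi => //.
    apply: measurableT_comp => //; apply: measurable_funM => //; exact: measurable_funM.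
  - apply: filterS hs => p1 hp1; rewrite PH -cintegralZl.
      by apply: eq_cintegral => p2; rewrite /K/= (mulrC p1).
    apply: cintegrable_expi => //; apply: measurableT_comp => //; apply: measurable_funM => //.
    by apply: (@measurable_funM _ _ _ _ (fun x : T => x)).
have hs := ae_cintegrable_section hi.
have mF2 : cmeasurable (fourier2 h).
  pose G (z : (T * T) * (T * T)) : R[i] :=
    expi (- (2 * pi * (z.2.1 * z.1.1 + z.2.2 * z.1.2))) * h z.2.
  apply: (@cmeasurable_parametric_cintegral _ _ _ _ _ leb2 G).
  apply: cmeasurableM; last exact: (cmeasurable_comp mh).
  apply: cmeasurable_expi; apply: measurableT_comp => //; apply: measurable_funM => //.
  by apply: measurable_funD; apply: measurable_funM;
    [exact: (measurableT_comp measurable_fst measurable_snd)|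
     exact: (measurableT_comp measurable_fst measurable_fst)|
     exact: (measurableT_comp measurable_snd measurable_snd)|
     exact: (measurableT_comp measurable_snd measurable_fst)].
have mcP : measurable_fun setT (fun z => (csq (P z))%:E).
  by apply/measurable_EFinP; exact: measurable_csq.
rewrite lebesgue2_tonelli2; last 2 first.
- by apply/measurable_EFinP; exact: measurable_csq.
- by move=> z; rewrite lee_fin csq_ge0.
transitivity (\int[leb]_x2 \int[leb]_p1 (csq (P (p1, x2)))%:E)%E.
  apply: eq_integral => x2 _; rewrite -(plancherel (Pi x2)).
  by apply: eq_integral => x1 _; rewrite F2.
rewrite -(lebesgue2_tonelli2 mcP); last by move=> z; rewrite lee_fin csq_ge0.
rewrite (lebesgue2_tonelli mcP); last by move=> z; rewrite lee_fin csq_ge0.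
have mch : measurable_fun setT (fun z => (csq (h z))%:E).
  by apply/measurable_EFinP; exact: measurable_csq.
rewrite (lebesgue2_tonelli mch); last by move=> z; rewrite lee_fin csq_ge0.
apply: ae_eq_integral.
- exact: measurableT.
- exact: (measurable_parametric_integral leb mcP).
- exact: (measurable_parametric_integral leb mch).
- by apply: filterS hs => p1 hp1 _; exact: (plancherel hp1).
Qed.

End complex_plancherel.

(** The sum of the series has finite integral, hence is finite almost everywhere. This turns rapid
    convergence in mean into convergence almost everywhere. *)
Lemma ae_bounded_series d (X : measurableType d) (R : realType) (mu : {measure set X -> \bar R})
    (h : nat -> X -> R) (C : R) :
  (forall n, measurable_fun setT (h n)) -> (forall n x, 0 <= h n x) ->
  (forall n, (\int[mu]_x (h n x)%:E <= (C * 2^-1 ^+ n)%:E)%E) ->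
  {ae mu, forall x, exists M : R, forall n, \sum_(k < n) h k x <= M}.
Proof.
move=> mh h0 hC.
have mh' n : measurable_fun setT (fun x => (h n x)%:E) by exact/measurable_EFinP.
pose S (x : X) := (\sum_(0 <= n <oo) (h n x)%:E)%E.
have mS : measurable_fun setT S by apply: ge0_emeasurable_sum => // n x _ _; rewrite lee_fin.
have S0 x : (0 <= S x)%E by apply: nneseries_ge0 => n _ _; rewrite lee_fin.
have C0 : 0 <= C.
  have : (0 <= (C * 2^-1 ^+ 0)%:E)%E.
    by apply: le_trans (hC 0%N); apply: integral_ge0 => x _; rewrite lee_fin.
  by rewrite expr0 mulr1 lee_fin.
have half1 : `|2^-1| < 1 :> R by rewrite ger0_norm// invf_lt1// ltr1n.
have Soo : (\int[mu]_x S x < +oo)%E.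
  rewrite integral_nneseries//; last by move=> n x _; rewrite lee_fin.
  apply: (@le_lt_trans _ _ (C / (1 - 2^-1))%:E); last exact: ltry.
  apply: lime_le.
    by apply: is_cvg_nneseries => n _ _; apply: integral_ge0 => x _; rewrite lee_fin.
  apply: nearW => n; apply: (@le_trans _ _ (\sum_(0 <= k < n) (C * 2^-1 ^+ k)%:E)%E).
    by apply: lee_sum => k _; exact: hC.
  rewrite sumEFin lee_fin.
  by apply: (geometric_le_lim n C0 _ half1); rewrite invr_gt0.
have Si : mu.-integrable setT S.
  by apply/integrableP; split => //; under eq_integral do rewrite gee0_abs//.
apply: filterS (integrable_ae measurableT Si) => x /(_ Logic.I) Sx.
exists (fine (S x)) => n.
rewrite -lee_fin fineK// -sumEFin -(big_mkord xpredT (fun k => (h k x)%:E)).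
by apply: nneseries_lim_ge => k _ _; rewrite lee_fin.
Qed.

Lemma bounded_series_cvg0 (R : realType) (a : nat -> R) (M : R) : (forall n, 0 <= a n) ->
  (forall n, \sum_(k < n) a k <= M) -> a n @[n --> \oo] --> 0.
Proof.
move=> a0 aM; apply: cvg_series_cvg_0.
apply: nondecreasing_is_cvgn.
  by apply/nondecreasing_seqP => n; rewrite /series/= big_nat_recr//= lerDl.
by exists M => _ [n _ <-]; rewrite /series/= big_mkord.
Qed.

Lemma measurable_set_lt d (X : measurableType d) (R : realType) (g h : X -> R) :
  measurable_fun setT g -> measurable_fun setT h -> measurable [set x | g x < h x].
Proof.
move=> mg mh.
rewrite (_ : [set _ | _] = (fun x => h x - g x) @^-1` `]0, +oo[%classic).
  by rewrite -[X in measurable X]setTI; apply: (measurable_funB mh mg).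
by apply/seteqP; split => x /=; rewrite in_itv/= andbT subr_gt0.
Qed.

(** * Criteria for strong measurability *)

Section strong_measurability.
Context d (X : measurableType d) (R : realType) (V : lmodType R[i]).
Variable dot : {dot V for @conjc R}.
Implicit Types f g : X -> V.

(** A form of Pettis's criterion. The approximation [s n x] is a point of v 0, ..., v n nearest to f
    x, the earliest one in case of a tie; its level sets are measurable because they are described
    by comparisons of measurable distances. *)
Lemma strongly_measurable_dense f (v : nat -> V) :
  (forall j, measurable_fun setT (fun x => dnorm dot (f x - v j))) ->
  (forall x (e : R), 0 < e -> exists j, dnorm dot (f x - v j) < e) ->
  strongly_measurable dot f.
Proof.
move=> mf df.
pose s := fix s n x := if n is n'.+1 then
  (if dnorm dot (f x - v n) < dnorm dot (f x - s n' x) then v n else s n' x) else v 0%N.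
have ms n : measurable_fun setT (fun x => dnorm dot (f x - s n x)) /\
    forall w, measurable (s n @^-1` [set w]).
  elim: n => [|n [IH1 IH2]].
    split; first exact: mf.
    by move=> w; rewrite (_ : s 0%N = cst (v 0%N))// preimage_cst; case: ifP.
  have mlt : measurable [set x | dnorm dot (f x - v n.+1) < dnorm dot (f x - s n x)].
    exact: measurable_set_lt.
  split.
    rewrite (_ : (fun x => _) = (fun x => Num.min (dnorm dot (f x - v n.+1)) (dnorm dot (f x - s n x)))).
      exact: measurable_minr.
    by apply/funext => x /=; rewrite /Num.min; case: ifP.
  move=> w.
  rewrite (_ : _ @^-1` _ = ([set x | dnorm dot (f x - v n.+1) < dnorm dot (f x - s n x)] `&` [set x | v n.+1 = w]) `|`
     (~` [set x | dnorm dot (f x - v n.+1) < dnorm dot (f x - s n x)] `&` s n @^-1` [set w])).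
    apply: measurableU; apply: measurableI => //; last exact: measurableC.
    have [vw|vw] := pselect (v n.+1 = w).
      by rewrite (_ : [set _ | _] = setT)//; apply/seteqP; split.
    by rewrite (_ : [set _ | _] = set0)//; apply/seteqP; split.
  apply/seteqP; split => x /=.
    by case: ifPn => h e; [left|right; split => //; exact/negP].
  by move=> [[-> //]|[/negP/negbTE ->]].
have sfin n : finite_set (range (s n)).
  apply: (@sub_finite_set _ _ (v @` `I_n.+1)); last exact/finite_image/finite_II.
  move=> _ [x _ <-]; elim: n => [|n [j jn jE]] /=; first by exists 0%N.
  case: ifP => _; first by exists n.+1 => //=.
  by exists j => //=; exact: ltnW.
pose s' n : {fimfun X >-> V} := HB.pack (s n) (FiniteImage.Build X V (s n) (sfin n)).
exists s'; split => [n w|x]; first exact: (ms n).2.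
have sle n j : (j <= n)%N -> dnorm dot (f x - s n x) <= dnorm dot (f x - v j).
  elim: n j => [|n IH] j /=; first by rewrite leqn0 => /eqP ->.
  rewrite leq_eqVlt => /predU1P[->|]; first by case: ltP.
  rewrite ltnS => /IH; case: ltP => // h1 h2; exact: le_trans (ltW h1) h2.
apply/cvgrPdist_lt => e e0; have [j je] := df x e e0.
exists j => // n /= jn; rewrite sub0r normrN ger0_norm ?dnorm_ge0//.
by apply: le_lt_trans je; exact: sle.
Qed.

(** [dnorm] is a squared norm, for which the triangle inequality costs a factor 2; hence the
    quarters. *)
Lemma dnorm_triangle_lt u v w (e : R) :
  dnorm dot (u - v) < e / 4 -> dnorm dot (v - w) < e / 4 -> dnorm dot (u - w) < e.
Proof.
move=> uv vw; have -> : u - w = (u - v) + (v - w) by rewrite addrA subrK.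
by apply: le_lt_trans (dnormD_le dot _ _) _; lra.
Qed.

Lemma simple_strongly_measurable (s : {fimfun X >-> V}) :
  (forall v, measurable (s @^-1` [set v])) -> strongly_measurable dot s.
Proof.
move=> ms; exists (fun=> s); split => // x.
by under eq_fun do rewrite subrr dnorm0; exact: cvg_cst.
Qed.

Lemma strongly_measurable_cst (v : V) : strongly_measurable dot (fun _ : X => v).
Proof.
apply: (@simple_strongly_measurable [the {fimfun X >-> V} of cst v]) => w /=.
by rewrite preimage_cst; case: ifP.
Qed.

Lemma measurable_dnormB f (v : V) : strongly_measurable dot f ->
  measurable_fun setT (fun x => dnorm dot (f x - v)).
Proof.
move=> mf; apply: (measurable_dnorm (strongly_measurableD mf (strongly_measurable_cst (- v)))).
Qed.

(** The values of simple approximations of all the [u n] form a countable family that comes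
    arbitrarily close to each f x with x in A; adding 0 takes care of the complement of A. *)
Lemma strongly_measurable_limit (u : nat -> X -> V) f (A : set X) :
  (forall n, strongly_measurable dot (u n)) -> measurable A ->
  (forall x, A x -> dnorm dot (f x - u n x) @[n --> \oo] --> 0) ->
  (forall x, ~ A x -> f x = 0) ->
  strongly_measurable dot f.
Proof.
move=> mu mA uf f0.
have /choice[s hs] n : exists s : nat -> {fimfun X >-> V},
  (forall k v, measurable (s k @^-1` [set v])) /\
  (forall x, dnorm dot (u n x - s k x) @[k --> \oo] --> 0) by exact: mu.
have /choice[S hS] (nk : nat * nat) : exists S : seq V, range (s nk.1 nk.2) = [set` S].
  exact/finite_seqP.
pose v (j : nat) : V := if unpickle j is Some (nk, i) then nth 0 (S nk) i else 0.
have sv n k x : exists j, v j = s n k x.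
  have : [set` S (n, k)] (s n k x) by rewrite -hS; exists x.
  move=> /= /(nthP 0)[i _ ie]; exists (pickle ((n, k), i)).
  by rewrite /v pickleK.
apply: (@strongly_measurable_dense f v).
- move=> j; pose g n x := if x \in A then dnorm dot (u n x - v j) else dnorm dot (0 - v j).
  apply: (@measurable_fun_cvg _ _ _ _ g).
    move=> n; apply: measurable_fun_ifT => //.
      apply: (measurable_fun_bool true); rewrite setTI (_ : _ @^-1` _ = A)//.
      by apply/seteqP; split => x /=; [move=> /set_mem|move=> /mem_set].
    exact: measurable_dnormB.
  move=> x _; rewrite /g; have [xA|xA] := boolP (x \in A).
    have Ax : A x by exact: set_mem.
    apply: (@cvg_dnorm _ _ dot (fun n => u n x - v j) (f x - v j)).
    under eq_fun do rewrite opprB addrA subrK.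
    exact: uf.
  rewrite f0; first exact: cvg_cst.
  by move=> Ax; move/negP : xA; apply; exact: mem_set.
- move=> x e e0; have e4 : 0 < e / 4 by rewrite divr_gt0.
  have [Ax|Ax] := pselect (A x); last first.
    (* An index just past the end of the list, where [nth] returns its default value 0. *)
    exists (pickle ((0%N, 0%N), size (S (0%N, 0%N)))).
    by rewrite /v pickleK nth_default// f0// subrr dnorm0.
  have /cvgrPdist_lt/(_ _ e4) [n _ /(_ n (leqnn _))] := uf x Ax.
  rewrite sub0r normrN ger0_norm ?dnorm_ge0// => fu.
  have /cvgrPdist_lt/(_ _ e4) [k _ /(_ k (leqnn _))] := (hs n).2 x.
  rewrite sub0r normrN ger0_norm ?dnorm_ge0// => us.
  have [j jE] := sv n k x; exists j; rewrite jE.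
  exact: dnorm_triangle_lt fu us.
Qed.

End strong_measurability.

Section complex_strong.
Context d (X : measurableType d) (R : realType).
Implicit Types f : X -> R[i]^o.
Local Notation Re := (@complex.Re R).
Local Notation Im := (@complex.Im R).

Lemma cmeasurable_strongly_measurable f :
  cmeasurable (f : X -> R[i]) -> strongly_measurable (@complex_dot R) f.
Proof.
move=> [mf1 mf2].
(* An enumeration of the Gaussian rationals, which are dense. *)
pose v (j : nat) : R[i]^o :=
  if unpickle j is Some ab then (ratr (ab.1 : rat) +i* ratr (ab.2 : rat))%C else 0.
apply: (@strongly_measurable_dense _ _ _ _ _ f v).
- move=> j; under eq_fun do rewrite dnorm_complex.
  rewrite /csq; apply: measurable_funD; apply: measurable_funX.
    rewrite (_ : (fun x => _) = (fun x => Re (f x) - Re (v j))).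
      exact: measurable_funB.
    by apply/funext => x; rewrite raddfB.
  rewrite (_ : (fun x => _) = (fun x => Im (f x) - Im (v j))).
    exact: measurable_funB.
  by apply/funext => x; rewrite raddfB.
- move=> x e e0.
  have e2 : 0 < Num.sqrt (e / 2) by rewrite sqrtr_gt0 divr_gt0.
  have approx (r : R) : exists q : rat, (r - ratr q) ^+ 2 < e / 2.
    have : r - Num.sqrt (e / 2) < r + Num.sqrt (e / 2) by lra.
    move=> /rat_in_itvoo[q]; rewrite in_itv/= => /andP[q1 q2]; exists q.
    rewrite -real_normK ?num_real// -[ltRHS]sqr_sqrtr ?divr_ge0 ?(ltW e0)//.
    by rewrite ltr_pXn2r// ?nnegrE ?sqrtr_ge0// ltr_norml; apply/andP; split; lra.
  have [[q1 h1] [q2 h2]] := (approx (Re (f x)), approx (Im (f x))).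
  exists (pickle (q1, q2)); rewrite /v pickleK dnorm_complex /csq.
  by move: h1 h2; case: (f x) => a b /=; lra.
Qed.

Lemma strongly_measurable_cmeasurable f :
  strongly_measurable (@complex_dot R) f -> cmeasurable (f : X -> R[i]).
Proof.
move=> [s [ms sf]].
have le (z : R[i]) : Re z ^+ 2 <= csq z /\ Im z ^+ 2 <= csq z.
  by rewrite /csq lerDl lerDr !sqr_ge0.
have sq0 (u : nat -> R) : (fun n => u n ^+ 2) @ \oo --> 0 -> u @ \oo --> 0.
  move=> u2; apply: norm_cvg0.
  have : Num.sqrt (u n ^+ 2) @[n --> \oo] --> Num.sqrt 0.
    by apply: continuous_cvg => //; exact: sqrt_continuous.
  by rewrite sqrtr0; under eq_fun do rewrite sqrtr_sqr.
have cvp (p : R[i] -> R) : (forall a b, p (a - b) = p a - p b) -> (forall z, p z ^+ 2 <= csq z) ->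
    forall x, p (s n x) @[n --> \oo] --> p (f x).
  move=> pB pc x; apply/subr_cvg0; apply: sq0.
  apply: (@squeeze_cvgr _ _ _ _ (cst 0) (fun n => dnorm (@complex_dot R) (f x - s n x))) => //.
  - apply: nearW => n; rewrite sqr_ge0/= dnorm_complex.
    by apply: le_trans (pc _); rewrite pB -[leRHS]sqrrN opprB.
  - exact: cvg_cst.
have mp (p : R[i] -> R) : (forall a b, p (a - b) = p a - p b) -> (forall z, p z ^+ 2 <= csq z) ->
    measurable_fun setT (fun x => p (f x)).
  move=> pB pc; apply: (@measurable_fun_cvg _ _ _ _ (fun n x => p (s n x))).
  - by move=> n _ B mB; rewrite setTI; exact: (@simple_measurable _ _ _ _ (s n) (p @^-1` B)).
  - by move=> x _; exact: cvp.
split; apply: mp => [a b|z]; rewrite ?raddfB//.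
  exact: (le z).1.
exact: (le z).2.
Qed.

End complex_strong.

(** * Completeness of L^2 spaces and orthogonal projections *)

Section fast_completeness.
Variable R : realType.

(* Convergence of rapidly Cauchy sequences only, which is enough for the projection theorem
   and passes from V to L^2(X; V) with a smaller ratio r. *)
Definition fast_complete (V : lmodType R[i]) (dot : {dot V for @conjc R}) (r : R) :=
  forall (u : nat -> V) (C : R), (forall k, dnorm dot (u k.+1 - u k) <= C * r ^+ k) ->
  exists v, dnorm dot (v - u n) @[n --> \oo] --> 0.

(** The constant 4 is stable under the induction: 2 (4 C r^(m+1)) + 2 C r^m <= 4 C r^m exactly
    because r <= 1/4. *)
Lemma fast_cauchy (V : lmodType R[i]) (dot : {dot V for @conjc R}) (r C : R) (u : nat -> V) :
  0 <= r <= 4^-1 -> (forall k, dnorm dot (u k.+1 - u k) <= C * r ^+ k) ->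
  forall m n, dnorm dot (u (m + n)%N - u m) <= 4 * C * r ^+ m.
Proof.
move=> /andP[r0 r4] uC m n.
have C0 : 0 <= C by have := uC 0%N; rewrite expr0 mulr1; exact: le_trans (dnorm_ge0 _ _).
elim: n m => [|n IH] m; first by rewrite addn0 subrr dnorm0 !mulr_ge0// exprn_ge0.
rewrite addnS -addSn.
have -> : u (m.+1 + n)%N - u m = (u (m.+1 + n)%N - u m.+1) + (u m.+1 - u m) by rewrite addrA subrK.
apply: le_trans (dnormD_le _ _ _) _.
have := IH m.+1; have := uC m; rewrite exprS.
have : r * (C * r ^+ m) <= 4^-1 * (C * r ^+ m) by rewrite ler_wpM2r// mulr_ge0// exprn_ge0.
have : 0 <= C * r ^+ m by rewrite mulr_ge0// exprn_ge0.
rewrite -!mulrA [C * (r * _)]mulrCA; set D := C * r ^+ m; lra.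
Qed.

(** The increments of the real and imaginary parts are bounded by sqrt(C) sqrt(r)^n, so their
    telescoping series converge absolutely. *)
Lemma complex_fast_complete (r : R) : 0 <= r < 1 -> fast_complete (@complex_dot R) r.
Proof.
move=> /andP[r0 r1] u C uC.
have C0 : 0 <= C by have := uC 0%N; rewrite expr0 mulr1; exact: le_trans (dnorm_ge0 _ _).
have sr : `|Num.sqrt r| < 1.
  by rewrite ger0_norm ?sqrtr_ge0// -[ltRHS]sqrtr1 ltr_sqrt.
have cv (p : R[i] -> R) : (forall a b, p (a - b) = p a - p b) -> (forall z, p z ^+ 2 <= csq z) ->
    exists l : R, (fun n => p (u n)) @ \oo --> l.
  move=> pB pc; apply/cvg_ex.
  rewrite (_ : (fun n => _) = (fun n => p (u 0%N) + series (telescope (fun n => p (u n))) n)); last first.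
    by apply/funext => n; rewrite -eq_sum_telescope.
  apply: is_cvgD; first exact: is_cvg_cst.
  apply: normed_cvg.
  apply: (@series_le_cvg _ _ (geometric (Num.sqrt C) (Num.sqrt r))).
  - by move=> n; exact: normr_ge0.
  - by move=> n; rewrite /geometric/= mulr_ge0 ?exprn_ge0 ?sqrtr_ge0.
  - move=> n; rewrite /geometric/=.
    have -> : telescope (fun n => p (u n)) n = p (u n.+1 - u n) by rewrite pB.
    have -> : Num.sqrt r ^+ n = Num.sqrt (r ^+ n).
      by rewrite -{2}(sqr_sqrtr r0) -exprM mulnC exprM sqrtr_sqr ger0_norm ?exprn_ge0 ?sqrtr_ge0.
    rewrite -sqrtr_sqr -sqrtrM// ler_sqrt ?mulr_ge0 ?exprn_ge0//.
    by apply: le_trans (pc _) _; rewrite -dnorm_complex; exact: uC.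
  - exact: is_cvg_geometric_series.
have [a ua] : exists l : R, (fun n => complex.Re (u n)) @ \oo --> l.
  apply: cv => [? ?|z]; first by rewrite raddfB.
  by rewrite /csq lerDl sqr_ge0.
have [b ub] : exists l : R, (fun n => complex.Im (u n)) @ \oo --> l.
  apply: cv => [? ?|z]; first by rewrite raddfB.
  by rewrite /csq lerDr sqr_ge0.
exists (a +i* b)%C; under eq_fun do rewrite dnorm_complex /csq !raddfB/=.
have sub0 (l : R) (s : nat -> R) : s @ \oo --> l -> (fun n => (l - s n) ^+ 2) @ \oo --> 0.
  move=> sl; rewrite [X in _ --> X](_ : 0 = (l - l) ^+ 2); last by rewrite subrr expr0n.
  by rewrite !expr2; apply: cvgM; apply: cvgB => //; exact: cvg_cst.
have /(_ _) := cvgD (sub0 _ _ ua) (sub0 _ _ ub).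
by rewrite addr0; apply; exact: eventually_filter.
Qed.

Lemma geometric_cvg0 (C r : R) : 0 <= r < 1 -> C * r ^+ n @[n --> \oo] --> 0.
Proof.
move=> /andP[r0 r1]; have : `|r| < 1 by rewrite ger0_norm.
by move=> /(cvg_geometric C).
Qed.

End fast_completeness.

Section L2_complete.
Context d (X : measurableType d) (R : realType) (mu : {measure set X -> \bar R}).
Context (V : lmodType R[i]) (dot : {dot V for @conjc R}).
Local Notation dotL := (@L2_dot _ _ _ mu _ dot).
Local Notation L2V := (L2 mu dot).

Lemma L2_dnormE (q : L2V) :
  ((dnorm dotL q)%:E = \int[mu]_x (dnorm dot (L2_fun q x))%:E)%E.
Proof.
have qi := integrable_dnorm (L2_funP q).
by rewrite -[LHS]/((\int[mu]_x _)%:E) EFin_Rintegral.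
Qed.

Lemma L2_funB (p q : L2V) : \forall x \ae mu, L2_fun (p - q) x = L2_fun p x - L2_fun q x.
Proof.
apply: filterS2 (L2_funD p (-1 *: q)) (L2_funZ (-1) q) => x.
by rewrite !scaleN1r => -> ->.
Qed.

Lemma L2_dnormB (p q : L2V) :
  ((dnorm dotL (p - q))%:E = \int[mu]_x (dnorm dot (L2_fun p x - L2_fun q x))%:E)%E.
Proof.
rewrite L2_dnormE; apply: ae_eq_integral => //.
- apply/measurable_EFinP; apply: measurable_dnorm; exact: (L2_funP _).1.
- apply/measurable_EFinP.
  have := square_integrable_funP (-1) (L2_funP q) (L2_funP p) => -[/measurable_dnorm + _].
  by apply: eq_measurable_fun => x _; rewrite scaleN1r addrC.
- by apply: filterS (L2_funB p q) => x -> _.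
Qed.

Lemma square_integrable_funB f g : square_integrable_fun mu dot f ->
  square_integrable_fun mu dot g -> square_integrable_fun mu dot (fun x => f x - g x).
Proof.
move=> f2 g2; have := square_integrable_funP (-1) g2 f2.
by congr square_integrable_fun; apply/funext => x; rewrite scaleN1r addrC.
Qed.

(** With ratio r / 2, the squared increments multiplied by r^-k have integrals at most C 2^-k.
    Almost everywhere their sum is bounded by some M, so the pointwise increments are at most M r^k
    and the completeness of V applies at each such point. *)
Lemma L2_fast_complete (r : R) : 0 < r <= 4^-1 -> fast_complete dot r ->
  fast_complete dotL (r / 2).
Proof.
move=> /andP[r0 r4] rV q C qC.
have r2 : 0 <= r / 2 <= 4^-1 by apply/andP; split; lra.
have C0 : 0 <= C by have := qC 0%N; rewrite expr0 mulr1; exact: le_trans (dnorm_ge0 _ _).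
have mq k : strongly_measurable dot (L2_fun (q k)) := (L2_funP (q k)).1.
have mD f g : strongly_measurable dot f -> strongly_measurable dot g ->
    measurable_fun setT (fun x : X => dnorm dot (f x - g x)).
  move=> mf mg; have := measurable_dnorm (strongly_measurableD mf (strongly_measurableZ (-1) mg)).
  by apply: eq_measurable_fun => x _; rewrite /= scaleN1r.
pose h k x := r^-1 ^+ k * dnorm dot (L2_fun (q k.+1) x - L2_fun (q k) x).
have hb : {ae mu, forall x, exists M : R, forall n, \sum_(k < n) h k x <= M}.
  apply: (@ae_bounded_series _ _ _ mu h C).
  - by move=> n; apply: measurable_funM => //; exact: mD.
  - by move=> n x; rewrite mulr_ge0 ?dnorm_ge0// exprn_ge0 ?invr_ge0 ?ltW.
  - move=> n; under eq_integral do rewrite EFinM.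
    rewrite ge0_integralZl_EFin//.
    + rewrite -L2_dnormB -EFinM lee_fin.
      apply: (@le_trans _ _ (r^-1 ^+ n * (C * (r / 2) ^+ n))).
        by rewrite ler_wpM2l ?exprn_ge0 ?invr_ge0 ?(ltW r0).
      by rewrite mulrCA -exprMn mulrA mulVf ?gt_eqF// mul1r.
    + by move=> x _; rewrite lee_fin dnorm_ge0.
    + by apply/measurable_EFinP; exact: mD.
    + by rewrite exprn_ge0 ?invr_ge0 ?(ltW r0).
have [N [mN N0 hN]] := hb.
have lim x : ~ N x -> exists v, dnorm dot (v - L2_fun (q n) x) @[n --> \oo] --> 0.
  move=> Nx; have [M hM] : exists M : R, forall n, \sum_(k < n) h k x <= M.
    by apply: contrapT => nM; apply: Nx; exact: hN.
  apply: (rV (fun n => L2_fun (q n) x) M) => k.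
  have := hM k.+1; rewrite big_ord_recr/= /h exprVn.
  have s0 : 0 <= \sum_(i < k) r^-1 ^+ i * dnorm dot (L2_fun (q i.+1) x - L2_fun (q i) x).
    by apply: sumr_ge0 => i _; rewrite mulr_ge0 ?dnorm_ge0// exprn_ge0 ?invr_ge0 ?ltW.
  move=> hk; rewrite -ler_pdivrMr ?exprn_gt0// mulrC.
  by apply: le_trans hk; rewrite lerDr.
have /choice[f0 hf0] x : exists v, ~ N x -> dnorm dot (v - L2_fun (q n) x) @[n --> \oo] --> 0.
  by have [Nx|/lim[v hv]] := pselect (N x); [exists 0|exists v].
(* The choice of limits is arbitrary on [N]; the value 0 there makes [strongly_measurable_limit]
   applicable. *)
pose f x := if x \in N then 0 else f0 x.
have hf x : ~ N x -> dnorm dot (f x - L2_fun (q n) x) @[n --> \oo] --> 0.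
  by move=> Nx; rewrite /f memNset//; exact: hf0.
have mf : strongly_measurable dot f.
  apply: (@strongly_measurable_limit _ _ _ _ _ (fun n => L2_fun (q n)) f (~` N)) => //.
    exact: measurableC.
  by move=> x /contrapT Nx; rewrite /f mem_set.
(* Fatou in m for q (n + m) - q n, whose squared norm is bounded uniformly in m by [fast_cauchy]. *)
have fq n : (\int[mu]_x (dnorm dot (f x - L2_fun (q n) x))%:E <= (4 * C * (r / 2) ^+ n)%:E)%E.
  apply: (@fatou_ae _ _ _ mu (fun m x => (dnorm dot (L2_fun (q (n + m)%N) x - L2_fun (q n) x))%:E)).
  - by move=> m; apply/measurable_EFinP; exact: mD.
  - by move=> m x; rewrite lee_fin dnorm_ge0.
  - by apply/measurable_EFinP; exact: mD.
  - by move=> x; rewrite lee_fin dnorm_ge0.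
  - exists N; split => // x /=; apply: contra_notP => Nx.
    apply: cvg_EFin; first exact: nearW.
    apply: (@cvg_dnorm _ _ dot (fun m => L2_fun (q (n + m)%N) x - L2_fun (q n) x)).
    under eq_fun do rewrite opprB addrA subrK.
    under eq_fun do rewrite addnC.
    by have := hf x Nx; rewrite -(cvg_shiftn n).
  - move=> m; rewrite -L2_dnormB lee_fin; exact: fast_cauchy.
have f2 : square_integrable_fun mu dot f.
  have g2 : square_integrable_fun mu dot (fun x => f x - L2_fun (q 0%N) x).
    split; last by apply: le_lt_trans (fq 0%N) _; exact: ltry.
    have := strongly_measurableD mf (strongly_measurableZ (-1) (mq 0%N)).
    by congr strongly_measurable; apply/funext => x /=; rewrite scaleN1r.
  have := square_integrable_funP 1 g2 (L2_funP (q 0%N)).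
  by congr square_integrable_fun; apply/funext => x; rewrite scale1r subrK.
exists (L2_of mu dot f).
apply: (@squeeze_cvgr _ _ _ _ (cst 0) (fun n => 4 * C * (r / 2) ^+ n)).
- apply: nearW => n; rewrite dnorm_ge0/= -lee_fin L2_dnormB; apply: le_trans (fq n).
  rewrite le_eqVlt; apply/orP; left; apply/eqP; apply: ae_eq_integral => //.
  + apply/measurable_EFinP; exact: mD (L2_funP _).1 (mq n).
  + by apply/measurable_EFinP; exact: mD.
  + by apply: filterS (L2_ofE f2) => x -> _.
- exact: cvg_cst.
- by apply: geometric_cvg0; apply/andP; split; lra.
Qed.

End L2_complete.

Section projection.
Context (R : realType) (V : lmodType R[i]) (dot : {dot V for @conjc R}).

(** Minimality along the real multiples of w kills the real part of the inner product, and along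
    those of i w the imaginary part. *)
Lemma orthogonal_of_minimal (h w : V) :
  (forall a : R[i], dnorm dot h <= dnorm dot (h - a *: w)) -> dot h w = 0.
Proof.
move=> hmin.
have re0 (v : V) : (forall t : R, dnorm dot h <= dnorm dot (h - t%:C%C *: v)) ->
    complex.Re (dot h v) = 0.
  move=> hv; have [->|v0] := eqVneq v 0; first by rewrite -(scale0r 0) dotZr conjc0 mul0r.
  have D0 := dnorm_gt0 dot v0.
  (* The minimiser of the quadratic polynomial t -> |h - t v|^2. *)
  have := hv (complex.Re (dot h v) / dnorm dot v).
  rewrite dnormB dnormZr dotZr conjc_real ReZ; set t := complex.Re _; set D := dnorm dot v in D0 *.
  have -> : dnorm dot h - 2 * (t / D * t) + (t / D) ^+ 2 * D = dnorm dot h - t ^+ 2 / D.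
    by field; rewrite gt_eqF.
  rewrite lerBrDr gerDl => tD.
  have : t ^+ 2 <= 0 by rewrite -(ler_pM2r (_ : 0 < D^-1)) ?invr_gt0// mul0r.
  by move=> t2; apply/eqP; rewrite -sqrf_eq0 eq_le t2 sqr_ge0.
have r1 : complex.Re (dot h w) = 0 by apply: re0 => t; exact: hmin.
have r2 : complex.Re (dot h ((0 +i* 1)%C *: w)) = 0.
  by apply: re0 => t; rewrite scalerA; exact: hmin.
move: r1 r2; rewrite dotZr; case: (dot h w) => a b /= -> ; rewrite mul0r sub0r mulN1r opprK => ->.
by [].
Qed.

(** The vector is F - v, where v is the point of W nearest to some F outside W. Choosing the
    minimising sequence within r^n of the infimum makes it rapidly Cauchy. *)
Lemma exists_orthogonal (r : R) (W : set V) : 0 < r < 1 -> fast_complete dot r ->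
  closed_subspace dot W -> W != setT -> exists2 h, h != 0 & forall w, W w -> dot h w = 0.
Proof.
move=> /andP[r0 r1] rV [W0 WD Wc] WT.
have [F WF] : exists F, ~ W F.
  apply: contrapT => nF; move/eqP : WT; apply; apply/seteqP; split => // v _.
  by apply: contrapT => Wv; apply: nF; exists v.
have WZ a v : W v -> W (a *: v) by move=> Wv; rewrite -[_ *: _]addr0; exact: WD.
pose D := [set dnorm dot (F - w) | w in W].
have D0 : D (dnorm dot (F - 0)) by exists 0.
have hD : has_inf D.
  split; first by exists (dnorm dot (F - 0)).
  by exists 0 => _ [w _ <-]; exact: dnorm_ge0.
pose dd := inf D.
have ddl w : W w -> dd <= dnorm dot (F - w) by move=> Ww; apply: (ge_inf hD.2); exists w.
have /choice[w hw] n : exists w, W w /\ dnorm dot (F - w) < dd + r ^+ n.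
  have [_ [w Ww <-] lt] := inf_adherent (exprn_gt0 n r0) hD.
  by exists w.
(* Parallelogram law: the midpoint of two terms is in W, so the left side is at most 2 (dd + r^k) +
   2 (dd + r^(k+1)) - 4 dd. *)
have wC k : dnorm dot (w k.+1 - w k) <= 4 * r ^+ k.
  have Wm : W (2^-1%:C%C *: (w k.+1 + w k)).
    apply: WZ; rewrite -[w k.+1]scale1r; apply: WD; [exact: (hw _).1|exact: (hw _).1].
  have := ddl _ Wm; have := (hw k).2; have := (hw k.+1).2.
  have par (a b : V) : dnorm dot (a - b) + dnorm dot (a + b) = 2 * dnorm dot a + 2 * dnorm dot b.
    by rewrite dnormB dnormD; ring.
  have := par (F - w k) (F - w k.+1).
  have -> : F - w k - (F - w k.+1) = w k.+1 - w k by rewrite opprB addrC addrA subrK.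
  have -> : F - w k + (F - w k.+1) = 2%:C%C *: (F - 2^-1%:C%C *: (w k.+1 + w k)).
    rewrite scalerBr scalerA -rmorphM mulfV// rmorph1 scale1r.
    have -> : 2%:C%C = 1 + 1 :> R[i] by rewrite -[1 + 1]/(2 : R[i]) rmorph_nat.
    by rewrite scalerDl scale1r opprD addrACA [- w k.+1 - _]addrC.
  rewrite dnormZr (exprS r).
  have : r * r ^+ k <= r ^+ k by rewrite ler_piMl ?exprn_ge0 ?(ltW r0) ?(ltW r1).
  lra.
have [v hv] := rV w 4 wC.
have Wv : W v.
  apply: (Wc w); first by move=> n; exact: (hw n).1.
  have : Num.sqrt (dnorm dot (v - w n)) @[n --> \oo] --> Num.sqrt 0.
    by apply: continuous_cvg => //; exact: sqrt_continuous.
  rewrite sqrtr0; under eq_fun do rewrite -dnormN opprB.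
  exact.
have hd : dnorm dot (F - v) <= dd.
  have cFv : dnorm dot (F - w n) @[n --> \oo] --> dnorm dot (F - v).
    apply: (@cvg_dnorm _ _ dot (fun n => F - w n)).
    rewrite (_ : (fun n => _) = (fun n => dnorm dot (v - w n)))//.
    apply/funext => n; rewrite -[RHS]dnormN opprB; congr dnorm.
    by rewrite opprB [LHS]addrC addrA subrK.
  have cdd : dd + r ^+ n @[n --> \oo] --> dd + 0.
    apply: cvgD; first exact: cvg_cst.
    have := @geometric_cvg0 _ 1 r; rewrite (ltW r0) r1 => /(_ isT).
    by under eq_fun do rewrite mul1r.
  rewrite -[leRHS]addr0; apply: (ler_cvg_to cFv cdd).
  by apply: nearW => n; exact: ltW (hw n).2.
exists (F - v).
  by rewrite subr_eq0; apply: contra_notN WF => /eqP ->.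
move=> u Wu; apply: orthogonal_of_minimal => a.
apply: le_trans hd _; rewrite -addrA -opprD; apply: ddl.
by rewrite addrC; exact: WD.
Qed.

End projection.

(** * Jointly measurable representatives *)

Section joint_representative.
Context d1 d2 (X : measurableType d1) (Y : measurableType d2) (R : realType).
Variable nu : {measure set Y -> \bar R}.
Local Notation L2Y := (L2 nu (@complex_dot R)).
Local Notation dotY := (@L2_dot _ _ _ nu _ (@complex_dot R)).

Lemma measurable_countable_cases d (Z : measurableType d) (A : nat -> set (X * Y))
    (g : nat -> X * Y -> Z) (f : X * Y -> Z) :
  (forall i, measurable (A i)) -> (forall i, measurable_fun setT (g i)) ->
  (forall z, exists i, A i z) -> (forall i z, A i z -> f z = g i z) -> measurable_fun setT f.
Proof.
move=> mA mg Acov fg _ B mB; rewrite setTI.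
rewrite (_ : f @^-1` B = \bigcup_i (A i `&` g i @^-1` B)).
  apply: bigcupT_measurable => i; apply: measurableI => //.
  by rewrite -[X in measurable X]setTI; exact: mg.
apply/seteqP; split => [z Bz|z [i _ [Az /=]]]; last by rewrite -fg.
by have [i Az] := Acov z; exists i => //; split => //=; rewrite -(fg i).
Qed.

Lemma cmeasurable_L2_fun (v : L2Y) : cmeasurable (L2_fun v : Y -> R[i]).
Proof. exact: strongly_measurable_cmeasurable (L2_funP v).1. Qed.

Lemma cmeasurable_simple_uncurry (u : X -> L2Y) (v : nat -> L2Y) (A : nat -> set X) :
  (forall i, measurable (A i)) -> (forall x, exists i, A i x) -> (forall i x, A i x -> u x = v i) ->
  cmeasurable (fun z : X * Y => L2_fun (u z.1) z.2 : R[i]).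
Proof.
move=> mA Acov uv.
have mAT i : measurable (A i `*` [set: Y]) by exact: measurableX.
have cov (z : X * Y) : exists i, (A i `*` [set: Y]) z.
  by have [i Az] := Acov z.1; exists i.
split.
- apply: (measurable_countable_cases mAT (g := fun i z => complex.Re (L2_fun (v i) z.2))) => //.
    by move=> i; exact: (measurableT_comp (cmeasurable_L2_fun (v i)).1 measurable_snd).
  by move=> i z [/= Az _]; rewrite (uv i).
- apply: (measurable_countable_cases mAT (g := fun i z => complex.Im (L2_fun (v i) z.2))) => //.
    by move=> i; exact: (measurableT_comp (cmeasurable_L2_fun (v i)).2 measurable_snd).
  by move=> i z [/= Az _]; rewrite (uv i).
Qed.

Lemma measurable_first_index (P : nat -> set X)  : (forall n, measurable (P n)) ->
  forall n, measurable (P n `&` \bigcap_(k < n) ~` P k).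
Proof.
move=> mP n; apply: measurableI => //.
by apply: bigcap_measurableType => k _; exact: measurableC.
Qed.

(* For every x, the section f(x, .) is the limit of s_n(x) along a subsequence of indices n
   that depends measurably on x and is so fast that it converges almost everywhere. *)
Lemma joint_representative (F : X -> L2Y) : strongly_measurable dotY F ->
  exists f : X * Y -> R[i], cmeasurable f /\
    forall x, \forall y \ae nu, f (x, y) = L2_fun (F x) y.
Proof.
move=> mF; have [s [ms sF]] := mF.
pose D n x := dnorm dotY (F x - s n x).
have mD n : measurable_fun setT (D n).
  have := measurable_dnorm (strongly_measurableD mF
    (strongly_measurableZ (-1) (simple_strongly_measurable dotY (ms n)))).
  by apply: eq_measurable_fun => x _; rewrite /D /= scaleN1r.
pose P j n := [set x | D n x < 2^-1 ^+ j].
have mP j n : measurable (P j n) by apply: measurable_set_lt => //; exact: measurable_cst.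
have Pex j x : exists n, `[< P j n x >].
  have := sF x => /cvgrPdist_lt /(_ (2^-1 ^+ j)) [|n _ /(_ n (leqnn n))]; first by rewrite exprn_gt0.
  rewrite sub0r normrN ger0_norm ?dnorm_ge0// => h; exists n; exact/asboolP.
pose N j x := ex_minn (Pex j x).
pose u j x := s (N j x) x.
have uD j x : dnorm dotY (F x - u j x) < 2^-1 ^+ j.
  by rewrite /u /N; case: ex_minnP => n /asboolP.
have NE j n x : (P j n `&` \bigcap_(k < n) ~` P j k) x -> N j x = n.
  move=> [Pn Pk]; rewrite /N; case: ex_minnP => m /asboolP Pm mmin.
  apply/eqP; rewrite eqn_leq; apply/andP; split; first exact/mmin/asboolP.
  by rewrite leqNgt; apply/negP => /Pk; exact.
have NP j x : (P j (N j x) `&` \bigcap_(k < N j x) ~` P j k) x.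
  rewrite {1 2}/N; case: ex_minnP => m /asboolP Pm mmin; split => // k /= km Pk.
  by have := mmin k; rewrite leqNgt km => /(_ (asboolT Pk)).
have /choice[S hS] n : exists S : seq L2Y, range (s n) = [set` S] by exact/finite_seqP.
have mf j : cmeasurable (fun z : X * Y => L2_fun (u j z.1) z.2 : R[i]).
  pose A i : set X := if unpickle i is Some (n, k) then
    (P j n `&` \bigcap_(m < n) ~` P j m) `&` s n @^-1` [set nth 0 (S n) k] else set0.
  pose v i : L2Y := if unpickle i is Some (n, k) then nth 0 (S n) k else 0.
  apply: (@cmeasurable_simple_uncurry _ v A).
  - move=> i; rewrite /A; case: unpickle => [[n k]|]; last exact: measurable0.
    by apply: measurableI; [exact: measurable_first_index|exact: ms].
  - move=> x; have : [set` S (N j x)] (u j x) by rewrite -hS; exists x.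
    move=> /= /(nthP 0)[k _ ke]; exists (pickle (N j x, k)).
    rewrite /A pickleK; split; first exact: NP.
    by rewrite /= ke.
  - move=> i x; rewrite /A /v; case: unpickle => [[n k]|//].
    by move=> [/NE Nn /= <-]; rewrite /u Nn.
(* An upper limit is defined and measurable everywhere; [fine] makes it 0 where it is infinite. *)
pose lim (p : R[i] -> R) (z : X * Y) : R :=
  fine (limn_esup (fun j => (p (L2_fun (u j z.1) z.2))%:E)).
have mlim (p : R[i] -> R) : (forall j, measurable_fun setT (fun z : X * Y => p (L2_fun (u j z.1) z.2))) ->
    measurable_fun setT (lim p).
  move=> mp; apply: (@measurableT_comp _ _ _ _ _ _ fine) => //.
  by apply: (measurable_fun_limn_esup (f := fun j z => (p (L2_fun (u j z.1) z.2))%:E)) => j; exact/measurable_EFinP.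
exists (fun z => (lim (@complex.Re R) z +i* lim (@complex.Im R) z)%C); split.
  by split; apply: mlim => j; [exact: (mf j).1|exact: (mf j).2].
move=> x.
pose h j y := csq (L2_fun (F x) y - L2_fun (u j x) y).
have mh j : measurable_fun setT (h j).
  have := L2_funP (F x - u j x); have := L2_funP (F x); have := L2_funP (u j x).
  move=> u2 F2 _; have [/measurable_dnorm + _] := square_integrable_funB F2 u2.
  by apply: eq_measurable_fun => y _; rewrite dnorm_complex.
have /ae_bounded_series : forall j, (\int[nu]_y (h j y)%:E <= (1 * 2^-1 ^+ j)%:E)%E.
  move=> j; under eq_integral do rewrite /h -dnorm_complex.
  by rewrite -L2_dnormB lee_fin mul1r ltW.
move=> /(_ mh (fun j y => csq_ge0 _)); apply: filterS => y [M hM].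
have h0 : h j y @[j --> \oo] --> 0.
  by apply: (bounded_series_cvg0 _ hM) => n; exact: csq_ge0.
have limE (p : R[i] -> R) : (forall z w, (p z - p w) ^+ 2 <= csq (z - w)) ->
    lim p (x, y) = p (L2_fun (F x) y).
  move=> hp; rewrite /lim/=.
  have cp : (fun j => p (L2_fun (u j x) y)) @ \oo --> p (L2_fun (F x) y).
    apply/cvgrPdist_lt => e e0.
    move/cvgrPdist_lt : h0 => /(_ (e ^+ 2)) [|n _ hn]; first exact: exprn_gt0.
    exists n => // j /hn; rewrite /= sub0r normrN ger0_norm ?csq_ge0// => hj.
    rewrite -(@ltr_pXn2r _ 2)// ?nnegrE ?normr_ge0 ?(ltW e0)// real_normK ?num_real//.
    exact: le_lt_trans (hp _ _) hj.
  have ce : (fun j => (p (L2_fun (u j x) y))%:E) @ \oo --> (p (L2_fun (F x) y))%:E.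
    by apply: cvg_EFin => //; exact: nearW.
  by rewrite is_cvg_limn_esupE ?(cvg_lim _ ce)//; apply/cvg_ex; exists (p (L2_fun (F x) y))%:E.
rewrite !limE => [|z w|z w]; first by case: (L2_fun _ _).
- by rewrite /csq !raddfB lerDr sqr_ge0.
- by rewrite /csq !raddfB lerDl sqr_ge0.
Qed.

End joint_representative.

(** * The orthogonality relation on Lebesgue spaces *)

Ltac mfun := lazymatch goal with
  | |- measurable_fun _ (fun x => x) => exact: measurable_id
  | |- measurable_fun _ (fun x => (_, _)) => apply: measurable_fun_pair; mfun
  | |- measurable_fun _ (fun x => fst x) => exact: measurable_fst
  | |- measurable_fun _ (fun x => snd x) => exact: measurable_snd
  | |- measurable_fun _ (fun x => fst (@?h x)) =>
      apply: (measurableT_comp measurable_fst (g := h)); mfun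
  | |- measurable_fun _ (fun x => snd (@?h x)) =>
      apply: (measurableT_comp measurable_snd (g := h)); mfun
  | |- measurable_fun _ (fun x => (_ * _)%R) => apply: measurable_funM; mfun
  | |- measurable_fun _ (fun x => (_ + - _)%R) => apply: measurable_funB; mfun
  | |- measurable_fun _ (fun x => (- _)%R) => apply: measurable_funN; mfun
  | |- measurable_fun _ (fun x => (_ + _)%R) => apply: measurable_funD; mfun
  | |- measurable_fun _ (fun x => (_ ^+ _)%R) => apply: measurable_funX; mfun
  | |- measurable_fun _ (fun x => (_^-1)%R) => apply: measurable_fun_inv; mfun
  | |- measurable_fun _ (fun x => `|_|%R) =>
      apply: (measurableT_comp (@normr_measurable _ setT)); mfun
  | |- measurable_fun _ (fun x => _%:E) => apply/measurable_EFinP; mfun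
  | |- _ => first [exact: measurable_cst | assumption | exact: measurable_fst | exact: measurable_snd | idtac]
  end.

(** * Linear substitutions in two and four variables *)

Section plane_substitutions.
Variable R : realType.
Local Notation T := (measurableTypeR R).
Local Notation leb := (@lebesgue_measure R).
Local Notation leb2 := (@lebesgue2 R).
Local Open Scope ereal_scope.

(** Two affine substitutions on the line: y -> d y + c x for fixed x, of Jacobian d, then x -> (D /
    d) x + b y / d for fixed y. *)
Let ge0_integral_linear2_aux (a b c d : R) (h : T * T -> \bar R) : d != 0%R ->
  (a * d - b * c)%R != 0%R -> measurable_fun setT h -> (forall z, 0 <= h z) ->
  \int[leb2]_z h (a * z.1 + b * z.2, c * z.1 + d * z.2)%R =
  (`|a * d - b * c|^-1)%:E * \int[leb2]_z h z.
Proof.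
set D := (a * d - b * c)%R => d0 D0 mh h0.
have mc : measurable_fun setT
    (fun z : T * T => h (a * z.1 + b * z.2, c * z.1 + d * z.2)%R).
  by apply: (measurableT_comp mh); mfun.
pose k (z : T * T) := h (a * z.1 + b * ((z.2 - c * z.1) / d), z.2)%R.
have mk : measurable_fun setT k by apply: (measurableT_comp mh); mfun.
have k0 z : 0 <= k z by exact: h0.
rewrite lebesgue2_tonelli//.
transitivity (\int[leb]_x ((`|d|^-1)%:E * \int[leb]_y k (x, y))).
  apply: eq_integral => x _.
  rewrite -(@ge0_integral_affine R d (c * x) (fun y => k (x, y)))//.
  - apply: eq_integral => y _; rewrite /k/=; congr h; congr pair; last by rewrite addrC.
    by rewrite addrK mulrAC divff// mul1r.
  - by apply: (measurableT_comp mk); mfun.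
rewrite ge0_integralZl_EFin//; last 2 first.
- by move=> x _; exact: integral_ge0.
- exact: (measurable_parametric_integral leb mk).
rewrite -(lebesgue2_tonelli mk k0) (lebesgue2_tonelli2 mk k0) (lebesgue2_tonelli2 mh h0).
rewrite (eq_integral (fun y => (`|D / d|^-1)%:E * \int[leb]_x h (x, y))); last first.
  move=> y _; rewrite -(@ge0_integral_affine R (D / d) (b * y / d) (fun x => h (x, y)))//.
  - apply: eq_integral => x _; rewrite /k/=; congr h; congr pair.
    by rewrite /D; field.
  - by rewrite mulf_neq0// invr_neq0.
  - by apply: (measurableT_comp mh); mfun.
rewrite ge0_integralZl_EFin//; last 2 first.
- by move=> x _; exact: integral_ge0.
- apply: (measurable_parametric_integral leb (G := fun z : T * T => h (z.2, z.1))).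
  by apply: (measurableT_comp mh); mfun.
rewrite muleA -EFinM; congr (_%:E * _).
by rewrite normrM normfV invfM invrK mulrCA mulVf ?mulr1// normr_eq0.
Qed.

Lemma lebesgue2_swap (h : T * T -> \bar R) : measurable_fun setT h -> (forall z, 0 <= h z) ->
  \int[leb2]_z h (z.2, z.1) = \int[leb2]_z h z.
Proof.
move=> mh h0; rewrite lebesgue2_tonelli2//; last by apply: (measurableT_comp mh); mfun.
by rewrite lebesgue2_tonelli.
Qed.

(** If d = 0 then c is nonzero, and exchanging the two source variables puts c in the place of d. *)
Lemma ge0_integral_linear2 (a b c d : R) (h : T * T -> \bar R) :
  (a * d - b * c)%R != 0%R -> measurable_fun setT h -> (forall z, 0 <= h z) ->
  \int[leb2]_z h (a * z.1 + b * z.2, c * z.1 + d * z.2)%R =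
  (`|a * d - b * c|^-1)%:E * \int[leb2]_z h z.
Proof.
move=> D0 mh h0; have [d0|d0] := eqVneq d 0%R; last exact: ge0_integral_linear2_aux.
move: D0; rewrite {}d0 mulr0 sub0r oppr_eq0 mulf_eq0 negb_or => /andP[b0 c0].
have mc : measurable_fun setT
    (fun z : T * T => h (b * z.1 + a * z.2, 0 * z.1 + c * z.2)%R).
  by apply: (measurableT_comp mh); mfun.
rewrite normrN -[(b * c)%R]subr0 -(mulr0 a) -ge0_integral_linear2_aux//; last first.
  by rewrite mulr0 subr0 mulf_neq0.
rewrite -(lebesgue2_swap mc)//; apply: eq_integral => z _; congr h; congr pair.
  by rewrite addrC.
by rewrite mulr0 !mul0r addr0 add0r.
Qed.

Lemma ge0_integral_shift2 (u v : R) (h : T * T -> \bar R) :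
  measurable_fun setT h -> (forall z, 0 <= h z) ->
  \int[leb2]_z h (z.1 + u, z.2 + v)%R = \int[leb2]_z h z.
Proof.
move=> mh h0.
have mc : measurable_fun setT (fun z : T * T => h (z.1 + u, z.2 + v)%R).
  by apply: (measurableT_comp mh); mfun.
rewrite lebesgue2_tonelli//.
have mu2 : measurable_fun setT (fun z : T * T => h (z.1 + u, z.2)%R).
  by apply: (measurableT_comp mh); mfun.
transitivity (\int[leb]_x \int[leb]_y h (x + u, y)%R).
  apply: eq_integral => x _.
  rewrite -(@ge0_integral_shift R v (fun y => h (x + u, y)%R))//.
  by apply: (measurableT_comp mh); mfun.
rewrite -(@lebesgue2_tonelli R (fun z => h (z.1 + u, z.2)%R))// lebesgue2_tonelli2//.
rewrite (lebesgue2_tonelli2 mh h0); apply: eq_integral => y _.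
rewrite -(@ge0_integral_shift R u (fun x => h (x, y)))//.
by apply: (measurableT_comp mh); mfun.
Qed.

Local Notation leb4 := (leb2 \x leb2).

Lemma lebesgue4_tonelli (H : (T * T) * (T * T) -> \bar R) : measurable_fun setT H ->
  (forall z, 0 <= H z) -> \int[leb4]_z H z = \int[leb2]_p \int[leb2]_q H (p, q).
Proof. by move=> mH H0; exact: fubini_tonelli1. Qed.

Definition transpose4 (z : (T * T) * (T * T)) : (T * T) * (T * T) :=
  ((z.1.1, z.2.1), (z.1.2, z.2.2)).

Lemma measurable_transpose4 : measurable_fun setT transpose4.
Proof.
by apply: measurable_fun_pair; apply: measurable_fun_pair;
  [exact: (measurableT_comp measurable_fst measurable_fst)|
   exact: (measurableT_comp measurable_fst measurable_snd)|
   exact: (measurableT_comp measurable_snd measurable_fst)|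
   exact: (measurableT_comp measurable_snd measurable_snd)].
Qed.

(** Matrix transposition exchanges the two middle coordinates only: with the outer ones set apart by
    Tonelli, it is a swap in the plane. *)
Lemma lebesgue4_transpose (H : (T * T) * (T * T) -> \bar R) : measurable_fun setT H ->
  (forall z, 0 <= H z) -> \int[leb4]_z H (transpose4 z) = \int[leb4]_z H z.
Proof.
have it (G : (T * T) * (T * T) -> \bar R) : measurable_fun setT G -> (forall z, 0 <= G z) ->
    \int[leb4]_z G z = \int[leb]_a \int[leb2]_z \int[leb]_d G ((a, z.1), (z.2, d)).
  move=> mG G0; rewrite lebesgue4_tonelli// lebesgue2_tonelli; last 2 first.
  - exact: (measurable_parametric_integral leb2 mG).
  - by move=> p; exact: integral_ge0.
  apply: eq_integral => a _.
  rewrite [RHS]lebesgue2_tonelli; last 2 first.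
  - apply: (measurable_parametric_integral leb (G := fun z : (T * T) * T => G ((a, z.1.1), (z.1.2, z.2)))).
    by apply: (measurableT_comp mG); mfun.
  - by move=> p; exact: integral_ge0.
  apply: eq_integral => b _; rewrite lebesgue2_tonelli//.
  by apply: (measurableT_comp mG); mfun.
move=> mH H0; have mHt := measurableT_comp mH measurable_transpose4.
rewrite [RHS](it _ mH H0); apply: etrans (it _ mHt (fun z => H0 _)) _.
apply: eq_integral => a _.
rewrite -[RHS]lebesgue2_swap//.
- apply: (measurable_parametric_integral leb (G := fun z : (T * T) * T => H ((a, z.1.1), (z.1.2, z.2)))).
  by apply: (measurableT_comp mH); mfun.
- by move=> p; exact: integral_ge0.
Qed.

(* z.1 and z.2 are the rows of a 2 x 2 matrix, which is multiplied on the left. *)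
Definition rows_mul (a b c d : R) (z : (T * T) * (T * T)) : (T * T) * (T * T) :=
  ((a * z.1.1 + b * z.2.1, a * z.1.2 + b * z.2.2),
   (c * z.1.1 + d * z.2.1, c * z.1.2 + d * z.2.2))%R.

Lemma measurable_rows_mul a b c d : measurable_fun setT (rows_mul a b c d).
Proof. by rewrite /rows_mul; mfun. Qed.

(** Left multiplication acts on each of the two columns by the same linear map of the plane, hence
    the square of the determinant; [transpose4] passes from rows to columns. *)
Lemma ge0_integral_rows_mul (a b c d : R) (H : (T * T) * (T * T) -> \bar R) :
  (a * d - b * c)%R != 0%R -> measurable_fun setT H -> (forall z, 0 <= H z) ->
  \int[leb4]_z H (rows_mul a b c d z) = (((a * d - b * c) ^+ 2)^-1)%:E * \int[leb4]_z H z.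
Proof.
set D := (a * d - b * c)%R => D0 mH H0.
have mt := measurable_transpose4.
have mHr : measurable_fun setT (H \o rows_mul a b c d).
  by apply: measurableT_comp => //; exact: measurable_rows_mul.
have mK : measurable_fun setT (H \o rows_mul a b c d \o transpose4) by exact: measurableT_comp.
have t1 := lebesgue4_transpose mHr (fun z => H0 _); rewrite -[LHS]t1.
rewrite -(lebesgue4_transpose mH H0).
have mHt : measurable_fun setT (H \o transpose4) by exact: measurableT_comp.
rewrite [LHS](lebesgue4_tonelli mK (fun z => H0 _)).
pose L (z : T * T) : T * T := (a * z.1 + b * z.2, c * z.1 + d * z.2)%R.
have mL : measurable_fun setT L by rewrite /L; mfun.
transitivity (\int[leb2]_p ((`|D|^-1)%:E * \int[leb2]_q H (transpose4 (L p, q)))).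
  apply: eq_integral => p _.
  rewrite -(ge0_integral_linear2 (a := a) (b := b) (c := c) (d := d)
    (h := fun q => H (transpose4 (L p, q))))//.
  by apply: (measurableT_comp mHt); mfun.
rewrite ge0_integralZl_EFin//; last 2 first.
- by move=> x _; exact: integral_ge0.
- apply: (measurable_parametric_integral leb2 (G := fun z => H (transpose4 (L z.1, z.2)))).
  by apply: (measurableT_comp mHt); apply: measurable_fun_pair; [apply: (measurableT_comp mL)|]; mfun.
rewrite (ge0_integral_linear2 (h := fun p => \int[leb2]_q H (transpose4 (p, q))))//; last 2 first.
- exact: (measurable_parametric_integral leb2 mHt).
- by move=> p; exact: integral_ge0.
have t2 := lebesgue4_tonelli mHt (fun z => H0 _); rewrite -[in LHS]t2 muleA -EFinM; congr (_%:E * _).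
by rewrite -invfM -expr2 real_normK ?num_real.
Qed.

End plane_substitutions.

Section complex_integrability.
Context d (X : measurableType d) (R : realType) (mu : {measure set X -> \bar R}).
Implicit Types a b h : X -> R[i].

Lemma cintegrable_dominated h (g : X -> R) : cmeasurable h -> measurable_fun setT g ->
  (forall x, 0 <= g x) -> (forall x, csq (h x) <= g x ^+ 2) -> (\int[mu]_x (g x)%:E < +oo)%E ->
  cintegrable mu h.
Proof.
move=> [h1 h2] mg g0 hg goo.
have gi : mu.-integrable setT (EFin \o g).
  apply/integrableP; split; first exact/measurable_EFinP.
  by under eq_integral do rewrite /= ger0_norm//.
have le (r : R) x : r ^+ 2 <= csq (h x) -> `|r| <= `|g x|.
  by move=> rh; rewrite -ler_sqr ?nnegrE ?normr_ge0// !real_normK ?num_real// (le_trans rh).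
split; apply: (le_integrable _ _ _ gi) => //; try exact/measurable_EFinP.
  by move=> x _; rewrite /= lee_fin le// /csq lerDl sqr_ge0.
by move=> x _; rewrite /= lee_fin le// /csq lerDr sqr_ge0.
Qed.

Lemma cintegrableM_conj a b : cmeasurable a -> cmeasurable b ->
  (\int[mu]_x (csq (a x))%:E < +oo)%E -> (\int[mu]_x (csq (b x))%:E < +oo)%E ->
  cintegrable mu (fun x => a x * (b x)^*%C).
Proof.
move=> ma mb aoo boo; have [ca cb] := (measurable_csq ma, measurable_csq mb).
apply: (@cintegrable_dominated _ (fun x => csq (a x) + csq (b x))).
- by apply: cmeasurableM => //; exact: cmeasurable_conj.
- exact: measurable_funD.
- by move=> x; rewrite addr_ge0 ?csq_ge0.
- move=> x; rewrite csqM csq_conj; have := csq_ge0 (a x); have := csq_ge0 (b x).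
  move: (csq _) (csq _) => u v u0 v0; rewrite sqrrD.
  have uv : 0 <= u * v by exact: mulr_ge0.
  by have := sqr_ge0 u; have := sqr_ge0 v; rewrite mulr2n; lra.
- under eq_integral do rewrite EFinD.
  rewrite ge0_integralD//; last 4 first.
  + by move=> x _; rewrite lee_fin csq_ge0.
  + exact/measurable_EFinP.
  + by move=> x _; rewrite lee_fin csq_ge0.
  + exact/measurable_EFinP.
  exact: lte_add_pinfty.
Qed.

End complex_integrability.

Section weighted_image_transfer.
Context d1 d2 (X : measurableType d1) (Y : measurableType d2) (R : realType).
Variables (m : {measure set X -> \bar R}) (w : X -> R) (phi : X -> Y).
Variable nu : {measure set Y -> \bar R}.
Hypotheses (mphi : measurable_fun setT phi) (mw : measurable_fun setT w).
Hypothesis w0 : forall x, 0 <= w x.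
Hypothesis nuE : forall B, measurable B -> nu B = weighted_image m w phi B.

Lemma weighted_image_ae (P : Y -> Prop) :
  (\forall y \ae nu, P y) -> \forall x \ae m, 0 < w x -> P (phi x).
Proof.
move=> [N [mN N0 NP]].
have mI : measurable_fun setT (fun y => (\1_N y)%:E : \bar R) by apply/measurable_EFinP.
have : (\int[m]_x ((\1_N (phi x))%:E * (w x)%:E) = 0)%E.
  rewrite -(@ge0_integral_weighted_image _ _ X Y R m w phi nu mphi mw w0 nuE (fun y => (\1_N y)%:E))//.
  by rewrite integral_indic// setIT.
have mIw : measurable_fun setT (fun x => (\1_N (phi x))%:E * (w x)%:E : \bar R)%E.
  apply: emeasurable_funM; last exact/measurable_EFinP.
  exact: (measurableT_comp mI mphi).
rewrite (eq_integral (fun x => `|(\1_N (phi x))%:E * (w x)%:E|)%E); last first.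
  by move=> x _; rewrite gee0_abs// mule_ge0// lee_fin.
move/(ae_eq_integral_abs _ measurableT mIw); apply: filterS => x /(_ I) x0 wx.
apply: contrapT => nP; have Nx : N (phi x) by apply: NP.
by move: x0; rewrite indicE mem_set// mul1e => -[] wx0; move: wx; rewrite wx0 ltxx.
Qed.

Lemma integral_weighted_image (f : Y -> \bar R) : measurable_fun setT f ->
  (\int[nu]_y f y = \int[m]_x (f (phi x) * (w x)%:E))%E.
Proof.
move=> mf; rewrite integralE [RHS]integralE.
have gi := @ge0_integral_weighted_image _ _ X Y R m w phi nu mphi mw w0 nuE.
rewrite (gi _ (measurable_funepos mf)); last by move=> y; exact: funepos_ge0.
rewrite (gi _ (measurable_funeneg mf)); last by move=> y; exact: funeneg_ge0.
have w0' x : (0 <= (w x)%:E)%E by rewrite lee_fin.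
congr (_ - _)%E; apply: eq_integral => x _.
  by rewrite !funeposE maxe_pMl// mul0e.
by rewrite !funenegE -mulNe maxe_pMl// mul0e.
Qed.

Lemma cintegral_weighted_image (h : Y -> R[i]) : cmeasurable h ->
  cintegral nu h = cintegral m (fun x => (w x)%:C%C * h (phi x)).
Proof.
move=> [h1 h2]; rewrite /cintegral /Rintegral; congr (fine _ +i* fine _)%C.
  rewrite integral_weighted_image; last exact/measurable_EFinP.
  by apply: eq_integral => x _; case: (h _) => u v /=; rewrite mul0r subr0 mulrC.
rewrite integral_weighted_image; last exact/measurable_EFinP.
by apply: eq_integral => x _; case: (h _) => u v /=; rewrite mul0r addr0 mulrC.
Qed.

Lemma cintegrable_weighted_image (h : Y -> R[i]) : cintegrable nu h ->
  cintegrable m (fun x => (w x)%:C%C * h (phi x)).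
Proof.
move=> hi; have mh := cintegrable_cmeasurable hi; case: hi => h1 h2.
have mk : cmeasurable (fun x => (w x)%:C%C * h (phi x)).
  apply: cmeasurableM; first exact: cmeasurable_real.
  exact: (cmeasurable_comp mh mphi).
have aux (p : R[i] -> R) : (forall (r : R) z, p (r%:C%C * z) = r * p z) ->
    nu.-integrable setT (EFin \o (p \o h)) -> measurable_fun setT (p \o h) ->
    measurable_fun setT (fun x => p ((w x)%:C%C * h (phi x))) ->
    m.-integrable setT (EFin \o (fun x => p ((w x)%:C%C * h (phi x)))).
  move=> pZ /integrableP[_ hoo] mp mp'; apply/integrableP; split; first exact/measurable_EFinP.
  rewrite (@ge0_integral_weighted_image _ _ X Y R m w phi nu mphi mw w0 nuE) in hoo; last 2 first.
  - by apply: measurableT_comp => //; exact/measurable_EFinP.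
  - by move=> y; exact: abse_ge0.
  apply: le_lt_trans hoo; rewrite le_eqVlt; apply/orP; left; apply/eqP.
  by apply: eq_integral => x _ /=; rewrite pZ normrM (ger0_norm (w0 x)) mulrC EFinM.
split.
  by apply: aux => // [r z||]; [exact: ReZ|exact: mh.1|exact: mk.1].
apply: aux => // [r z||]; [|exact: mh.2|exact: mk.2].
by case: z => u v /=; rewrite mul0r addr0.
Qed.

End weighted_image_transfer.

(** * Plancherel in the variable 1/t *)

Section inverted_plancherel.
Variable R : realType.
Local Notation T := (measurableTypeR R).
Local Notation leb := (@lebesgue_measure R).

Let sqrinv_ge0 (x : T) : 0 <= (x ^+ 2)^-1.
Proof. by rewrite invr_ge0 sqr_ge0. Qed.

Let measurable_sqrinv : measurable_fun setT (fun x : T => (x ^+ 2)^-1).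
Proof. by mfun. Qed.

Lemma cintegral_inv (h : T -> R[i]) : cmeasurable h ->
  cintegral leb (fun x : T => ((x ^+ 2)^-1)%:C%C * h (x^-1)) = cintegral leb h.
Proof.
by move=> mh; rewrite [RHS](cintegral_weighted_image (@measurable_inv R) measurable_sqrinv
  sqrinv_ge0 (@lebesgue_weighted_inv R) mh).
Qed.

Lemma cintegrable_inv (h : T -> R[i]) : cintegrable leb h ->
  cintegrable leb (fun x : T => ((x ^+ 2)^-1)%:C%C * h (x^-1)).
Proof.
by move=> hi; exact: (cintegrable_weighted_image (@measurable_inv R) measurable_sqrinv
  sqrinv_ge0 (@lebesgue_weighted_inv R) hi).
Qed.

(** With t = 1/s the measure dt/|t| becomes ds/|s|, and the inner integral is the Fourier transform
    of phi(1/s) / |s|. The square of that function carries the Jacobian s^-2, so going back to t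
    leaves |phi|^2 against dt, and no longer dt/|t|. *)
Lemma plancherel_inv (phi : T -> R[i]) : cmeasurable phi ->
  cintegrable leb (fun t : T => (`|t|^-1)%:C%C * phi t) ->
  (\int[leb]_u (csq (cintegral leb (fun t : T =>
      expi (- (2 * pi * (t^-1 * u))) * ((`|t|^-1)%:C%C * phi t))))%:E =
   \int[leb]_t (csq (phi t))%:E)%E.
Proof.
move=> mphi phii; have mi := @measurable_inv R.
pose psi (s : T) : R[i] := (`|s|^-1)%:C%C * phi (s^-1).
have psiE (s : T) : ((s ^+ 2)^-1)%:C%C * ((`|s^-1|^-1)%:C%C * phi (s^-1)) = psi s.
  rewrite /psi mulrA -rmorphM/=; congr (_%:C%C * _).
  rewrite normfV invrK; have [->|s0] := eqVneq s 0; first by rewrite normr0 mulr0 invr0.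
  by rewrite -[s ^+ 2]real_normK ?num_real// expr2 invfM -mulrA mulVf ?mulr1// normr_eq0.
have psii : cintegrable leb psi.
  by have := cintegrable_inv phii; congr cintegrable; apply/funext => s; exact: psiE.
transitivity (\int[leb]_u (csq (fourier psi u))%:E)%E.
  apply: eq_integral => u _; congr (csq _)%:E.
  rewrite -cintegral_inv; last first.
    apply: cmeasurableM; first by apply: cmeasurable_expi; mfun.
    exact: cintegrable_cmeasurable phii.
  apply: eq_cintegral => s; rewrite mulrCA psiE invrK.
  by rewrite (mulrC u).
rewrite (plancherel psii) -[RHS]ge0_integral_inv; last 2 first.
- by apply/measurable_EFinP; exact: measurable_csq.
- by move=> t; rewrite lee_fin csq_ge0.
apply: eq_integral => s _; rewrite csqM csq_real -EFinM mulrC; congr (_ * _)%:E.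
by rewrite exprVn real_normK ?num_real.
Qed.

Lemma ge0_integral_dilate_inv (t : R) (G : T -> \bar R) : t != 0 -> measurable_fun setT G ->
  (forall x, (0 <= G x)%E) ->
  (\int[leb]_v (((v ^+ 2)^-1)%:E * G (v^-1 * t)%R) = (`|t|^-1)%:E * \int[leb]_x G x)%E.
Proof.
move=> t0 mG G0; have mc : measurable_fun setT (fun s : T => G (t * s)%R).
  by apply: (measurableT_comp mG); apply: measurable_funM => //; exact: measurable_cst.
under eq_integral do rewrite muleC mulrC.
rewrite (ge0_integral_inv mc)// -(ge0_integral_affine 0 t0 mG)//.
by apply: eq_integral => x _; rewrite addr0.
Qed.

End inverted_plancherel.

Section lebesgue4.
Variable R : realType.
(** A name for the product measure, to which a sigma-finite structure is attached so that Tonelli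
    applies to the six coordinates of G_2. *)
Definition lebesgue4 :
    set ((measurableTypeR R * measurableTypeR R) * (measurableTypeR R * measurableTypeR R)) -> \bar R :=
  (@lebesgue2 R \x @lebesgue2 R)%E.

HB.instance Definition _ := Measure.on (lebesgue4).

Lemma lebesgue4_sigma_finite : sigma_finite setT (lebesgue4).
Proof.
have /sigma_finiteP[F [TF ndF Foo]] := sigma_finiteT (@lebesgue2 R).
exists (fun n => F n `*` F n).
  rewrite -setXTT TF predeqE => -[x y]; split.
    move=> [/= [n _ Fnx] [k _ Fky]]; exists (maxn n k) => //; split.
    - by move: x Fnx; exact/subsetPset/ndF/leq_maxl.
    - by move: y Fky; exact/subsetPset/ndF/leq_maxr.
  by move=> [n _ []/= ? ?]; split; exists n.
move=> k; have [? ?] := Foo k; split; first exact: measurableX.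
by rewrite /lebesgue4 product_measure1E// lte_mul_pinfty// ge0_fin_numE.
Qed.

HB.instance Definition _ :=
  Measure_isSigmaFinite.Build _ _ _ (lebesgue4) (lebesgue4_sigma_finite).

Lemma lebesgue6_tonelli
  (L : ((measurableTypeR R * measurableTypeR R) * (measurableTypeR R * measurableTypeR R)) * (measurableTypeR R * measurableTypeR R) -> \bar R) :
  measurable_fun setT L -> (forall z, (0 <= L z)%E) ->
  (\int[(@lebesgue2 R \x @lebesgue2 R) \x @lebesgue2 R]_z L z =
   \int[@lebesgue2 R \x @lebesgue2 R]_A \int[@lebesgue2 R]_x L (A, x))%E.
Proof. by move=> mL L0; exact: (@fubini_tonelli1 _ _ _ _ R (lebesgue4) (@lebesgue2 R) L mL L0). Qed.

Lemma lebesgue6_tonelli2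
  (L : ((measurableTypeR R * measurableTypeR R) * (measurableTypeR R * measurableTypeR R)) * (measurableTypeR R * measurableTypeR R) -> \bar R) :
  measurable_fun setT L -> (forall z, (0 <= L z)%E) ->
  (\int[(@lebesgue2 R \x @lebesgue2 R) \x @lebesgue2 R]_z L z =
   \int[@lebesgue2 R]_x \int[@lebesgue2 R \x @lebesgue2 R]_A L (A, x))%E.
Proof. by move=> mL L0; exact: (@fubini_tonelli2 _ _ _ _ R (lebesgue4) (@lebesgue2 R) L mL L0). Qed.

End lebesgue4.

Lemma conjc_realM (R : rcfType) (r : R) (z : R[i]) : (r%:C%C * z)^*%C = r%:C%C * z^*%C.
Proof. by case: z => a b; apply/eqP; rewrite eq_complex /=; apply/andP; split; apply/eqP; ring. Qed.

Lemma measurable_sqrtr (R : realType) : measurable_fun setT (Num.sqrt : measurableTypeR R -> measurableTypeR R).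
Proof. by apply: continuous_measurable_fun; exact: sqrt_continuous. Qed.

Section orthogonality.
Variable R : realType.
Local Notation T := (measurableTypeR R).
Local Notation RR := (T * T)%type.
Local Notation leb := (@lebesgue_measure R).
Local Notation leb2 := (@lebesgue2 R).
Local Notation leb4 := (leb2 \x leb2)%E.

Definition nsq (p : RR) : R := p.1 ^+ 2 + p.2 ^+ 2.

(* A row p times the matrix with rows A.1 and A.2. *)
Definition lin (p : RR) (A : RR * RR) : RR :=
  (p.1 * A.1.1 + p.2 * A.2.1, p.1 * A.1.2 + p.2 * A.2.2).

(** The second row of gamma(p)^-1, of which p is the first row. *)
Definition rot90 (p : RR) : RR := (- p.2, p.1).

Definition cross (w q : RR) : R := w.1 * q.2 - w.2 * q.1.

(* u_{p,A} and v_{p,A} are the coordinates of q = (rot90 p) A with respect to w = pA. *)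
Definition ucoord (w q : RR) : R := (q.1 * w.1 + q.2 * w.2) / nsq w.

Definition vcoord (w q : RR) : R := cross w q / nsq w.

Definition detA (A : RR * RR) : R := cross A.1 A.2.

Lemma nsq_ge0 p : 0 <= nsq p. Proof. by rewrite addr_ge0 ?sqr_ge0. Qed.

Lemma nsq_gt0 p : p.1 != 0 -> 0 < nsq p.
Proof. by move=> p0; rewrite ltr_pwDl ?sqr_ge0// lt0r sqrf_eq0 p0 sqr_ge0. Qed.

Lemma ae_fst_neq0 : {ae leb2, forall p : RR, p.1 != 0}.
Proof.
have m0 : measurable ([set 0] `*` setT : set RR) by apply: measurableX => //; exact: measurable_set1.
exists ([set 0] `*` setT); split => //.
  rewrite /lebesgue2 product_measure1E//.
  by rewrite [X in (X * _)%E]lebesgue_measure_set1 mul0e.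
by move=> p /= /negP; rewrite negbK => /eqP.
Qed.

Variables f e : RR * T -> R[i].
Hypotheses (mf : cmeasurable f) (me : cmeasurable e).
Hypothesis foo : forall p, (\int[leb]_t (`|t|^-1 * csq (f (p, t)))%:E < +oo)%E.
Hypothesis eoo : forall w, (\int[leb]_t (`|t|^-1 * csq (e (w, t)))%:E < +oo)%E.

(* The inner product over t in R^* of F[0, gamma p] with the section of E at w = pA, for
   z = ((p, w), (u, v)). *)
Definition Jint (z : (RR * RR) * RR) : R[i] :=
  cintegral leb (fun t : T => expi (- (2 * pi * (t^-1 * z.2.1))) *
    ((`|t|^-1)%:C%C * (f (z.1.1, t) * (e (z.1.2, z.2.2^-1 * t))^*%C))).

Definition Jfun (p : RR) (A : RR * RR) : R[i] :=
  Jint ((p, lin p A), (ucoord (lin p A) (lin (rot90 p) A), vcoord (lin p A) (lin (rot90 p) A))).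

Definition Vscale (p : RR) (A : RR * RR) : R :=
  Num.sqrt `|detA A| * Num.sqrt (nsq p) / Num.sqrt (nsq (lin p A)).

(** [Vscale] is the scalar factor of sigma; |p|^-2 is the density of the Haar measure of K in the
    coordinates p. *)
Definition Vweight (p : RR) (A : RR * RR) : R := (nsq p)^-1 * Vscale p A.

(* The wavelet coefficient at [x, A], where z = (A, x). *)
Definition Vfun (z : (RR * RR) * RR) : R[i] :=
  fourier2 (fun p => (Vweight p z.1)%:C%C * Jfun p z.1) z.2.

Lemma cmeasurable_Jint : cmeasurable Jint.
Proof.
pose G (y : ((RR * RR) * RR) * T) : R[i] := expi (- (2 * pi * (y.2^-1 * y.1.2.1))) *
    ((`|y.2|^-1)%:C%C * (f (y.1.1.1, y.2) * (e (y.1.1.2, y.1.2.2^-1 * y.2))^*%C)).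
apply: (@cmeasurable_parametric_cintegral _ _ _ _ _ leb G); rewrite /G.
apply: cmeasurableM; first by apply: cmeasurable_expi; mfun.
apply: cmeasurableM; first by apply: cmeasurable_real; mfun.
apply: cmeasurableM; first by apply: (cmeasurable_comp mf); mfun.
by apply: cmeasurable_conj; apply: (cmeasurable_comp me); mfun.
Qed.

Lemma cmeasurable_integrand (p w : RR) (v : R) :
  cmeasurable (fun t : T => f (p, t) * (e (w, v^-1 * t))^*%C).
Proof.
apply: cmeasurableM; first by apply: (cmeasurable_comp mf); mfun.
by apply: cmeasurable_conj; apply: (cmeasurable_comp me); mfun.
Qed.

(** The weight 1/|t| is split into two square roots, which leaves a product of two square-integrable
    functions; the dilation by v preserves dt/|t|. *)
Lemma cintegrable_integrand (p w : RR) (v : R) : v != 0 ->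
  cintegrable leb (fun t : T => (`|t|^-1)%:C%C * (f (p, t) * (e (w, v^-1 * t))^*%C)).
Proof.
move=> v0.
have mt : measurable_fun setT (fun t : T => Num.sqrt `|t|^-1).
  by apply: (measurableT_comp (@measurable_sqrtr R)); mfun.
have ma : cmeasurable (fun t : T => (Num.sqrt `|t|^-1)%:C%C * f (p, t)).
  by apply: cmeasurableM; [exact: cmeasurable_real|apply: (cmeasurable_comp mf); mfun].
have mb : cmeasurable (fun t : T => (Num.sqrt `|t|^-1)%:C%C * e (w, v^-1 * t)).
  by apply: cmeasurableM; [exact: cmeasurable_real|apply: (cmeasurable_comp me); mfun].
have t0 (t : R) : 0 <= `|t|^-1 by rewrite invr_ge0.
have := cintegrableM_conj ma mb (mu := leb).
have -> : (fun t : T => (Num.sqrt `|t|^-1)%:C%C * f (p, t) * ((Num.sqrt `|t|^-1)%:C%C * e (w, v^-1 * t))^*%C) =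
    (fun t : T => (`|t|^-1)%:C%C * (f (p, t) * (e (w, v^-1 * t))^*%C)).
  apply/funext => t; rewrite conjc_realM mulrACA -rmorphM/=; congr (_%:C%C * _).
  by rewrite -expr2 sqr_sqrtr.
apply.
- under eq_integral do rewrite csqM csq_real sqr_sqrtr//.
  exact: foo.
- under eq_integral do rewrite csqM csq_real sqr_sqrtr//.
  pose H (s : T) : \bar R := (`|s|^-1 * csq (e (w, s)))%:E.
  have mH : measurable_fun setT H.
    apply/measurable_EFinP; apply: measurable_funM; first by mfun.
    by apply: measurable_csq; apply: (cmeasurable_comp me); mfun.
  have H0 s : (0 <= H s)%E by rewrite lee_fin mulr_ge0 ?csq_ge0.
  rewrite (eq_integral (fun t : T => ((`|v|^-1)%:E * H (v^-1 * t + 0)%R)%E)); last first.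
    move=> t _; rewrite /H addr0 -EFinM mulrA normrM invfM normfV invrK mulrA mulVf ?mul1r//.
    by rewrite normr_eq0.
  rewrite ge0_integralZl_EFin//; last first.
    by apply: (measurableT_comp mH); mfun.
  rewrite (ge0_integral_affine 0 (invr_neq0 v0) mH)// !lte_mul_pinfty ?lee_fin//.
  exact: eoo.
Qed.

Lemma integral_csq_Jint (p w : RR) (v : R) : v != 0 ->
  (\int[leb]_u (csq (Jint ((p, w), (u, v))))%:E =
   \int[leb]_t (csq (f (p, t)) * csq (e (w, v^-1 * t)))%:E)%E.
Proof.
move=> v0; rewrite (plancherel_inv (cmeasurable_integrand p w v) (cintegrable_integrand p w v0)).
by apply: eq_integral => t _; rewrite csqM csq_conj.
Qed.

(** Plancherel in u has replaced dt/|t| by dt. The substitution nu = t/v in v^-2 dv produces the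
    factor 1/|t|, which restores the Haar measure for f and leaves dnu for e. *)
Lemma integral2_csq_Jint (p w : RR) :
  (\int[leb2]_z (((z.2 ^+ 2)^-1 * csq (Jint ((p, w), z)))%:E) =
   (\int[leb]_t (`|t|^-1 * csq (f (p, t)))%:E) * \int[leb]_t (csq (e (w, t)))%:E)%E.
Proof.
have mJ : measurable_fun setT (fun z : RR => csq (Jint ((p, w), z))).
  by apply: measurable_csq; apply: (cmeasurable_comp cmeasurable_Jint); mfun.
have mfc : measurable_fun setT (fun t : T => csq (f (p, t))).
  by apply: measurable_csq; apply: (cmeasurable_comp mf); mfun.
have mec : measurable_fun setT (fun t : T => csq (e (w, t))).
  by apply: measurable_csq; apply: (cmeasurable_comp me); mfun.
rewrite lebesgue2_tonelli2; last 2 first.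
- by apply/measurable_EFinP; apply: measurable_funM => //; mfun.
- by move=> z; rewrite lee_fin mulr_ge0 ?csq_ge0 ?invr_ge0 ?sqr_ge0.
pose K (z : T * T) : \bar R := ((z.1 ^+ 2)^-1 * (csq (f (p, z.2)) * csq (e (w, z.1^-1 * z.2))))%:E.
have mK : measurable_fun setT K.
  apply/measurable_EFinP; apply: measurable_funM; first by mfun.
  apply: measurable_funM; first by apply: (measurableT_comp mfc); mfun.
  by apply: (measurableT_comp mec); mfun.
have K0 z : (0 <= K z)%E by rewrite lee_fin !mulr_ge0 ?csq_ge0 ?invr_ge0 ?sqr_ge0.
transitivity (\int[leb]_v \int[leb]_t K (v, t))%E.
  (* At v = 0 both sides vanish because the inverse of 0 is 0. *)
  apply: eq_integral => v _; have [->|v0] := eqVneq v 0.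
    rewrite !integral0_eq// => x _; rewrite /K /=.
      by rewrite expr0n invr0 mul0r.
    by rewrite expr0n invr0 mul0r.
  under eq_integral do rewrite EFinM/=.
  rewrite ge0_integralZl_EFin//; last 3 first.
  - by move=> u _; rewrite lee_fin csq_ge0.
  - by apply/measurable_EFinP; apply: (measurableT_comp mJ); mfun.
  - by rewrite invr_ge0 sqr_ge0.
  rewrite integral_csq_Jint// -ge0_integralZl_EFin//.
  - by move=> t _; rewrite lee_fin mulr_ge0 ?csq_ge0.
  - apply/measurable_EFinP; apply: measurable_funM => //.
    by apply: (measurableT_comp mec); mfun.
  - by rewrite invr_ge0 sqr_ge0.
rewrite -(lebesgue2_tonelli mK K0) (lebesgue2_tonelli2 mK K0).
rewrite -ge0_integralZr//; last 3 first.
- by apply/measurable_EFinP; apply: measurable_funM => //; mfun.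
- by move=> t _; rewrite lee_fin mulr_ge0 ?csq_ge0 ?invr_ge0.
- by apply: integral_ge0 => t _; rewrite lee_fin csq_ge0.
have ne0 : {ae leb, forall t : T, t != 0}.
  exists [set 0]; split; [exact: measurable_set1|exact: lebesgue_measure_set1|].
  by move=> t /= /negP; rewrite negbK => /eqP.
apply: ae_eq_integral => //.
- exact: (measurable_parametric_integral leb (G := fun z : T * T => K (z.2, z.1)) (measurableT_comp mK (measurable_fun_pair measurable_snd measurable_fst))).
- apply: emeasurable_funM; last exact: measurable_cst.
  by apply/measurable_EFinP; apply: measurable_funM => //; mfun.
- apply: filterS ne0 => t t0 _.
  rewrite mulrC EFinM -muleA -(ge0_integral_dilate_inv t0 (G := fun s => (csq (e (w, s)))%:E)); last 2 first.
  + exact/measurable_EFinP.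
  + by move=> x; rewrite lee_fin csq_ge0.
  rewrite -ge0_integralZl_EFin ?csq_ge0//.
  + by apply: eq_integral => v _; rewrite /K/= -!EFinM mulrCA.
  + by move=> x _; rewrite -EFinM lee_fin mulr_ge0 ?csq_ge0 ?invr_ge0 ?sqr_ge0.
  + apply: emeasurable_funM; first by mfun.
    apply/measurable_EFinP; apply: (measurableT_comp mec).
    by apply: measurable_funM; [exact: measurable_inv|exact: measurable_cst].
Qed.

(** The determinant of gamma(p)^-1 A, as gamma(p)^-1 has determinant |p|^2. *)
Lemma cross_lin p A : cross (lin p A) (lin (rot90 p) A) = nsq p * detA A.
Proof. by rewrite /cross /lin /rot90 /nsq /detA /cross /=; ring. Qed.

Lemma measurable_coords : measurable_fun setT (fun B : RR * RR => (ucoord B.1 B.2, vcoord B.1 B.2)).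
Proof. by rewrite /ucoord /vcoord /cross /nsq; mfun. Qed.

Lemma measurable_csq_Jint_coords (p : RR) : measurable_fun setT
  (fun B : RR * RR => csq (Jint ((p, B.1), (ucoord B.1 B.2, vcoord B.1 B.2)))).
Proof.
apply: measurable_csq; apply: (cmeasurable_comp cmeasurable_Jint).
apply: measurable_fun_pair; last exact: measurable_coords.
by mfun.
Qed.

(** For fixed w, the map q -> (u, v) is linear of determinant |w|^-2, and [cross w q] is |w|^2 v.
    Hence a factor |w|^-4 from the cross product, while the Jacobian |w|^2 cancels the other
    weight. *)
Lemma integral_coords (p w : RR) :
  (\int[leb2]_q ((cross w q ^+ 2)^-1 * ((nsq w)^-1 *
     csq (Jint ((p, w), (ucoord w q, vcoord w q)))))%:E =
   ((nsq w ^+ 2)^-1)%:E * \int[leb2]_z ((z.2 ^+ 2)^-1 * csq (Jint ((p, w), z)))%:E)%E.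
Proof.
have mJ : measurable_fun setT (fun z : RR => csq (Jint ((p, w), z))).
  by apply: measurable_csq; apply: (cmeasurable_comp cmeasurable_Jint); mfun.
have [w0|w0] := eqVneq (nsq w) 0.
  rewrite w0 expr0n invr0 mul0e integral0_eq// => q _.
  by rewrite mul0r mulr0.
pose G (z : RR) : \bar R := ((((nsq w) ^+ 2)^-1 * (nsq w)^-1)%:E * ((z.2 ^+ 2)^-1 * csq (Jint ((p, w), z)))%:E)%E.
have mG0 : measurable_fun setT (fun z : RR => ((z.2 ^+ 2)^-1 * csq (Jint ((p, w), z)))%:E).
  by apply/measurable_EFinP; apply: measurable_funM => //; mfun.
have G00 (z : RR) : (0 <= ((z.2 ^+ 2)^-1 * csq (Jint ((p, w), z)))%:E)%E.
  by rewrite lee_fin mulr_ge0 ?csq_ge0 ?invr_ge0 ?sqr_ge0.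
have c0 : 0 <= (nsq w ^+ 2)^-1 * (nsq w)^-1 by rewrite mulr_ge0 ?invr_ge0 ?sqr_ge0 ?nsq_ge0.
have mG : measurable_fun setT G by apply: emeasurable_funM => //; exact: measurable_cst.
have GE q : ((cross w q ^+ 2)^-1 * ((nsq w)^-1 * csq (Jint ((p, w), (ucoord w q, vcoord w q)))))%:E =
    G (w.1 / nsq w * q.1 + w.2 / nsq w * q.2, - w.2 / nsq w * q.1 + w.1 / nsq w * q.2).
  have -> : w.1 / nsq w * q.1 + w.2 / nsq w * q.2 = ucoord w q.
    by rewrite /ucoord mulrDl [in LHS]mulrAC [w.2 / _ * _]mulrAC (mulrC w.1) (mulrC w.2).
  have vE : - w.2 / nsq w * q.1 + w.1 / nsq w * q.2 = vcoord w q.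
    by rewrite /vcoord /cross mulrDl addrC !mulNr ![in LHS](mulrAC _ _ (q.1)) ![in LHS](mulrAC _ _ (q.2)).
  rewrite vE /G -EFinM /=; congr (_%:E).
  have -> : (cross w q ^+ 2)^-1 = (nsq w ^+ 2)^-1 * (vcoord w q ^+ 2)^-1.
    by rewrite -invfM -exprMn mulrC /vcoord divfK.
  by rewrite -!mulrA; congr (_ * _); rewrite mulrCA.
have D0 : w.1 / nsq w * (w.1 / nsq w) - w.2 / nsq w * (- w.2 / nsq w) = (nsq w)^-1.
  rewrite mulNr mulrN opprK mulrACA [_ / _ * (w.2 / _)]mulrACA -mulrDl -!expr2 -/(nsq w).
  by rewrite expr2 mulrA mulfV// mul1r.
under eq_integral do rewrite GE.
rewrite (ge0_integral_linear2 (h := G)) ?D0 ?invr_neq0//; last first.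
  by move=> z; rewrite mule_ge0// lee_fin.
rewrite ge0_integralZl_EFin// muleA -EFinM; congr (_%:E * _)%E.
rewrite normfV invrK ger0_norm ?nsq_ge0// mulrCA mulfV// mulr1.
by [].
Qed.

(** The new variables are the rows w and q of gamma(p)^-1 A. The Jacobian |p|^-4 of this left
    multiplication cancels the |p|^4 that arises when det A is expressed by [cross w q]. *)
Lemma integral_csq_Jfun (p : RR) : p.1 != 0 ->
  (\int[leb4]_A (((detA A) ^+ 2)^-1 * ((nsq (lin p A))^-1 * csq (Jfun p A)))%:E =
   (\int[leb]_t (`|t|^-1 * csq (f (p, t)))%:E) *
   \int[leb2]_w (((nsq w ^+ 2)^-1)%:E * \int[leb]_t (csq (e (w, t)))%:E))%E.
Proof.
move=> p0; have n0 := nsq_gt0 p0.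
pose H0 (B : RR * RR) : R := (cross B.1 B.2 ^+ 2)^-1 * ((nsq B.1)^-1 *
  csq (Jint ((p, B.1), (ucoord B.1 B.2, vcoord B.1 B.2)))).
have H0_ge0 B : 0 <= H0 B by rewrite !mulr_ge0 ?csq_ge0 ?invr_ge0 ?sqr_ge0 ?nsq_ge0.
have mH0 : measurable_fun setT (EFin \o H0).
  apply/measurable_EFinP; apply: measurable_funM; first by rewrite /cross; mfun.
  by apply: measurable_funM; [rewrite /nsq; mfun|exact: measurable_csq_Jint_coords].
pose H (B : RR * RR) : \bar R := ((nsq p ^+ 2)%:E * (H0 B)%:E)%E.
have HE A : ((detA A ^+ 2)^-1 * ((nsq (lin p A))^-1 * csq (Jfun p A)))%:E =
    H (rows_mul p.1 p.2 (- p.2) p.1 A).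
  have -> : rows_mul p.1 p.2 (- p.2) p.1 A = (lin p A, lin (rot90 p) A) by [].
  rewrite /H -EFinM /H0 /= cross_lin.
  congr (_%:E); rewrite [RHS]mulrA; congr (_ * _).
  by rewrite (exprMn _ (nsq p)) (invfM (nsq p ^+ 2)) mulrA divff ?mul1r// expf_neq0// gt_eqF.
under eq_integral do rewrite HE.
have D0 : p.1 * p.1 - p.2 * - p.2 = nsq p by rewrite mulrN opprK -!expr2.
rewrite ge0_integral_rows_mul ?D0 ?gt_eqF//; last 2 first.
- by apply: emeasurable_funM => //; exact: measurable_cst.
- by move=> z; rewrite mule_ge0 ?lee_fin ?sqr_ge0.
rewrite ge0_integralZl_EFin ?sqr_ge0//; last by move=> z _; rewrite lee_fin.
rewrite muleA -EFinM mulVf ?expf_neq0 ?gt_eqF// mul1e.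
rewrite lebesgue4_tonelli//.
have me2 : measurable_fun setT (fun w => \int[leb]_t (csq (e (w, t)))%:E)%E.
  apply: (measurable_parametric_integral leb (G := fun z => (csq (e z))%:E)).
  by apply/measurable_EFinP; exact: measurable_csq.
have ie0 w : (0 <= \int[leb]_t (csq (e (w, t)))%:E)%E.
  by apply: integral_ge0 => t _; rewrite lee_fin csq_ge0.
rewrite -ge0_integralZl//; last 3 first.
- apply: emeasurable_funM => //; rewrite /nsq; mfun.
- by move=> w _; rewrite mule_ge0 ?lee_fin ?invr_ge0 ?sqr_ge0.
- by apply: integral_ge0 => t _; rewrite lee_fin mulr_ge0 ?csq_ge0 ?invr_ge0.
apply: eq_integral => w _.
by rewrite /H0/= integral_coords integral2_csq_Jint muleCA.
Qed.

(** Powers: (|p|^-4 |det A| |p|^2 |pA|^-2) |det A|^-3. What remains is the density |p|^-2 for the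
    norm of F and the weight integrated in [integral_csq_Jfun]. *)
Lemma Vweight_sqr (p : RR) (A : RR * RR) :
  Vweight p A ^+ 2 * (`|detA A| * `|detA A| ^+ 2)^-1 =
  (nsq p)^-1 * ((detA A ^+ 2)^-1 * (nsq (lin p A))^-1).
Proof.
have [D0|D0] := eqVneq (detA A) 0.
  by rewrite D0 normr0 mul0r invr0 expr0n invr0 mul0r !mulr0.
have [p0|p0] := eqVneq (nsq p) 0.
  by rewrite /Vweight p0 invr0 !mul0r expr0n mul0r.
rewrite /Vweight /Vscale !exprMn exprVn !sqr_sqrtr ?nsq_ge0// exprVn sqr_sqrtr ?nsq_ge0//.
rewrite real_normK ?num_real// invfM expr2 invfM.
have nD : `|detA A| != 0 by rewrite normr_eq0.
move: (nsq (lin p A))^-1 (nsq p) p0 (`|_|) nD ((detA A ^+ 2)^-1) => a b b0 c c0 g.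
by field; rewrite b0 c0.
Qed.

Lemma cmeasurable_Jfun : cmeasurable (fun z : (RR * RR) * RR => Jfun z.2 z.1).
Proof.
rewrite /Jfun.
have mr : measurable_fun setT (fun z : (RR * RR) * RR => lin (rot90 z.2) z.1) by rewrite /lin /rot90; mfun.
have ml : measurable_fun setT (fun z : (RR * RR) * RR => lin z.2 z.1) by rewrite /lin; mfun.
apply: (cmeasurable_comp cmeasurable_Jint); apply: measurable_fun_pair; first by mfun.
exact: (measurableT_comp measurable_coords (measurable_fun_pair ml mr)).
Qed.

Lemma measurable_Vweight : measurable_fun setT (fun z : (RR * RR) * RR => Vweight z.2 z.1).
Proof.
have ms := @measurable_sqrtr R.
rewrite /Vweight /Vscale; apply: measurable_funM; first by rewrite /nsq; mfun.
apply: measurable_funM; first apply: measurable_funM.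
- by apply: (measurableT_comp ms); rewrite /detA /cross; mfun.
- by apply: (measurableT_comp ms); rewrite /nsq; mfun.
- by apply: measurable_fun_inv; apply: (measurableT_comp ms); rewrite /nsq /lin; mfun.
Qed.

Lemma cmeasurable_Vfun : cmeasurable Vfun.
Proof.
pose G (z : ((RR * RR) * RR) * RR) : R[i] :=
  expi (- (2 * pi * (z.2.1 * z.1.2.1 + z.2.2 * z.1.2.2))) *
  ((Vweight z.2 z.1.1)%:C%C * Jfun z.2 z.1.1).
apply: (@cmeasurable_parametric_cintegral _ _ _ _ _ leb2 G); rewrite /G.
have mz : measurable_fun setT (fun z : ((RR * RR) * RR) * RR => (z.1.1, z.2)) by mfun.
apply: cmeasurableM; first by apply: cmeasurable_expi; mfun.
apply: cmeasurableM; first by apply: cmeasurable_real; exact: (measurableT_comp measurable_Vweight mz).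
exact: (cmeasurable_comp cmeasurable_Jfun mz).
Qed.

Lemma scalar_orthogonality :
  (forall A, detA A != 0 -> cintegrable leb2 (fun p => (Vweight p A)%:C%C * Jfun p A)) ->
  (\int[leb4 \x leb2]_z (csq (Vfun z) * (`|detA z.1| * `|detA z.1| ^+ 2)^-1)%:E =
   (\int[leb2]_p (((nsq p)^-1)%:E * \int[leb]_t (`|t|^-1 * csq (f (p, t)))%:E)) *
   \int[leb2]_w (((nsq w ^+ 2)^-1)%:E * \int[leb]_t (csq (e (w, t)))%:E))%E.
Proof.
move=> hint.
have w0 A : 0 <= (`|detA A| * `|detA A| ^+ 2)^-1 by rewrite invr_ge0 mulr_ge0.
have mdet : measurable_fun setT detA by rewrite /detA /cross; mfun.
have mw : measurable_fun setT (fun A => (`|detA A| * `|detA A| ^+ 2)^-1).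
  apply: measurable_fun_inv; have mn : measurable_fun setT (fun A => `|detA A|) by exact: measurableT_comp.
  by apply: measurable_funM => //; exact: measurable_funX.
have mV := measurable_csq cmeasurable_Vfun.
pose L (z : (RR * RR) * RR) : \bar R := (csq (Vfun z) * (`|detA z.1| * `|detA z.1| ^+ 2)^-1)%:E.
have mL : measurable_fun setT L.
  apply/measurable_EFinP; apply: measurable_funM => //.
  exact: (measurableT_comp mw measurable_fst).
have L0 z : (0 <= L z)%E by rewrite lee_fin mulr_ge0 ?csq_ge0.
transitivity (\int[leb4]_A \int[leb2]_x L (A, x))%E.
  exact: lebesgue6_tonelli.
pose K (z : (RR * RR) * RR) : \bar R :=
  ((nsq z.2)^-1 * ((detA z.1 ^+ 2)^-1 * ((nsq (lin z.2 z.1))^-1 * csq (Jfun z.2 z.1))))%:E.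
have mK : measurable_fun setT K.
  apply/measurable_EFinP; apply: measurable_funM; first by rewrite /nsq; mfun.
  apply: measurable_funM; first by apply: measurable_fun_inv; apply: measurable_funX;
    exact: (measurableT_comp mdet measurable_fst).
  apply: measurable_funM; first by rewrite /nsq /lin; mfun.
  exact: measurable_csq cmeasurable_Jfun.
have K0 z : (0 <= K z)%E by rewrite lee_fin !mulr_ge0 ?csq_ge0 ?invr_ge0 ?sqr_ge0 ?nsq_ge0.
transitivity (\int[leb4]_A \int[leb2]_p K (A, p))%E.
  apply: eq_integral => A _; rewrite /L/=.
  (* For singular A both densities are 0, so [hint] is called for invertible A only. *)
  have [D0|D0] := eqVneq (detA A) 0.
    rewrite !integral0_eq// => x _; rewrite /K /= D0.
      by rewrite expr0n invr0 mul0r mulr0.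
    by rewrite normr0 mul0r invr0 mulr0.
  under eq_integral do rewrite mulrC EFinM.
  have mVA : measurable_fun setT (fun x : RR => (csq (Vfun (A, x)))%:E).
    by apply/measurable_EFinP; apply: (measurableT_comp mV); mfun.
  rewrite ge0_integralZl_EFin//; last by move=> x _; rewrite lee_fin csq_ge0.
  pose h p : R[i] := (Vweight p A)%:C%C * Jfun p A.
  have mh : measurable_fun setT (fun p => (csq (h p))%:E).
    by apply/measurable_EFinP; exact: measurable_csq (cintegrable_cmeasurable (hint A D0)).
  have h0 p : setT p -> (0 <= (csq (h p))%:E)%E by move=> _; rewrite lee_fin csq_ge0.
  transitivity ((`|detA A| * `|detA A| ^+ 2)^-1%:E * \int[leb2]_p (csq (h p))%:E)%E.
    by congr (_ * _)%E; exact: (plancherel2 (hint A D0)).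
  rewrite -(ge0_integralZl_EFin leb2 measurableT h0 mh (w0 A)).
  apply: eq_integral => p _; rewrite csqM csq_real -EFinM mulrA [X in X * _]mulrC Vweight_sqr.
  by rewrite /K /= !mulrA.
rewrite -(lebesgue6_tonelli mK K0) (lebesgue6_tonelli2 mK K0).
have me2 : measurable_fun setT (fun w => \int[leb]_t (csq (e (w, t)))%:E)%E.
  apply: (measurable_parametric_integral leb (G := fun z => (csq (e z))%:E)).
  by apply/measurable_EFinP; exact: measurable_csq.
have mf2 : measurable_fun setT (fun p => \int[leb]_t (`|t|^-1 * csq (f (p, t)))%:E)%E.
  apply: (measurable_parametric_integral leb (G := fun z => (`|z.2|^-1 * csq (f z))%:E)).
  apply/measurable_EFinP; apply: measurable_funM; first by mfun.
  exact: measurable_csq.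
have f20 p : (0 <= \int[leb]_t (`|t|^-1 * csq (f (p, t)))%:E)%E.
  by apply: integral_ge0 => t _; rewrite lee_fin mulr_ge0 ?csq_ge0 ?invr_ge0.
have mn : measurable_fun setT (fun p : RR => ((nsq p)^-1)%:E) by rewrite /nsq; mfun.
rewrite -ge0_integralZr//; last 3 first.
- exact: emeasurable_funM.
- by move=> p _; rewrite mule_ge0 ?lee_fin ?invr_ge0 ?nsq_ge0.
- apply: integral_ge0 => w _; rewrite mule_ge0 ?lee_fin ?invr_ge0 ?sqr_ge0//.
  by apply: integral_ge0 => t _; rewrite lee_fin csq_ge0.
apply: ae_eq_integral => //.
- have mKs : measurable_fun setT (fun z : RR * (RR * RR) => K (z.2, z.1)).
    by apply: (measurableT_comp mK); exact: measurable_fun_pair.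
  have t := (@measurable_parametric_integral _ _ _ _ R (@lebesgue4 R) (fun z : RR * (RR * RR) => K (z.2, z.1)) mKs).
  exact t.
- by apply: emeasurable_funM; [exact: emeasurable_funM|exact: measurable_cst].
- apply: filterS ae_fst_neq0 => p p0 _.
  rewrite -muleA -integral_csq_Jfun// -ge0_integralZl_EFin ?invr_ge0 ?nsq_ge0//.
  + by move=> A _; rewrite lee_fin !mulr_ge0 ?csq_ge0 ?invr_ge0 ?sqr_ge0 ?nsq_ge0.
  + apply/measurable_EFinP; apply: measurable_funM; first by apply: measurable_fun_inv; exact: measurable_funX.
    apply: measurable_funM; first by rewrite /nsq /lin; mfun.
    by apply: measurable_csq; apply: (cmeasurable_comp cmeasurable_Jfun (f := fun A => (A, p))); mfun.
Qed.

End orthogonality.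

Lemma ae_cintegrable d (X : measurableType d) (R : realType) (mu : {measure set X -> \bar R})
    (h k : X -> R[i]) : cintegrable mu h -> cmeasurable k ->
  (\forall x \ae mu, h x = k x) -> cintegrable mu k.
Proof.
move=> [h1 h2] [k1 k2] hk.
have aux (p : R[i] -> R) : mu.-integrable setT (EFin \o (p \o h)) ->
    measurable_fun setT (p \o k) -> mu.-integrable setT (EFin \o (p \o k)).
  move=> /integrableP[mh hoo] mk; apply/integrableP; split; first exact/measurable_EFinP.
  apply: le_lt_trans hoo; rewrite le_eqVlt; apply/orP; left; apply/eqP.
  apply: ae_eq_integral => //; try by apply: measurableT_comp => //; exact/measurable_EFinP.
  by apply: filterS hk => x /= -> _.
by split; exact: aux.
Qed.

Lemma strongly_measurable_comp d1 d2 (X : measurableType d1) (Y : measurableType d2) (R : realType)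
    (V : lmodType R[i]) (dot : {dot V for @conjc R}) (F : Y -> V) (phi : X -> Y) :
  measurable_fun setT phi -> strongly_measurable dot F -> strongly_measurable dot (F \o phi).
Proof.
move=> mphi [s [ms sF]].
have sfin n : finite_set (range (s n \o phi)).
  by apply: (@sub_finite_set _ _ (range (s n))) => // _ [x _ <-]; exists (phi x).
pose s' n : {fimfun X >-> V} := HB.pack (s n \o phi) (FiniteImage.Build X V (s n \o phi) (sfin n)).
exists s'; split => [n v|x]; last exact: sF.
by have := mphi measurableT _ (ms n v); rewrite setTI.
Qed.

(** * Coordinates on K and on the affine group *)

Section charts.
Variable R : realType.
Local Notation T := (measurableTypeR R).
Local Notation RR := (T * T)%type.
Local Notation leb := (@lebesgue_measure R).
Local Notation leb2 := (@lebesgue2 R).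

Lemma measurable_rstar : measurable_fun setT (@rstar R).
Proof.
apply: (@measurable_insubd _ _ _ _ T _ (Rstar R) (Rstar R) id) => //.
rewrite (_ : [set _ | _] = ~` [set 0]); last by apply/seteqP; split=> x /eqP.
by apply: measurableC; exact: measurable_set1.
Qed.

Lemma measurable_norminv : measurable_fun setT (fun t : T => `|t|^-1).
Proof. by mfun. Qed.

Lemma norminv_ge0 (t : T) : 0 <= `|t|^-1.
Proof. by rewrite invr_ge0. Qed.

Lemma mu_RstarE (B : set (Rstar R)) : measurable B ->
  @mu_Rstar R B = weighted_image leb (fun t => `|t|^-1) (@rstar R) B.
Proof. by []. Qed.

Lemma ge0_integral_Rstar (f : Rstar R -> \bar R) : measurable_fun setT f -> (forall t, (0 <= f t)%E) ->
  (\int[@mu_Rstar R]_t f t = \int[leb]_t (f (rstar t) * (`|t|^-1)%:E))%E.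
Proof.
exact: (@ge0_integral_weighted_image _ _ T (Rstar R) R leb _ _ _ measurable_rstar
  measurable_norminv norminv_ge0 mu_RstarE).
Qed.

Lemma val_rstar (t : R) : t != 0 -> val (rstar t) = t.
Proof. by move=> t0; rewrite /rstar insubdK. Qed.

Lemma ae_neq0 : {ae leb, forall t : T, t != 0}.
Proof.
exists [set 0]; split; [exact: measurable_set1|exact: lebesgue_measure_set1|].
by move=> t /= /negP; rewrite negbK => /eqP.
Qed.

Lemma ae_mu_Rstar (P : Rstar R -> Prop) :
  (\forall t \ae @mu_Rstar R, P t) -> \forall t \ae leb, P (rstar t).
Proof.
move=> aeP; have := weighted_image_ae measurable_rstar measurable_norminv norminv_ge0 mu_RstarE aeP.
by move=> h; apply: filterS2 ae_neq0 h => t t0; apply; rewrite invr_gt0 normr_gt0.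
Qed.

Lemma ae_affine (a : R) (P : R -> Prop) : a != 0 ->
  (\forall t \ae leb, P t) -> \forall t \ae leb, P (a * t).
Proof.
move=> a0 [N [mN N0 NP]].
have mI : measurable_fun setT (fun y : T => (\1_N y)%:E : \bar R) by apply/measurable_EFinP.
have ma : measurable_fun setT (fun t : T => a * t + 0 : T) by mfun.
have I0 (x : T) : (0 <= (\1_N x)%:E :> \bar R)%E by rewrite lee_fin.
have := ge0_integral_affine 0 a0 mI I0; rewrite [X in _ = (_ * X)%E](_ : _ = 0%E) ?mule0; last first.
  by rewrite [LHS]integral_indic// setIT; exact: N0.
rewrite (eq_integral (fun x : T => `|(\1_N (a * x + 0))%:E|)%E); last first.
  by move=> x _; rewrite gee0_abs.
move/(ae_eq_integral_abs _ measurableT (measurableT_comp mI ma)); apply: filterS => x /(_ I) /=.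
rewrite addr0 indicE => x0; apply: contrapT => nP.
have Nx : N (a * x) by exact: NP.
by move: x0; rewrite mem_set// => -[] /eqP; rewrite oner_eq0.
Qed.

Definition kap (p : RR) : K R := kappa (rvec2 p).

Lemma sqr_enorm (w : 'rV[R]_2) : enorm w ^+ 2 = w 0 0 ^+ 2 + w 0 1 ^+ 2.
Proof. by rewrite sqr_sqrtr// addr_ge0// sqr_ge0. Qed.

Lemma sqr_enorm_rvec2 (p : RR) : enorm (rvec2 p) ^+ 2 = nsq p.
Proof. by rewrite sqr_enorm !mxE. Qed.

Lemma enorm_rvec2 (p : RR) : enorm (rvec2 p) = Num.sqrt (nsq p).
Proof. by rewrite -sqr_enorm_rvec2 sqrtr_sqr ger0_norm// sqrtr_ge0. Qed.

Lemma nsq_eq0 (p : RR) : nsq p = 0 -> p = (0, 0).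
Proof.
case: p => a b /eqP; rewrite /nsq paddr_eq0 ?sqr_ge0// !sqrf_eq0 => /andP[/eqP + /eqP].
by move=> /= -> ->.
Qed.

Lemma rvec2_eq0 (p : RR) : (rvec2 p == 0) = (nsq p == 0).
Proof.
apply/eqP/eqP => [p0|/nsq_eq0 ->]; first by rewrite -sqr_enorm_rvec2 p0 sqr_enorm !mxE expr0n addr0.
by apply/rowP => j; rewrite !mxE; case: ifP.
Qed.

Lemma measurable_sqr_enorm : measurable_fun setT (fun w : 'rV[R]_2 => enorm w ^+ 2).
Proof.
under eq_fun do rewrite sqr_enorm.
by apply: measurable_funD; apply: measurable_funX; exact: measurable_entry.
Qed.

Lemma measurable_gamma : measurable_fun setT (@gamma R).
Proof.
apply: measurable_matrix => i j; under eq_fun do rewrite mxE.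
apply: measurable_funM; first exact: (measurable_fun_inv measurable_sqr_enorm).
under eq_fun do rewrite mxE.
by case: (i == 0); case: (j == 0); do ?apply: measurable_funN; exact: measurable_entry.
Qed.

Lemma rvec2_coords (w : 'rV[R]_2) : rvec2 (w 0 0, w 0 1) = w.
Proof.
apply/rowP => j; rewrite mxE; case: j => [[|[|//]] ?] /=;
  by congr (w _ _); exact: val_inj.
Qed.

Lemma enorm_eq0 (w : 'rV[R]_2) : (enorm w ^+ 2 == 0) = (w == 0).
Proof. by rewrite -(rvec2_coords w) rvec2_eq0 sqr_enorm_rvec2. Qed.

Lemma measurable_kappa : measurable_fun setT (@kappa R).
Proof.
have mg : measurable_fun setT (fun w => (0, gamma w) : 'cV[R]_2 * 'M[R]_2).
  by apply: measurable_fun_pair; [exact: measurable_cst|exact: measurable_gamma].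
have mG : measurable_fun setT (fun w : 'rV[R]_2 => G2_of 0 (gamma w)).
  apply: (@measurable_insubd _ _ _ _ _ _ (G2 R) (G2 R) id (G2_one R) _ _ mg); first by [].
  rewrite (_ : [set _ | _] = (fun w => enorm w ^+ 2) @^-1` (~` [set 0])).
    rewrite -[X in measurable X]setTI; apply: measurable_sqr_enorm => //.
    by apply: measurableC; exact: measurable_set1.
  apply/seteqP; split=> w /=; last by move=> /eqP; rewrite enorm_eq0; exact: gamma_unit.
  apply: contraTnot => /eqP; rewrite enorm_eq0 => /eqP ->.
  rewrite /gamma !mxE oppr0 (_ : mat2 0 0 0 0 = 0) ?scaler0 ?unitmxE ?det0 ?unitr0//.
  by apply/matrixP => i j; rewrite !mxE; case: ifP => _; case: ifP.
apply: (@measurable_insubd _ _ _ _ _ _ (K R) (K R) id (K_one R) _ _ mG); first by [].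
rewrite (_ : [set _ | _] = setT)//; apply/seteqP; split=> // w _ /=.
exact: kappa_in_K.
Qed.

Lemma measurable_kap : measurable_fun setT kap.
Proof. exact: (measurableT_comp measurable_kappa (@measurable_rvec2 R)). Qed.

Lemma measurable_nsqinv : measurable_fun setT (fun p : RR => (nsq p)^-1).
Proof. by rewrite /nsq; mfun. Qed.

Lemma nsqinv_ge0 (p : RR) : 0 <= (nsq p)^-1.
Proof. by rewrite invr_ge0 nsq_ge0. Qed.

Lemma mu_KE (B : set (K R)) : measurable B ->
  @mu_K R B = weighted_image leb2 (fun p => (nsq p)^-1) kap B.
Proof.
move=> mB; rewrite /mu_K /weighted_image.
rewrite [LHS](@ge0_integral_pushforward _ _ RR 'rV[R]_2 R _ (@measurable_rvec2 R) leb2).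
- by apply: eq_integral => p _; rewrite /= sqr_enorm_rvec2.
- by rewrite -[X in measurable X]setTI; exact: measurable_kappa.
- apply: measurable_funTS; apply/measurable_EFinP.
  exact: (measurable_fun_inv measurable_sqr_enorm).
- by move=> w _; rewrite lee_fin invr_ge0 sqr_ge0.
Qed.

Lemma ge0_integral_K (f : K R -> \bar R) : measurable_fun setT f -> (forall k, (0 <= f k)%E) ->
  (\int[@mu_K R]_k f k = \int[leb2]_p (f (kap p) * ((nsq p)^-1)%:E))%E.
Proof.
exact: (@ge0_integral_weighted_image _ _ RR (K R) R leb2 _ _ _ measurable_kap
  measurable_nsqinv nsqinv_ge0 mu_KE).
Qed.

Lemma ae_lebesgue_rV2 (P : 'rV[R]_2 -> Prop) :
  (\forall w \ae @lebesgue_rV2 R, P w) -> \forall p \ae leb2, P (rvec2 p).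
Proof.
move=> [N [mN N0 NP]]; exists (@rvec2 R @^-1` N); split => //.
  by rewrite -[X in measurable X]setTI; exact: measurable_rvec2.
by move=> p /= nP; apply: NP.
Qed.

Lemma ae_mu_K (P : K R -> Prop) :
  (\forall k \ae @mu_K R, P k) -> \forall p \ae leb2, P (kap p).
Proof.
move=> aeP; have := weighted_image_ae measurable_kap measurable_nsqinv nsqinv_ge0 mu_KE aeP.
by move=> h; apply: filterS2 (@ae_fst_neq0 R) h => p p0; apply; rewrite invr_gt0 nsq_gt0.
Qed.

End charts.

Section group_coordinates.
Variable R : realType.
Local Notation T := (measurableTypeR R).
Local Notation RR := (T * T)%type.

Lemma mat2_ext (A : 'M[R]_2) : A = mat2 (A 0 0) (A 0 1) (A 1 0) (A 1 1).
Proof.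
apply/matrixP => i j; rewrite mxE.
by case: i j => [[|[|//]] ?] [[|[|//]] ?] /=; congr (A _ _); exact: val_inj.
Qed.

Lemma mat2_mul (a b c d a' b' c' d' : R) : mat2 a b c d *m mat2 a' b' c' d' =
  mat2 (a * a' + b * c') (a * b' + b * d') (c * a' + d * c') (c * b' + d * d').
Proof.
apply/matrixP => i j; rewrite !mxE !big_ord_recl big_ord0 addr0 !mxE /=.
by case: (i == 0); case: (j == 0).
Qed.

Lemma mat2_scale (k a b c d : R) : k *: mat2 a b c d = mat2 (k * a) (k * b) (k * c) (k * d).
Proof. by apply/matrixP => i j; rewrite !mxE; case: (i == 0); case: (j == 0). Qed.

Lemma mat2_1 : mat2 1 0 0 1 = 1%:M :> 'M[R]_2.
Proof.
by apply/matrixP => i j; rewrite !mxE; case: i j => [[|[|//]] ?] [[|[|//]] ?].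
Qed.

Definition coordsG (g : G2 R) : (RR * RR) * RR :=
  let A := G2_mx g in let x := G2_vec g in
  (((A 0 0, A 0 1), (A 1 0, A 1 1)), (x 0 0, x 1 0)).

Definition chart (z : (RR * RR) * RR) : G2 R := G2_of (cvec2 z.2) (mx22 z.1).

Lemma mx22_coordsG g : mx22 (coordsG g).1 = G2_mx g.
Proof. by rewrite [RHS]mat2_ext. Qed.

Lemma cvec2_coordsG g : cvec2 (coordsG g).2 = G2_vec g.
Proof.
apply/colP => i; rewrite mxE.
by case: i => [[|[|//]] ?] /=; congr (G2_vec g _ _); exact: val_inj.
Qed.

Lemma det_mx22 (A : RR * RR) : \det (mx22 A) = detA A.
Proof. by rewrite det_mat2. Qed.

Lemma det_coordsG g : \det (G2_mx g) = detA (coordsG g).1.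
Proof. by rewrite -mx22_coordsG det_mx22. Qed.

Lemma detA_coordsG g : detA (coordsG g).1 != 0.
Proof. by rewrite -det_coordsG -unitfE -unitmxE G2_mx_unit. Qed.

Lemma mx22_unit (A : RR * RR) : (mx22 A \in unitmx) = (detA A != 0).
Proof. by rewrite unitmxE unitfE det_mx22. Qed.

Lemma val_chart z : detA z.1 != 0 -> val (chart z) = (cvec2 z.2, mx22 z.1).
Proof. by move=> z0; rewrite /chart /G2_of insubdK// -topredE /= mx22_unit. Qed.

Lemma coords_chart z : detA z.1 != 0 -> coordsG (chart z) = z.
Proof.
move=> z0; rewrite /coordsG /G2_mx /G2_vec val_chart// !mxE /=.
by case: z z0 => [[[a b] [c d]] [x y]].
Qed.

Lemma chart_coords g : chart (coordsG g) = g.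
Proof.
have v := val_chart (detA_coordsG g).
by apply: G2_eq; rewrite /G2_mx /G2_vec v /= ?mx22_coordsG ?cvec2_coordsG.
Qed.

Lemma measurable_G2_val : measurable_fun setT (val : G2 R -> 'cV[R]_2 * 'M[R]_2).
Proof. by move=> _ B mB; rewrite setTI; apply/initial_measurableP; exists B. Qed.

Lemma measurable_coordsG : measurable_fun setT coordsG.
Proof.
have mA i j : measurable_fun setT (fun g : G2 R => G2_mx g i j : T).
  exact: (measurableT_comp (measurable_entry i j) (measurableT_comp measurable_snd measurable_G2_val)).
have mx i : measurable_fun setT (fun g : G2 R => G2_vec g i 0 : T).
  exact: (measurableT_comp (measurable_entry i 0) (measurableT_comp measurable_fst measurable_G2_val)).
apply: measurable_fun_pair; last exact: measurable_fun_pair.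
by apply: measurable_fun_pair; exact: measurable_fun_pair.
Qed.

Lemma measurable_mx22 : measurable_fun setT (fun z : (RR * RR) * RR => mx22 z.1).
Proof.
have m1 : measurable_fun setT (fun z : (RR * RR) * RR => z.1.1) by mfun.
have m2 : measurable_fun setT (fun z : (RR * RR) * RR => z.1.2) by mfun.
apply: measurable_matrix => i j; under eq_fun do rewrite mxE.
case: (i == 0); case: (j == 0).
- exact: (measurableT_comp measurable_fst m1).
- exact: (measurableT_comp measurable_snd m1).
- exact: (measurableT_comp measurable_fst m2).
- exact: (measurableT_comp measurable_snd m2).
Qed.

Lemma measurable_chart : measurable_fun setT chart.
Proof.
apply: (@measurable_insubd _ _ _ _ _ _ (G2 R) (G2 R) id (G2_one R)
  (fun z : (RR * RR) * RR => (cvec2 z.2, mx22 z.1))); first by [].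
- apply: measurable_fun_pair; last exact: measurable_mx22.
  apply: measurable_matrix => i j; under eq_fun do rewrite mxE.
  case: (i == 0); first exact: (measurableT_comp measurable_fst measurable_snd).
  exact: (measurableT_comp measurable_snd measurable_snd).
- rewrite (_ : [set _ | _] = (fun z => detA z.1) @^-1` (~` [set 0])).
    have md : measurable_fun setT (fun z : (RR * RR) * RR => detA z.1) by rewrite /detA /cross; mfun.
    rewrite -[X in measurable X]setTI; apply: md => //.
    by apply: measurableC; exact: measurable_set1.
  by apply/seteqP; split=> z /=; rewrite mx22_unit => /eqP.
Qed.

Definition haar_weight (z : (RR * RR) * RR) : R := (`|detA z.1| * `|detA z.1| ^+ 2)^-1.

Lemma haar_weight_ge0 z : 0 <= haar_weight z.
Proof. by rewrite invr_ge0 mulr_ge0. Qed.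

Lemma measurable_haar_weight : measurable_fun setT haar_weight.
Proof. by rewrite /haar_weight /detA /cross; mfun. Qed.

Lemma haar_G2E (B : set (G2 R)) : measurable B -> @haar_G2 R B =
  weighted_image ((@lebesgue2 R \x @lebesgue2 R) \x @lebesgue2 R)%E haar_weight chart B.
Proof.
move=> mB; rewrite /haar_G2 /weighted_image; apply: eq_integral => z _.
by rewrite det_mx22.
Qed.

Lemma ge0_integral_haar (f : G2 R -> \bar R) : measurable_fun setT f -> (forall g, (0 <= f g)%E) ->
  (\int[@haar_G2 R]_g f g =
   \int[(@lebesgue2 R \x @lebesgue2 R) \x @lebesgue2 R]_z (f (chart z) * (haar_weight z)%:E))%E.
Proof.
exact: (@ge0_integral_weighted_image _ _ _ (G2 R) R _ haar_weight chart (@haar_G2 R)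
  measurable_chart measurable_haar_weight haar_weight_ge0 haar_G2E).
Qed.

Lemma rvec2_mul (p : RR) (A : RR * RR) : rvec2 p *m mx22 A = rvec2 (lin p A).
Proof.
apply/rowP => j; rewrite !mxE !big_ord_recl big_ord0 addr0 !mxE /=.
by case: (j == 0).
Qed.

Lemma rvec2_cvec2 (p x : RR) : (rvec2 p *m cvec2 x) 0 0 = p.1 * x.1 + p.2 * x.2.
Proof. by rewrite !mxE !big_ord_recl big_ord0 addr0 !mxE /=. Qed.

Lemma gamma_rvec2 (p : RR) :
  gamma (rvec2 p) = mat2 ((nsq p)^-1 * p.1) ((nsq p)^-1 * - p.2) ((nsq p)^-1 * p.2) ((nsq p)^-1 * p.1).
Proof. by rewrite /gamma sqr_enorm_rvec2 !mxE /= mat2_scale. Qed.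

Lemma invmx_gamma (p : RR) : nsq p != 0 -> invmx (gamma (rvec2 p)) = mat2 p.1 p.2 (- p.2) p.1.
Proof.
move=> p0; have gu : gamma (rvec2 p) \in unitmx by apply: gamma_unit; rewrite rvec2_eq0.
rewrite -[LHS]mulmx1 -[RHS](mulKmx gu); congr (_ *m _).
rewrite gamma_rvec2 mat2_mul -mat2_1; move: p0; rewrite /nsq => p0.
by congr mat2; field.
Qed.

(** The upper left entry is 1 if pA is nonzero, and 0 otherwise by the convention on the inverse of
    0. *)
Lemma gamma_conj (p : RR) (A : RR * RR) : nsq p != 0 ->
  invmx (gamma (rvec2 p)) *m mx22 A *m gamma (rvec2 p *m mx22 A) =
  mat2 ((nsq (lin p A))^-1 * nsq (lin p A)) 0
    (ucoord (lin p A) (lin (rot90 p) A)) (vcoord (lin p A) (lin (rot90 p) A)).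
Proof.
move=> p0; rewrite invmx_gamma// rvec2_mul gamma_rvec2 !mat2_mul.
rewrite /ucoord /vcoord /cross; set c := (nsq (lin p A))^-1.
by rewrite /nsq /lin /rot90 /=; congr mat2; ring.
Qed.

Lemma u_coefE (p : RR) (A : RR * RR) : nsq p != 0 ->
  u_coef (rvec2 p) (mx22 A) = ucoord (lin p A) (lin (rot90 p) A).
Proof. by move=> p0; rewrite /u_coef gamma_conj// !mxE. Qed.

Lemma v_coefE (p : RR) (A : RR * RR) : nsq p != 0 ->
  v_coef (rvec2 p) (mx22 A) = vcoord (lin p A) (lin (rot90 p) A).
Proof. by move=> p0; rewrite /v_coef gamma_conj// !mxE. Qed.

Lemma nsq_lin_neq0 (p : RR) (A : RR * RR) : nsq p != 0 -> detA A != 0 -> nsq (lin p A) != 0.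
Proof.
move=> p0 A0; apply/eqP => /nsq_eq0 l0.
have := cross_lin p A; rewrite l0 /cross /= !mul0r subrr => /esym/eqP.
by rewrite mulf_eq0 (negbTE p0) (negbTE A0).
Qed.

Lemma vcoord_neq0 (p : RR) (A : RR * RR) : nsq p != 0 -> detA A != 0 ->
  vcoord (lin p A) (lin (rot90 p) A) != 0.
Proof.
by move=> p0 A0; rewrite /vcoord cross_lin !mulf_neq0 ?invr_neq0 ?nsq_lin_neq0.
Qed.

End group_coordinates.

(** * The wavelet transform *)

Section wavelet_orthogonality.
Context (R : realType).
Local Notation T := (measurableTypeR R).
Local Notation RR := (T * T)%type.
Local Notation leb := (@lebesgue_measure R).
Local Notation leb2 := (@lebesgue2 R).
Implicit Types (E F : L2_K R) (g : G2 R).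

(* For the section at p to be a representative for every p, rather than almost every p, is
   what allows to evaluate it at pA for fixed p and varying A. *)
Definition representative F (f : RR * T -> R[i]) := cmeasurable f /\
  forall p, \forall t \ae leb, f (p, t) = L2_fun (L2_fun F (kap p)) (rstar t).

Lemma exists_representative F : exists f, representative F f.
Proof.
have mF : strongly_measurable (dot_Rstar R) (L2_fun F \o @kap R).
  by apply: strongly_measurable_comp; [exact: measurable_kap|exact: (L2_funP F).1].
have [f [mf fF]] := joint_representative mF.
exists (fun z => f (z.1, rstar z.2)); split.
  apply: (cmeasurable_comp mf); apply: measurable_fun_pair; first exact: measurable_fst.
  exact: (measurableT_comp (@measurable_rstar R) measurable_snd).
by move=> p; apply: ae_mu_Rstar (fF p).
Qed.

Lemma cmeasurable_rstar (a : L2_Rstar R) : cmeasurable (fun t : T => L2_fun a (rstar t) : R[i]).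
Proof. exact: (cmeasurable_comp (cmeasurable_L2_fun a) (@measurable_rstar R)). Qed.

Lemma dot_Rstar_leb (a b : L2_Rstar R) : dot_Rstar R a b = cintegral leb
  (fun t : T => (`|t|^-1)%:C%C * (L2_fun a (rstar t) * (L2_fun b (rstar t))^*%C)).
Proof.
have mh : cmeasurable (fun t : Rstar R => L2_fun a t * (L2_fun b t)^*%C : R[i]).
  by apply: cmeasurableM; [|apply: cmeasurable_conj]; exact: cmeasurable_L2_fun.
exact: (cintegral_weighted_image (@measurable_rstar R) (@measurable_norminv R)
  (@norminv_ge0 R) (@mu_RstarE R) mh).
Qed.

Lemma dnorm_Rstar_leb (a : L2_Rstar R) :
  ((dnorm (dot_Rstar R) a)%:E = \int[leb]_t (`|t|^-1 * csq (L2_fun a (rstar t)))%:E)%E.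
Proof.
rewrite L2_dnormE.
rewrite ge0_integral_Rstar.
- by apply: eq_integral => t _; rewrite dnorm_complex -EFinM mulrC.
- by apply/measurable_EFinP; exact: measurable_dnorm (L2_funP a).1.
- by move=> t; rewrite lee_fin dnorm_ge0.
Qed.

Lemma dnorm_representative F f p : representative F f ->
  (\int[leb]_t (`|t|^-1 * csq (f (p, t)))%:E = (dnorm (dot_Rstar R) (L2_fun F (kap p)))%:E)%E.
Proof.
move=> [mf fF]; rewrite dnorm_Rstar_leb; apply: ae_eq_integral => //.
- apply/measurable_EFinP; apply: measurable_funM; first exact: measurable_norminv.
  by apply: measurable_csq; apply: (cmeasurable_comp mf); mfun.
- apply/measurable_EFinP; apply: measurable_funM; first exact: measurable_norminv.
  exact: measurable_csq (cmeasurable_rstar _).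
- by apply: filterS (fF p) => t -> _.
Qed.

Lemma representative_lty F f : representative F f -> forall p,
  (\int[leb]_t (`|t|^-1 * csq (f (p, t)))%:E < +oo)%E.
Proof. by move=> fF p; rewrite (dnorm_representative p fF) ltry. Qed.

Definition fiber_dot F E (p : RR) : R[i] :=
  dot_Rstar R (L2_fun F (kap p)) (L2_fun E (kap p)).

Lemma cintegrable_dot_K F E :
  cintegrable (@mu_K R) (fun k => dot_Rstar R (L2_fun F k) (L2_fun E k)).
Proof.
by split; [exact: (integrable_Re_dot (L2_funP F) (L2_funP E))|exact: (integrable_Im_dot (L2_funP F) (L2_funP E))].
Qed.

Lemma dot_K_leb2 F E : dot_K R F E =
  cintegral leb2 (fun p => ((nsq p)^-1)%:C%C * fiber_dot F E p).
Proof.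
exact: (cintegral_weighted_image (@measurable_kap R) (@measurable_nsqinv R) (@nsqinv_ge0 R)
  (@mu_KE R) (cintegrable_cmeasurable (cintegrable_dot_K F E))).
Qed.

Lemma cintegrable_fiber_dot F E :
  cintegrable leb2 (fun p => ((nsq p)^-1)%:C%C * fiber_dot F E p).
Proof.
exact: (cintegrable_weighted_image (@measurable_kap R) (@measurable_nsqinv R) (@nsqinv_ge0 R)
  (@mu_KE R) (cintegrable_dot_K F E)).
Qed.

Lemma dnorm_K_leb2 F f : representative F f -> ((dnorm (dot_K R) F)%:E =
  \int[leb2]_p (((nsq p)^-1)%:E * \int[leb]_t (`|t|^-1 * csq (f (p, t)))%:E))%E.
Proof.
move=> fF; rewrite L2_dnormE.
rewrite ge0_integral_K.
- by apply: eq_integral => p _; rewrite (dnorm_representative p fF) muleC.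
- by apply/measurable_EFinP; exact: measurable_dnorm (L2_funP F).1.
- by move=> t; rewrite lee_fin dnorm_ge0.
Qed.

Lemma conj_expi (x : R) : (expi x)^*%C = expi (- x).
Proof. by rewrite /expi cosN sinN. Qed.

Lemma conjcM (z w : R[i]) : (z * w)^*%C = z^*%C * w^*%C.
Proof. exact: rmorphM. Qed.

Lemma real_complexM (a b : R) : (a * b)%:C%C = a%:C%C * b%:C%C.
Proof. exact: rmorphM. Qed.

Definition admissibility (e : RR * T -> R[i]) : \bar R :=
  (\int[leb2]_w (((nsq w ^+ 2)^-1)%:E * \int[leb]_t (csq (e (w, t)))%:E))%E.

Variable sigma : G2 R -> L2_K R -> L2_K R.
Hypothesis sigmaE : sigma_formula sigma.

(** The formula for sigma E is conjugated inside the inner product over R^*: the two phases change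
    sign, the one that depends on x leaves the integral, and the one in t^-1 u becomes the kernel of
    [Jint]. *)
Lemma fiber_dot_sigma F E f e g : representative F f -> representative E e ->
  let z := coordsG g in \forall p \ae leb2, fiber_dot F (sigma g E) p =
    (expi (- (2 * pi * (p.1 * z.2.1 + p.2 * z.2.2))) *
     (Vscale p z.1)%:C%C) *
    Jfun f e p z.1.
Proof.
move=> fF eE z; have [mf fr] := fF; have [me er] := eE.
have A0 : detA z.1 != 0 by exact: detA_coordsG.
have := ae_lebesgue_rV2 (sigmaE g E).
apply: filterS2 (@ae_fst_neq0 R) => p p0; have n0 : nsq p != 0 by rewrite gt_eqF// nsq_gt0.
rewrite rvec2_eq0 n0 => /(_ isT).
rewrite -(mx22_coordsG g) -(cvec2_coordsG g) -/z det_mx22 rvec2_mul rvec2_cvec2 !enorm_rvec2.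
rewrite u_coefE// v_coefE//.
rewrite -/(Vscale p z.1); set c := Vscale _ _; set u := ucoord _ _; set v := vcoord _ _.
have v0 : v != 0 by exact: vcoord_neq0.
move=> /ae_mu_Rstar aeS.
(* [er] is available at the point pA itself, and the dilation t -> t/v preserves null sets. *)
have aeE := ae_affine (invr_neq0 v0) (er (lin p z.1)).
set th := 2 * pi * (p.1 * z.2.1 + p.2 * z.2.2).
have mu1 : measurable_fun setT (fun t : T => - (2 * pi * (t^-1 * u))).
  by apply: measurableT_comp => //; do 2 apply: measurable_funM => //; exact: measurable_inv.
have ci := cintegrable_expi mu1
  (cintegrable_integrand mf me (representative_lty fF) (representative_lty eE) p (lin p z.1) v0).
rewrite /Jfun /Jint /= -(cintegralZl _ ci) /fiber_dot dot_Rstar_leb.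
apply: ae_eq_cintegral.
- apply: cmeasurableM; first by apply: cmeasurable_real; exact: measurable_norminv.
  by apply: cmeasurableM; [|apply: cmeasurable_conj]; exact: cmeasurable_rstar.
- apply: cmeasurableM; last exact: cintegrable_cmeasurable ci.
  by split; exact: measurable_cst.
apply: filterS2 (filterI (@ae_neq0 R) (fr p)) (filterI aeS aeE) => t [t0 ->] [-> ->].
rewrite val_rstar// -/(kap (lin p z.1)).
rewrite !conjcM conjc_real conj_expi.
rewrite (mulrDr (2 * pi)) opprD expiD -/th -/v -/u.
set a := L2_fun _ _; set b := (L2_fun _ _)^*%C; set X := expi _; set Y := expi _.
by move: (c%:C%C) ((`|t|^-1)%:C%C) => ? ?; ring.
Qed.

Lemma wavelet_Vfun F E f e g : representative F f -> representative E e ->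
  dot_K R F (sigma g E) = Vfun f e (coordsG g).
Proof.
move=> fF eE; have [mf _] := fF; have [me _] := eE.
rewrite dot_K_leb2 /Vfun /fourier2; apply: ae_eq_cintegral.
- exact: cintegrable_cmeasurable (cintegrable_fiber_dot F (sigma g E)).
- apply: cmeasurableM; first by apply: cmeasurable_expi; mfun.
  have mp : measurable_fun setT (fun p : RR => ((coordsG g).1, p)) by mfun.
  apply: cmeasurableM; last exact: (cmeasurable_comp (cmeasurable_Jfun mf me) mp).
  by apply: cmeasurable_real; exact: (measurableT_comp (@measurable_Vweight R) mp).
- apply: filterS (fiber_dot_sigma g fF eE) => p ->.
  rewrite /Vweight (real_complexM (nsq p)^-1).
  by move: (expi _) ((Vscale _ _)%:C%C) (Jfun _ _ _ _) => X c J; rewrite [RHS]mulrA [X * (_ * _)]mulrCA !mulrA.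
Qed.

Lemma cintegrable_Jfun F E f e (A : RR * RR) : representative F f -> representative E e ->
  detA A != 0 -> cintegrable leb2 (fun p => (Vweight p A)%:C%C * Jfun f e p A).
Proof.
move=> fF eE A0; have [mf _] := fF; have [me _] := eE.
have Z0 : coordsG (chart (A, (0, 0))) = (A, (0, 0)) by exact: coords_chart.
apply: ae_cintegrable (cintegrable_fiber_dot F (sigma (chart (A, (0, 0))) E)) _ _.
- have mp : measurable_fun setT (fun p : RR => (A, p)) by mfun.
  apply: cmeasurableM; last exact: (cmeasurable_comp (cmeasurable_Jfun mf me) mp).
  by apply: cmeasurable_real; exact: (measurableT_comp (@measurable_Vweight R) mp).
- apply: filterS (fiber_dot_sigma (chart (A, (0, 0))) fF eE) => p ->.
  rewrite Z0 /= !mulr0 addr0 mulr0 oppr0 /Vweight (real_complexM (nsq p)^-1).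
  have -> : expi 0 = 1 :> R[i] by rewrite /expi cos0 sin0.
  by rewrite mul1r mulrA.
Qed.

Lemma orthogonality_relation F E f e : representative F f -> representative E e ->
  (\int[@haar_G2 R]_g (csq (dot_K R F (sigma g E)))%:E =
   (dnorm (dot_K R) F)%:E * admissibility e)%E.
Proof.
move=> fF eE; have [mf _] := fF; have [me _] := eE.
have mV := measurable_csq (cmeasurable_Vfun mf me).
under eq_integral do rewrite (wavelet_Vfun _ fF eE).
rewrite ge0_integral_haar; last 2 first.
- by apply/measurable_EFinP; exact: (measurableT_comp mV (@measurable_coordsG R)).
- by move=> g; rewrite lee_fin csq_ge0.
rewrite (dnorm_K_leb2 fF) /admissibility.
rewrite -(scalar_orthogonality mf me (representative_lty fF) (representative_lty eE)); last first.
  by move=> A A0; exact: cintegrable_Jfun fF eE A0.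
have E' z : ((csq (Vfun f e (coordsG (chart z))))%:E * (haar_weight z)%:E =
    (csq (Vfun f e z) * (`|detA z.1| * `|detA z.1| ^+ 2)^-1)%:E :> \bar R)%E.
  have [z0|z0] := eqVneq (detA z.1) 0; last by rewrite coords_chart.
  by rewrite /haar_weight z0 normr0 mul0r invr0 mule0 mulr0.
by apply: eq_integral => z _; exact: E'.
Qed.

(** The coefficient equals the parametric integral [Vfun] at every g, so its measurability is that
    of [Vfun]. *)
Lemma cmeasurable_wavelet F E : cmeasurable (fun g => dot_K R F (sigma g E)).
Proof.
have [f fF] := exists_representative F; have [e eE] := exists_representative E.
rewrite (_ : (fun g => _) = (fun g => Vfun f e (coordsG g))).
  by apply: (cmeasurable_comp (cmeasurable_Vfun fF.1 eE.1)); exact: measurable_coordsG.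
by apply/funext => g; exact: wavelet_Vfun.
Qed.

End wavelet_orthogonality.

(** * Left invariance of the measure on the affine group *)

Section left_translation.
Context (R : realType).
Local Notation T := (measurableTypeR R).
Local Notation RR := (T * T)%type.
Local Notation leb2 := (@lebesgue2 R).
Local Notation leb4 := (leb2 \x leb2)%E.
Implicit Types g h : G2 R.

Definition translate_mx h (A : RR * RR) : RR * RR :=
  let H := (coordsG h).1 in rows_mul H.1.1 H.1.2 H.2.1 H.2.2 A.

Definition translate_vec h (x : RR) : RR :=
  let H := (coordsG h).1 in let y := (coordsG h).2 in
  (H.1.1 * x.1 + H.1.2 * x.2 + y.1, H.2.1 * x.1 + H.2.2 * x.2 + y.2).

Lemma coordsG_mul h g : coordsG (h * g)%g =
  (translate_mx h (coordsG g).1, translate_vec h (coordsG g).2).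
Proof.
rewrite /coordsG /translate_mx /translate_vec /rows_mul /=.
rewrite [G2_mx (h * g)%g]/(G2_mx h *m G2_mx g) [G2_vec (h * g)%g]/(G2_vec h + G2_mx h *m G2_vec g).
rewrite !mxE !big_ord_recl !big_ord0 !addr0.
have -> : lift ord0 ord0 = 1 :> 'I_2 by exact: val_inj.
by congr (_, (_, _)); rewrite addrC.
Qed.

Lemma measurable_translate h : measurable_fun setT
  (fun z : (RR * RR) * RR => (translate_mx h z.1, translate_vec h z.2)).
Proof. by rewrite /translate_mx /translate_vec /rows_mul; mfun. Qed.

Lemma measurable_mulg h : measurable_fun setT (fun g => h * g)%g.
Proof.
rewrite (_ : (fun g => _) = (fun g => chart (translate_mx h (coordsG g).1, translate_vec h (coordsG g).2))).
  apply: (measurableT_comp (@measurable_chart R)).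
  exact: (measurableT_comp (measurable_translate h) (@measurable_coordsG R)).
by apply/funext => g; rewrite -coordsG_mul chart_coords.
Qed.

Lemma detA_translate h A : detA (translate_mx h A) = detA (coordsG h).1 * detA A.
Proof. by rewrite /translate_mx /rows_mul /detA /cross /=; ring. Qed.

Lemma ge0_integral_translate_vec h (f : RR -> \bar R) : measurable_fun setT f -> (forall x, (0 <= f x)%E) ->
  (\int[leb2]_x f (translate_vec h x) = (`|detA (coordsG h).1|^-1)%:E * \int[leb2]_x f x)%E.
Proof.
move=> mf f0; set y := (coordsG h).2.
have mS : measurable_fun setT (fun x : RR => f (x.1 + y.1, x.2 + y.2)).
  by apply: (measurableT_comp mf); mfun.
rewrite -[in RHS](ge0_integral_shift2 y.1 y.2 mf f0).
exact: (ge0_integral_linear2 (detA_coordsG h) mS (fun x => f0 _)).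
Qed.

Lemma ge0_integral_translate_mx h (f : RR * RR -> \bar R) : measurable_fun setT f -> (forall x, (0 <= f x)%E) ->
  (\int[leb4]_A f (translate_mx h A) = ((detA (coordsG h).1 ^+ 2)^-1)%:E * \int[leb4]_A f A)%E.
Proof. by move=> mf f0; exact: (ge0_integral_rows_mul (detA_coordsG h) mf f0). Qed.

(** With D the determinant of the matrix of h, the density changes by |D|^-3, which matches the
    Jacobians D^-2 of A -> HA and |D|^-1 of x -> Hx + y, where h = [y, H]. *)
Lemma haar_left_invariant h (f : G2 R -> \bar R) : measurable_fun setT f -> (forall g, (0 <= f g)%E) ->
  (\int[@haar_G2 R]_g f (h * g)%g = \int[@haar_G2 R]_g f g)%E.
Proof.
move=> mf f0; have mfc := measurableT_comp mf (@measurable_chart R).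
rewrite ge0_integral_haar//; last by apply: (measurableT_comp mf); exact: measurable_mulg.
rewrite ge0_integral_haar//.
set D := detA (coordsG h).1; have D0 : D != 0 by exact: detA_coordsG.
have nD0 : `|D| != 0 by rewrite normr_eq0.
pose w (A : RR * RR) : R := (`|detA A| * `|detA A| ^+ 2)^-1.
have w0 A : 0 <= w A by rewrite invr_ge0 mulr_ge0.
have mw : measurable_fun setT (fun A => (w A)%:E) by rewrite /w /detA /cross; mfun.
pose L (z : (RR * RR) * RR) : \bar R := (f (chart z) * (w z.1)%:E)%E.
have mL : measurable_fun setT L.
  by apply: emeasurable_funM => //; exact: (measurableT_comp mw measurable_fst).
have L0 z : (0 <= L z)%E by rewrite mule_ge0// lee_fin.
pose t z := (translate_mx h z.1, translate_vec h z.2).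
have fE z : (f (h * chart z)%g * (haar_weight z)%:E = (`|D| ^+ 3)%:E * L (t z))%E.
  have wt : w (translate_mx h z.1) = (`|D| ^+ 3)^-1 * w z.1.
    by rewrite /w detA_translate -/D normrM -!invfM; congr (_^-1); ring.
  rewrite /L wt muleCA -EFinM mulrA mulfV ?expf_neq0// mul1r /haar_weight -/(w z.1).
  (* For singular matrices [chart] takes a default value, but the density vanishes there. *)
  have [z0|z0] := eqVneq (detA z.1) 0; first by rewrite /w z0 normr0 mul0r invr0 !mule0.
  by congr (f _ * _)%E; rewrite -[LHS]chart_coords coordsG_mul coords_chart.
have mLt : measurable_fun setT (L \o t) by apply: measurableT_comp => //; exact: measurable_translate.
transitivity ((`|D| ^+ 3)%:E * \int[leb4 \x leb2]_z L (t z))%E.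
  rewrite -(@ge0_integralZl_EFin _ _ R (leb4 \x leb2)%E setT measurableT (L \o t) (fun z _ => L0 _) mLt) ?exprn_ge0//.
  by apply: eq_integral => z _; exact: fE.
rewrite (lebesgue6_tonelli mLt (fun z => L0 _)) [RHS](lebesgue6_tonelli mL L0).
pose Phi A := (\int[leb2]_x L (A, x))%E.
have mPhi : measurable_fun setT Phi by exact: (measurable_parametric_integral leb2 mL).
have Phi0 A : (0 <= Phi A)%E by apply: integral_ge0 => x _; exact: L0.
transitivity ((`|D| ^+ 3)%:E * \int[leb4]_A ((`|D|^-1)%:E * Phi (translate_mx h A)))%E.
  congr (_ * _)%E; apply: eq_integral => A _.
  rewrite /= -(ge0_integral_translate_vec h (f := fun x => L (translate_mx h A, x)))//.
  by apply: (measurableT_comp mL); mfun.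
have mPt : measurable_fun setT (fun A => Phi (translate_mx h A)).
  apply: (measurableT_comp mPhi); exact: measurable_rows_mul.
have Di : 0 <= `|D|^-1 by rewrite invr_ge0.
rewrite (ge0_integralZl_EFin leb4 measurableT (fun A _ => Phi0 _) mPt Di).
rewrite (ge0_integral_translate_mx h mPhi Phi0) !muleA -!EFinM -/D.
rewrite -[D ^+ 2]real_normK ?num_real// (_ : _ * _ = 1) ?mul1e//.
by field.
Qed.

Lemma ae_translate h (P : G2 R -> Prop) :
  (\forall g \ae @haar_G2 R, P g) -> \forall g \ae @haar_G2 R, P (h * g)%g.
Proof.
move=> [N [mN N0 NP]].
have mI : measurable_fun setT (fun y : G2 R => (\1_N y)%:E : \bar R) by apply/measurable_EFinP.
have I0 (g : G2 R) : (0 <= (\1_N g)%:E :> \bar R)%E by rewrite lee_fin.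
have mIh : measurable_fun setT (fun g : G2 R => (\1_N (h * g)%g)%:E : \bar R).
  exact: (measurableT_comp mI (measurable_mulg h)).
have := haar_left_invariant h mI I0.
rewrite [X in _ = X -> _](_ : _ = 0%E); last by rewrite integral_indic// setIT.
rewrite (eq_integral (fun g : G2 R => `|(\1_N (h * g)%g)%:E|)%E); last first.
  by move=> x _; rewrite gee0_abs.
move/(ae_eq_integral_abs _ measurableT mIh); apply: filterS => g /(_ I) /=.
rewrite indicE => x0; apply: contrapT => nP.
have Nx : N (h * g)%g by exact: NP.
by move: x0; rewrite mem_set// => -[] /eqP; rewrite oner_eq0.
Qed.

End left_translation.

Section L2_classes.
Context d (X : measurableType d) (R : realType) (mu : {measure set X -> \bar R}).
Context (V : lmodType R[i]) (dot : {dot V for @conjc R}).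

Lemma L2_of_ae (f k : X -> V) : square_integrable_fun mu dot f -> square_integrable_fun mu dot k ->
  (\forall x \ae mu, f x = k x) -> L2_of mu dot f = L2_of mu dot k.
Proof.
move=> f2 k2 fk; apply/L2_eqP.
apply: filterS2 fk (filterI (L2_ofE f2) (L2_ofE k2)) => x fk [-> ->].
exact: fk.
Qed.

Lemma dnorm_L2_of (f : X -> V) : square_integrable_fun mu dot f ->
  ((dnorm (@L2_dot _ _ _ mu _ dot) (L2_of mu dot f))%:E = \int[mu]_x (dnorm dot (f x))%:E)%E.
Proof.
move=> f2; rewrite L2_dnormE; apply: ae_eq_integral => //.
- by apply/measurable_EFinP; exact: measurable_dnorm (L2_funP _).1.
- by apply/measurable_EFinP; exact: measurable_dnorm f2.1.
- by apply: filterS (L2_ofE f2) => x -> _.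
Qed.

Lemma L2_of_linear (a : R[i]) (f k l : X -> V) : square_integrable_fun mu dot f ->
  square_integrable_fun mu dot k -> square_integrable_fun mu dot l ->
  (forall x, l x = a *: f x + k x) ->
  L2_of mu dot l = a *: L2_of mu dot f + L2_of mu dot k.
Proof.
move=> f2 k2 l2 lE; apply/L2_eqP.
apply: filterS2 (filterI (L2_ofE l2) (L2_funD (a *: L2_of mu dot f) (L2_of mu dot k)))
  (filterI (L2_funZ a (L2_of mu dot f)) (filterI (L2_ofE f2) (L2_ofE k2))).
by move=> x [-> ->] [-> [-> ->]].
Qed.

End L2_classes.

(** * Isometry, intertwining property and irreducibility *)

Section wavelet_properties.
Context (R : realType) (sigma : G2 R -> L2_K R -> L2_K R).
Hypothesis sigma_unitary : unitary_representation (dot_K R) sigma.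
Hypothesis sigmaE : sigma_formula sigma.
Local Notation T := (measurableTypeR R).
Local Notation RR := (T * T)%type.
Local Notation leb := (@lebesgue_measure R).
Local Notation leb2 := (@lebesgue2 R).
Implicit Types (E F : L2_K R) (g h : G2 R).

Lemma wavelet_square_integrable F E e : representative E e -> (admissibility e < +oo)%E ->
  square_integrable_fun (@haar_G2 R) (@complex_dot R) (wavelet_transform sigma E F).
Proof.
move=> eE aoo; have [f fF] := exists_representative F; split.
  exact: cmeasurable_strongly_measurable (cmeasurable_wavelet sigmaE F E).
under eq_integral do rewrite dnorm_complex.
rewrite (orthogonality_relation sigmaE fF eE) lte_mul_pinfty ?lee_fin ?dnorm_ge0//.
Qed.

Lemma wavelet_intertwine F E g h :
  wavelet_transform sigma E (sigma g F) h = wavelet_transform sigma E F (g^-1 * h)%g.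
Proof.
have [_ iso [_ mul] _] := sigma_unitary.
have /= := mul g (g^-1 * h)%g E; rewrite mulVKg /wavelet_transform => ->.
exact: iso.
Qed.

Lemma wavelet_linear E (a : R[i]) F F' h : wavelet_transform sigma E (a *: F + F') h =
  a * wavelet_transform sigma E F h + wavelet_transform sigma E F' h.
Proof. by rewrite /wavelet_transform dotDl dotZl. Qed.

Section admissible.
Variables (E : L2_K R) (e : RR * T -> R[i]).
Hypotheses (eE : representative E e) (e1 : admissibility e = 1%E).

Let V_E F : L2_G2 R := L2_of (@haar_G2 R) (@complex_dot R) (wavelet_transform sigma E F).

Let wavelet2 F : square_integrable_fun (@haar_G2 R) (@complex_dot R) (wavelet_transform sigma E F).
Proof. by apply: (wavelet_square_integrable F eE); rewrite e1 ltry. Qed.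

Lemma V_E_linear : linear V_E.
Proof.
by move=> a F F'; apply: L2_of_linear => //; exact: wavelet_linear.
Qed.

Lemma V_E_isometry F : hnorm (dot_G2 R) (V_E F) = hnorm (dot_K R) F.
Proof.
rewrite /hnorm; congr Num.sqrt; apply: EFin_inj; rewrite dnorm_L2_of//.
under eq_integral do rewrite dnorm_complex.
have [f fF] := exists_representative F.
by rewrite (orthogonality_relation sigmaE fF eE) e1 mule1.
Qed.

Lemma V_E_intertwines g F : V_E (sigma g F) = left_regular g (V_E F).
Proof.
rewrite /V_E /left_regular; apply: L2_of_ae => //.
- have [m2 i2] := L2_funP (V_E F); split.
    exact: (strongly_measurable_comp (measurable_mulg g^-1%g) m2).
  rewrite (haar_left_invariant g^-1%g (f := fun h => (dnorm (@complex_dot R) (L2_fun (V_E F) h))%:E))//.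
  + by apply/measurable_EFinP; exact: measurable_dnorm m2.
  + by move=> h; rewrite lee_fin dnorm_ge0.
- apply: filterS (ae_translate g^-1%g (L2_ofE (wavelet2 F))) => h ->.
  exact: wavelet_intertwine.
Qed.

End admissible.

(** The admissibility integral and the norm of E integrate |e|^2 with different weights, but the
    weight |w|^-4 is positive off the origin, so e vanishes almost everywhere on almost every fibre,
    and then so does the norm. *)
Lemma admissibility_eq0 E e : representative E e -> admissibility e = 0%E -> E = 0.
Proof.
move=> eE a0; have [me _] := eE.
apply: (@dnorm_eq0 _ _ (dot_K R)); apply: EFin_inj; rewrite (dnorm_K_leb2 eE).
have mce : measurable_fun setT (fun z => (csq (e z))%:E) by apply/measurable_EFinP; exact: measurable_csq.
pose k (w : RR) : \bar R := (((nsq w ^+ 2)^-1)%:E * \int[leb]_t (csq (e (w, t)))%:E)%E.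
have k0 w : (0 <= k w)%E.
  rewrite mule_ge0 ?lee_fin ?invr_ge0 ?sqr_ge0//.
  by apply: integral_ge0 => t _; rewrite lee_fin csq_ge0.
have mk : measurable_fun setT k.
  apply: emeasurable_funM; last exact: (measurable_parametric_integral leb mce).
  by rewrite /nsq; mfun.
have : (\int[leb2]_w `|k w| = 0)%E.
  by rewrite -a0; apply: eq_integral => w _; rewrite gee0_abs.
move/(ae_eq_integral_abs _ measurableT mk) => ae0.
have mi : measurable_fun setT (fun p : RR => ((nsq p)^-1)%:E *
    \int[leb]_t (`|t|^-1 * csq (e (p, t)))%:E)%E.
  apply: emeasurable_funM; first by rewrite /nsq; mfun.
  apply: (measurable_parametric_integral leb (G := fun z => (`|z.2|^-1 * csq (e z))%:E)).
  by apply/measurable_EFinP; apply: measurable_funM; [mfun|exact: measurable_csq].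
transitivity (\int[leb2]_p (cst 0 p : \bar R))%E; last exact: integral0.
apply: ae_eq_integral => //.
apply: filterS2 (@ae_fst_neq0 R) ae0 => p p0 /(_ I) kp _.
have n0 : nsq p != 0 by rewrite gt_eqF// nsq_gt0.
have : (\int[leb]_t `|(csq (e (p, t)))%:E| = 0)%E.
  under eq_integral do rewrite gee0_abs ?lee_fin ?csq_ge0//.
  move/eqP : kp; rewrite /k mule_eq0 => /orP[|/eqP//].
  by rewrite eqe invr_eq0 sqrf_eq0 (negbTE n0).
have mep : measurable_fun setT (fun t : T => (csq (e (p, t)))%:E).
  by apply: (measurableT_comp mce); mfun.
move/(ae_eq_integral_abs _ measurableT mep) => ep0.
rewrite [X in (_ * X)%E](_ : _ = 0%E) ?mule0//.
transitivity (\int[leb]_t (cst 0 t : \bar R))%E; last exact: integral0.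
apply: ae_eq_integral => //.
  by apply/measurable_EFinP; apply: measurable_funM; [mfun|exact/measurable_EFinP].
by apply: filterS ep0 => t /(_ I) [->] _; rewrite mulr0.
Qed.

(** The ratio 1/4 for complex numbers, halved once for each of the two layers of L^2. *)
Lemma fast_complete_K : fast_complete (dot_K R) (4^-1 / 2 / 2).
Proof.
apply: L2_fast_complete; first by apply/andP; split; lra.
apply: L2_fast_complete; first by apply/andP; split; lra.
by apply: complex_fast_complete; apply/andP; split; lra.
Qed.

(* If F is orthogonal to an invariant W containing E, then the coefficients <F, sigma(g) E>
   vanish, so that |F|^2 times the admissibility of E is 0. *)
Lemma sigma_irreducible : irreducible (dot_K R) sigma.
Proof.
have r01 : 0 < (4^-1 / 2 / 2 : R) < 1 by apply/andP; split; lra.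
move=> W Wc Winv; have [W0|nW0] := pselect (W = [set 0]); [by left|right].
apply/eqP; apply: contrapT => /negP WT.
have [h h0 hW] := exists_orthogonal r01 fast_complete_K Wc WT.
apply: nW0; apply/seteqP; split => [E WE|_ -> /=]; last by case: Wc.
have [e eE] := exists_representative E; have [f fh] := exists_representative h.
apply: (admissibility_eq0 eE); apply/eqP.
have := orthogonality_relation sigmaE fh eE.
under eq_integral do rewrite (hW _ (Winv _ _ WE)).
have -> : csq (0 : R[i]) = 0 by rewrite /csq/= expr0n addr0.
rewrite integral0 => /esym/eqP; rewrite mule_eq0 => /orP[|//].
by rewrite eqe gt_eqF// dnorm_gt0.
Qed.

End wavelet_properties.

(** * The admissibility integral of a product a(w) b(t) *)

Section admissibility_of_tensor.
Context (R : realType).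
Local Notation T := (measurableTypeR R).
Local Notation RR := (T * T)%type.
Local Notation leb := (@lebesgue_measure R).
Local Notation leb2 := (@lebesgue2 R).

Lemma admissibility_tensor (E : L2_K R) e (a : RR -> R[i]) (b : T -> R[i]) :
  representative E e -> cmeasurable a -> cmeasurable b ->
  (\forall p \ae leb2, \forall t \ae leb, L2_fun (L2_fun E (kap p)) (rstar t) = a p * b t) ->
  admissibility e = ((\int[leb2]_p ((nsq p ^+ 2)^-1 * csq (a p))%:E) * \int[leb]_t (csq (b t))%:E)%E.
Proof.
move=> [me er] ma mb Eab; have [mca mcb] := (measurable_csq ma, measurable_csq mb).
have mn : measurable_fun setT (fun p : RR => (nsq p ^+ 2)^-1) by rewrite /nsq; mfun.
have ie0 (c : T -> R[i]) : (0 <= \int[leb]_t (csq (c t))%:E)%E.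
  by apply: integral_ge0 => t _; rewrite lee_fin csq_ge0.
have mce : measurable_fun setT (fun z => (csq (e z))%:E) by apply/measurable_EFinP; exact: measurable_csq.
have m1 : measurable_fun setT (fun p : RR => ((nsq p ^+ 2)^-1 * csq (a p))%:E).
  by apply/measurable_EFinP; exact: measurable_funM.
have m1_ge0 p : setT p -> (0 <= ((nsq p ^+ 2)^-1 * csq (a p))%:E)%E.
  by move=> _; rewrite lee_fin mulr_ge0 ?csq_ge0 ?invr_ge0 ?sqr_ge0.
rewrite -(ge0_integralZr leb2 measurableT m1 m1_ge0 (ie0 b)).
apply: ae_eq_integral => //.
- apply: emeasurable_funM; first exact/measurable_EFinP.
  exact: (measurable_parametric_integral leb mce).
- by apply: emeasurable_funM => //; exact: measurable_cst.
- apply: filterS Eab => p Ep _; rewrite EFinM -muleA; congr (_ * _)%E.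
  rewrite -ge0_integralZl_EFin ?csq_ge0//; last 2 first.
  + by move=> t _; rewrite lee_fin csq_ge0.
  + exact/measurable_EFinP.
  apply: ae_eq_integral => //.
  + by apply: (measurableT_comp mce); mfun.
  + by apply: emeasurable_funM; [exact: measurable_cst|exact/measurable_EFinP].
  + by apply: filterS2 (er p) Ep => t -> -> _; rewrite csqM EFinM.
Qed.

Lemma K_mx_kap (p : RR) : nsq p != 0 -> K_mx (kap p) = gamma (rvec2 p).
Proof.
move=> p0; have gu : gamma (rvec2 p) \in unitmx by apply: gamma_unit; rewrite rvec2_eq0.
rewrite /K_mx /kap /kappa insubdK; last by rewrite -topredE; exact: kappa_in_K.
by rewrite /G2_mx /G2_of insubdK.
Qed.

Lemma det_gamma (p : RR) : nsq p != 0 -> \det (gamma (rvec2 p)) = (nsq p)^-1.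
Proof.
move=> p0; rewrite gamma_rvec2 det_mat2; move: p0; rewrite /nsq => p0.
by field.
Qed.

Lemma row0_invmx_gamma (p : RR) : nsq p != 0 ->
  delta_mx 0 0 *m invmx (gamma (rvec2 p)) = rvec2 p.
Proof.
move=> p0; rewrite invmx_gamma// -rowE; apply/rowP => j; rewrite !mxE /=.
by case: (j == 0).
Qed.

Lemma ge0_integral_rV2 (f : 'rV[R]_2 -> \bar R) : measurable_fun setT f -> (forall w, (0 <= f w)%E) ->
  (\int[@lebesgue_rV2 R]_w f w = \int[leb2]_p f (rvec2 p))%E.
Proof.
move=> mf f0.
by rewrite [LHS](@ge0_integral_pushforward _ _ RR 'rV[R]_2 R _ (@measurable_rvec2 R) leb2 setT f).
Qed.

Lemma sqr_normc (z : R[i]) : Normc.normc z ^+ 2 = csq z.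
Proof. by case: z => x y; rewrite /= sqr_sqrtr// addr_ge0 ?sqr_ge0. Qed.

(** At L = gamma(p), (1,0) L^-1 = p and det L = |p|^-2, so E is conj(eta(p)) |p|^2 times g(t). The
    integral over p is then |eta|^2 = 1, and the one over t is the normalisation of g, since dt =
    |t| dt/|t|. *)
Lemma admissibility_wavelet (g : L2_Rstar R) (eta : L2_rV2 R) (E : L2_K R) e :
  (\int[@mu_Rstar R]_nu ((Normc.normc ((Num.sqrt `|val nu|)%:C%C * L2_fun g nu)) ^+ 2)%:E = 1)%E ->
  hnorm (dot_rV2 R) eta = 1 ->
  (\forall k \ae @mu_K R, \forall nu \ae @mu_Rstar R,
     L2_fun (L2_fun E k) nu =
     (L2_fun eta (delta_mx 0 0 *m invmx (K_mx k)))^*%C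
       / (`|\det (K_mx k)|)%:C%C * L2_fun g nu) ->
  representative E e -> admissibility e = 1%E.
Proof.
move=> g1 eta1 EE eE.
have meta : cmeasurable (fun p : RR => L2_fun eta (rvec2 p) : R[i]).
  exact: (cmeasurable_comp (cmeasurable_L2_fun eta) (@measurable_rvec2 R)).
pose a (p : RR) : R[i] := (L2_fun eta (rvec2 p))^*%C * (nsq p)%:C%C.
have ma : cmeasurable a.
  apply: cmeasurableM; first exact: cmeasurable_conj.
  by apply: cmeasurable_real; rewrite /nsq; mfun.
rewrite (admissibility_tensor eE ma (cmeasurable_rstar g)); last first.
  apply: filterS2 (@ae_fst_neq0 R) (ae_mu_K EE) => p p0.
  have n0 : nsq p != 0 by rewrite gt_eqF// nsq_gt0.
  move=> /ae_mu_Rstar; apply: filterS => t ->.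
  rewrite K_mx_kap// det_gamma// row0_invmx_gamma// ger0_norm ?invr_ge0 ?nsq_ge0//.
  by rewrite /a -[in RHS](invrK (nsq p)) [in RHS]fmorphV.
have -> : (\int[leb2]_p ((nsq p ^+ 2)^-1 * csq (a p))%:E = 1)%E.
  have <- : ((dnorm (dot_rV2 R) eta)%:E = 1)%E.
    move: eta1; rewrite /hnorm => /(congr1 (fun x => x ^+ 2)).
    by rewrite sqr_sqrtr ?dnorm_ge0// expr1n => ->.
  rewrite L2_dnormE ge0_integral_rV2; last 2 first.
  - by apply/measurable_EFinP; exact: measurable_dnorm (L2_funP eta).1.
  - by move=> w; rewrite lee_fin dnorm_ge0.
  apply: ae_eq_integral => //.
  - apply/measurable_EFinP; apply: measurable_funM; first by rewrite /nsq; mfun.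
    exact: measurable_csq.
  - apply/measurable_EFinP; under eq_fun do rewrite dnorm_complex.
    exact: measurable_csq.
  - apply: filterS (@ae_fst_neq0 R) => p p0 _; congr (_%:E).
    have n0 : nsq p != 0 by rewrite gt_eqF// nsq_gt0.
    by rewrite dnorm_complex /a csqM csq_conj csq_real mulrCA mulVf ?mulr1// expf_neq0.
rewrite mul1e -g1.
rewrite ge0_integral_Rstar; last 2 first.
- apply/measurable_EFinP; under eq_fun do rewrite sqr_normc.
  apply: measurable_csq; apply: cmeasurableM; last exact: cmeasurable_L2_fun.
  apply: cmeasurable_real; apply: (measurableT_comp (@measurable_sqrtr R)).
  apply: measurableT_comp => //.
  by move=> _ B mB; rewrite setTI; apply/initial_measurableP; exists B.
- by move=> t; rewrite lee_fin sqr_ge0.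
apply: ae_eq_integral => //.
- apply/measurable_EFinP; exact: measurable_csq (cmeasurable_rstar g).
- apply: emeasurable_funM; last by apply/measurable_EFinP; exact: measurable_norminv.
  apply/measurable_EFinP; under eq_fun do rewrite sqr_normc.
  apply: measurable_csq; apply: cmeasurableM; last exact: cmeasurable_rstar.
  apply: cmeasurable_real; apply: (measurableT_comp (@measurable_sqrtr R)).
  apply: measurableT_comp => //.
  have mv : measurable_fun setT (fun t : Rstar R => val t : T).
    by move=> _ B mB; rewrite setTI; apply/initial_measurableP; exists B.
  exact: (measurableT_comp mv (@measurable_rstar R)).
- apply: filterS (@ae_neq0 R) => t t0 _; rewrite sqr_normc csqM csq_real sqr_sqrtr// val_rstar//.
  by rewrite -EFinM mulrAC divff ?mul1r// normr_eq0.
Qed.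

End admissibility_of_tensor.

Lemma ae_exists d (X : measurableType d) (R : realType) (mu : {measure set X -> \bar R})
    (A : set X) (P : X -> Prop) : measurable A -> mu A != 0%E ->
  (\forall x \ae mu, P x) -> exists2 x, A x & P x.
Proof.
move=> mA A0 [N [mN N0 NP]]; apply: contrapT => nex.
move/eqP : A0; apply; apply/eqP; rewrite eq_le measure_ge0 andbT -N0.
apply: le_measure; rewrite ?inE// => x Ax.
by apply: NP => Px; apply: nex; exists x.
Qed.

Lemma strongly_measurable_indic d (X : measurableType d) (R : realType) (V : lmodType R[i])
    (dot : {dot V for @conjc R}) (A : set X) (v : V) : measurable A ->
  strongly_measurable dot (fun x => if x \in A then v else 0).
Proof.
move=> mA; apply: (@strongly_measurable_dense _ _ _ _ _ _ (fun j => if j is 0%N then 0 else v)).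
  move=> j; set w := (if j is 0%N then 0 else v).
  rewrite (_ : (fun x => _) = (fun x => if x \in A then dnorm dot (v - w) else dnorm dot (0 - w))).
    apply: measurable_fun_ifT => //; apply: (measurable_fun_bool true).
    rewrite setTI (_ : _ @^-1` _ = A)//.
    by apply/seteqP; split => x /=; [move=> /set_mem|move=> /mem_set].
  by apply/funext => x; case: ifP.
move=> x r r0; case: ifP => _; [exists 1%N|exists 0%N]; by rewrite subrr dnorm0.
Qed.

(** * An explicit admissible vector *)

Section admissible_vector.
Context (R : realType).
Local Notation T := (measurableTypeR R).
Local Notation RR := (T * T)%type.
Local Notation leb := (@lebesgue_measure R).
Local Notation leb2 := (@lebesgue2 R).

(** On [1, 2] the density 1/|t| is at most 1, and on its square |p| is at least 1. All weights are
    thus at most 1, and both sets have measure 1. *)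
Let I12 : set T := `[1, 2]%classic.

Let B12 : set RR := I12 `*` I12.

Let mI12 : measurable I12. Proof. exact: measurable_itv. Qed.

Let mB12 : measurable B12. Proof. exact: measurableX. Qed.

Let leb_I12 : leb I12 = 1%E.
Proof.
rewrite [LHS]lebesgue_measure_itv/= lte_fin ltr1n/= -EFinB.
by congr (_%:E); lra.
Qed.

Let leb2_B12 : leb2 B12 = 1%E.
Proof. by rewrite /lebesgue2 product_measure1E//= [leb I12]leb_I12 mule1. Qed.

(* The point w with gamma w = L, for [0, L] in K. *)
Definition coordsK (k : K R) : RR :=
  let s := K_mx k 0 0 in let t := K_mx k 1 0 in
  (s / (s ^+ 2 + t ^+ 2), t / (s ^+ 2 + t ^+ 2)).

Lemma measurable_coordsK : measurable_fun setT coordsK.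
Proof.
have mv : measurable_fun setT (fun k : K R => val k : G2 R).
  by move=> _ B mB; rewrite setTI; apply/initial_measurableP; exists B.
have mA i j : measurable_fun setT (fun k : K R => K_mx k i j : T).
  exact: (measurableT_comp (measurable_entry i j)
    (measurableT_comp measurable_snd (measurableT_comp (@measurable_G2_val R) mv))).
have mn : measurable_fun setT (fun k : K R => (K_mx k 0 0 ^+ 2 + K_mx k 1 0 ^+ 2)^-1 : T).
  exact: (measurable_fun_inv (measurable_funD (measurable_funX 2 (mA 0 0)) (measurable_funX 2 (mA 1 0)))).
exact: measurable_fun_pair (measurable_funM (mA 0 0) mn) (measurable_funM (mA 1 0) mn).
Qed.

Lemma coordsK_kap (p : RR) : nsq p != 0 -> coordsK (kap p) = p.
Proof.
move=> p0; rewrite /coordsK K_mx_kap// gamma_rvec2 !mxE /=.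
rewrite !exprMn -mulrDr -/(nsq p).
have -> : (nsq p)^-1 ^+ 2 * nsq p = (nsq p)^-1 by rewrite expr2 -mulrA mulVf ?mulr1.
rewrite invrK; case: p p0 => a b p0 /=; congr pair; by rewrite mulrAC mulVf ?mul1r.
Qed.

Let bump (t : Rstar R) : R[i]^o := if t \in (fun t : Rstar R => val t : T) @^-1` I12 then 1 else 0.

Let mval : measurable_fun setT (fun t : Rstar R => val t : T).
Proof. by move=> _ B mB; rewrite setTI; apply/initial_measurableP; exists B. Qed.

Let bump_rstar (t : T) : t != 0 -> csq (bump (rstar t)) = \1_I12 t.
Proof.
move=> t0; rewrite /bump indicE.
have -> : (rstar t \in (fun t : Rstar R => val t : T) @^-1` I12) = (t \in I12).
  by apply/idP/idP => /set_mem /=; [rewrite val_rstar// => /mem_set|move=> tI; apply/mem_set; rewrite /= val_rstar].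
by case: ifP => _; rewrite /csq/= ?expr1n ?expr0n ?addr0.
Qed.

Let strongly_bump : strongly_measurable (@complex_dot R) bump.
Proof.
apply: strongly_measurable_indic.
by rewrite -[X in measurable X]setTI; exact: mval.
Qed.

Let mbump : cmeasurable (fun t : T => bump (rstar t) : R[i]).
Proof.
exact: (cmeasurable_comp (strongly_measurable_cmeasurable strongly_bump) (@measurable_rstar R)).
Qed.

Let integral_bump : (\int[leb]_t (csq (bump (rstar t)))%:E = 1)%E.
Proof.
transitivity (\int[leb]_t (\1_I12 t)%:E)%E; last by rewrite integral_indic// setIT; exact: leb_I12.
apply: ae_eq_integral => //.
- by apply/measurable_EFinP; exact: measurable_csq.
- by apply/measurable_EFinP; exact: measurable_indic.
- by apply: filterS (@ae_neq0 R) => t t0 _; rewrite bump_rstar.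
Qed.

Let bump2 : square_integrable_fun (@mu_Rstar R) (@complex_dot R) bump.
Proof.
split; first exact: strongly_bump.
rewrite ge0_integral_Rstar; last 2 first.
- by apply/measurable_EFinP; exact: measurable_dnorm.
- by move=> t; rewrite lee_fin dnorm_ge0.
apply: le_lt_trans (ltry 1); rewrite -integral_bump.
have mc := measurable_csq mbump.
apply: ae_ge0_le_integral => //.
- by move=> t _; rewrite mule_ge0 ?lee_fin ?dnorm_ge0 ?norminv_ge0.
- apply: emeasurable_funM; last by apply/measurable_EFinP; exact: measurable_norminv.
  by apply/measurable_EFinP; under eq_fun do rewrite dnorm_complex.
- by move=> t _; rewrite lee_fin csq_ge0.
- exact/measurable_EFinP.
- apply: filterS (@ae_neq0 R) => t t0 _; rewrite dnorm_complex bump_rstar// -EFinM lee_fin indicE.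
  have [/set_mem|_] := boolP (t \in I12); last by rewrite mul0r.
  rewrite /I12/= in_itv/= => /andP[t1 _]; rewrite mul1r invf_le1 ?normr_gt0//.
  by rewrite ger0_norm// (le_trans _ t1).
Qed.

Let g0 : L2_Rstar R := L2_of (@mu_Rstar R) (@complex_dot R) bump.

(** A tensor product: the indicator of the square in the coordinates of K times the class of the
    indicator of [1, 2]. *)
Let annular (k : K R) : L2_Rstar R := if k \in coordsK @^-1` B12 then g0 else 0.

Let strongly_annular : strongly_measurable (dot_Rstar R) annular.
Proof.
apply: strongly_measurable_indic.
by rewrite -[X in measurable X]setTI; exact: measurable_coordsK.
Qed.

Let annular_kap (p : RR) : p.1 != 0 -> annular (kap p) = if p \in B12 then g0 else 0.
Proof.
move=> p0; rewrite /annular; have n0 : nsq p != 0 by rewrite gt_eqF// nsq_gt0.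
have -> : (kap p \in coordsK @^-1` B12) = (p \in B12); last by [].
by apply/idP/idP => /set_mem /=; [rewrite coordsK_kap// => /mem_set|move=> pB; apply/mem_set; rewrite /= coordsK_kap].
Qed.

Let nsq_ge1 (p : RR) : p \in B12 -> 1 <= nsq p.
Proof.
move/set_mem => [/=]; rewrite /I12/= in_itv/= => /andP[p1 _] _.
by rewrite /nsq ler_wpDr ?sqr_ge0// -[leLHS](expr1n _ 2) ler_pXn2r ?nnegrE// (le_trans _ p1).
Qed.

Let annular2 : square_integrable_fun (@mu_K R) (dot_Rstar R) annular.
Proof.
split; first exact: strongly_annular.
rewrite ge0_integral_K; last 2 first.
- by apply/measurable_EFinP; exact: measurable_dnorm.
- by move=> t; rewrite lee_fin dnorm_ge0.
set M := dnorm (dot_Rstar R) g0; have M0 : 0 <= M by exact: dnorm_ge0.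
apply: le_lt_trans (ltry M); rewrite -[M%:E]mule1 -leb2_B12 -[B12]setIT -(integral_indic leb2 measurableT mB12).
rewrite -(ge0_integralZl_EFin leb2 measurableT (f1 := fun p => (\1_B12 p)%:E))//; last first.
  by apply/measurable_EFinP; exact: measurable_indic.
apply: ae_ge0_le_integral => //.
- by move=> t _; rewrite mule_ge0 ?lee_fin ?dnorm_ge0 ?nsqinv_ge0.
- apply: emeasurable_funM; last by apply/measurable_EFinP; exact: measurable_nsqinv.
  apply/measurable_EFinP; exact: (measurableT_comp (measurable_dnorm strongly_annular) (@measurable_kap R)).
- by move=> p _; rewrite mule_ge0 ?lee_fin.
- apply: emeasurable_funM; first exact: measurable_cst.
  by apply/measurable_EFinP; exact: measurable_indic.
- apply: filterS (@ae_fst_neq0 R) => p p0 _; rewrite annular_kap// indicE.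
  case: ifPn => pB; last by rewrite dnorm0 mul0e mule0.
  rewrite mule1 -EFinM lee_fin ler_piMr// invf_le1 ?nsq_ge1//.
  exact: lt_le_trans ltr01 (nsq_ge1 pB).
Qed.

Let xi0 : L2_K R := L2_of (@mu_K R) (dot_Rstar R) annular.

Let xi0_kap : \forall p \ae leb2, L2_fun xi0 (kap p) = if p \in B12 then g0 else 0.
Proof.
apply: filterS2 (@ae_fst_neq0 R) (ae_mu_K (L2_ofE annular2)) => p p0 ->.
exact: annular_kap.
Qed.

Let g0_rstar : \forall t \ae leb, L2_fun g0 (rstar t) = bump (rstar t).
Proof. exact: ae_mu_Rstar (L2_ofE bump2). Qed.

Let zero_rstar : \forall t \ae leb, L2_fun (0 : L2_Rstar R) (rstar t) = 0.
Proof. exact: ae_mu_Rstar (L2_fun0 _ _). Qed.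

Let g0_neq0 : g0 != 0.
Proof.
apply/eqP => g00; have I0 : leb I12 != 0%E by rewrite [leb I12]leb_I12 onee_neq0.
have [t tI [t0 [gt zt]]] := ae_exists mI12 I0 (filterI (@ae_neq0 R) (filterI g0_rstar zero_rstar)).
have := bump_rstar t0; rewrite -gt g00 zt indicE mem_set// /csq/= expr0n addr0 => /eqP.
by rewrite eq_sym oner_eq0.
Qed.

(** Square integrability of sigma is asserted independently of any g and eta, so a vector is
    exhibited. Its admissibility integral is at most the measure of the square. *)
Lemma exists_admissible : exists2 xi : L2_K R, xi != 0 &
  forall e, representative xi e -> (admissibility e < +oo)%E.
Proof.
exists xi0.
  apply/eqP => x0; have B0 : leb2 B12 != 0%E by rewrite [leb2 B12]leb2_B12 onee_neq0.
  have z0 : \forall p \ae leb2, L2_fun (0 : L2_K R) (kap p) = 0 by exact: ae_mu_K (L2_fun0 _ _).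
  have [p pB [xp zp]] := ae_exists mB12 B0 (filterI xi0_kap z0).
  by move: xp; rewrite x0 zp mem_set// => /esym/eqP; rewrite (negbTE g0_neq0).
move=> e eE; pose a (p : RR) : R[i] := (\1_B12 p : R)%:C%C.
have ma : cmeasurable a by apply: cmeasurable_real; exact: measurable_indic.
rewrite (admissibility_tensor eE ma mbump); last first.
  apply: filterS xi0_kap => p ->; rewrite /a indicE; case: ifP => _.
    by apply: filterS g0_rstar => t ->; rewrite mul1r.
  by apply: filterS zero_rstar => t ->; rewrite mul0r.
rewrite integral_bump mule1; apply: le_lt_trans (ltry 1).
rewrite -leb2_B12 -[B12]setIT -(integral_indic leb2 measurableT mB12).
apply: ge0_le_integral => //.
- by move=> p _; rewrite lee_fin mulr_ge0 ?csq_ge0 ?invr_ge0 ?sqr_ge0.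
- apply/measurable_EFinP; apply: measurable_funM; last exact: measurable_csq.
  by rewrite /nsq; mfun.
- by apply/measurable_EFinP; exact: measurable_indic.
- move=> p _; rewrite lee_fin /a csq_real indicE.
  have [pB|_] := boolP (p \in B12); last by rewrite expr0n mulr0.
  have n1 := nsq_ge1 pB.
  have n0 := lt_le_trans ltr01 n1.
  by rewrite expr1n mulr1 invf_le1 ?exprn_gt0// -[leLHS](expr1n _ 2) ler_pXn2r ?nnegrE// (ltW n0).
Qed.

End admissible_vector.

Theorem theorem5p9 (R : realType) (sigma : G2 R -> L2_K R -> L2_K R)
    (sigma_unitary : unitary_representation (dot_K R) sigma)
    (sigmaE : sigma_formula sigma) :
  (forall (g : L2_Rstar R) (eta : L2_rV2 R) (E : L2_K R),
     (\int[@mu_Rstar R]_nu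
        ((Normc.normc ((Num.sqrt `|val nu|)%:C%C * L2_fun g nu)) ^+ 2)%:E = 1)%E ->
     hnorm (dot_rV2 R) eta = 1 ->
     (\forall k \ae @mu_K R, \forall nu \ae @mu_Rstar R,
        L2_fun (L2_fun E k) nu =
        (L2_fun eta (delta_mx 0 0 *m invmx (K_mx k)))^*%C
          / (`|\det (K_mx k)|)%:C%C * L2_fun g nu) ->
     (forall F : L2_K R, square_integrable_fun (@haar_G2 R) (@complex_dot R)
        (wavelet_transform sigma E F)) /\
     let V_E F : L2_G2 R := L2_of (@haar_G2 R) (@complex_dot R) (wavelet_transform sigma E F) in
     linear_isometry (dot_K R) (dot_G2 R) V_E /\
     intertwines (dot_K R) (dot_G2 R) V_E sigma (@left_regular R)) /\
  square_integrable_representation (dot_K R) sigma.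
Proof.
split.
  move=> g eta E g1 eta1 EE; have [e eE] := exists_representative E.
  have e1 := admissibility_wavelet g1 eta1 EE eE.
  split=> [F|]; first by apply: (wavelet_square_integrable sigmaE F eE); rewrite e1 ltry.
  have lin := V_E_linear sigmaE eE e1; have iso := V_E_isometry sigmaE eE e1.
  split; first by split.
  split=> //; first by exists 1 => F; rewrite mul1r iso.
  exact: (V_E_intertwines sigma_unitary sigmaE eE e1).
split=> //; first exact: (sigma_irreducible sigmaE).
have [xi xi0 xioo] := exists_admissible R; exists xi => //.
have [e eE] := exists_representative xi.
exact: (wavelet_square_integrable sigmaE xi eE (xioo e eE)).
Qed.
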